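(* Let $(u_1^\varepsilon,u_2^\varepsilon)$ be the smooth solution of the penalized system, let $\theta_1^\varepsilon:=u_1^\varepsilon-u_2^\varepsilon-\psi_1$, $\theta_2^\varepsilon:=u_2^\varepsilon-u_1^\varepsilon-\psi_2$, and, for $i\in\{1,2\}$ and $x_0\in U$, let $(\sigma^{1,\varepsilon},\sigma^{2,\varepsilon})$ be the solution of the adjoint system (systems and hypotheses are written in the context). Then there exists a constant $C>0$, independent of $\varepsilon>0$ (and of $x_0$ and $i$), such that $$\int_U(\gamma^\varepsilon)'(\theta_1^\varepsilon)\,\sigma^{1,\varepsilon}\,dx+\int_U(\gamma^\varepsilon)'(\theta_2^\varepsilon)\,\sigma^{2,\varepsilon}\,dx\le C.$$
   Context: $U\subset\mathbb R^n$ ($n\ge2$) is an open bounded domain with smooth boundary; $H_1,H_2:\overline U\times\mathbb R^n\to\mathbb R$ and $\psi_1,\psi_2:\overline U\to\mathbb R$ are smooth, $\psi_1,\psi_2\ge\alpha$ in $\overline U$ for some $\alpha>0$. Standing assumptions ($j=1,2$): (1) $H_j(x,\cdot)$ is convex for every $x\in\overline U$; (2) $\lim_{|p|\to\infty}H_j(x,p)/|p|=+\infty$ uniformly in $x$; (3) $|D_xH_j|$ is bounded on $\overline U\times\mathbb R^n$; (4) there are $\Phi_1,\Phi_2\in C^2(U)\cap C^1(\overline U)$ with $\Phi_j=0$ on $\partial U$, $-\psi_2\le\Phi_1-\Phi_2\le\psi_1$ and $\Phi_j+H_j(x,D\Phi_j)<0$ in $\overline U$. $\gamma:\mathbb R\to[0,+\infty)$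 is smooth and convex with $\gamma(s)=0$ for $s\le0$, $\gamma(s)>0$ and $0<\gamma'(s)\le1$ for $s>0$, $\lim_{s\to+\infty}\gamma(s)=+\infty$; $\gamma^\varepsilon(s):=\gamma(s/\varepsilon)$. Penalized system: $u_1^\varepsilon+H_1(x,Du_1^\varepsilon)+\gamma^\varepsilon(\theta_1^\varepsilon)=\varepsilon\Delta u_1^\varepsilon$, $u_2^\varepsilon+H_2(x,Du_2^\varepsilon)+\gamma^\varepsilon(\theta_2^\varepsilon)=\varepsilon\Delta u_2^\varepsilon$ in $U$, $u_1^\varepsilon=u_2^\varepsilon=0$ on $\partial U$. Adjoint system: $$(1+(\gamma^\varepsilon)'(\theta_1^\varepsilon))\sigma^{1,\varepsilon}-\mathrm{div}(D_pH_1(x,Du_1^\varepsilon)\sigma^{1,\varepsilon})-(\gamma^\varepsilon)'(\theta_2^\varepsilon)\sigma^{2,\varepsilon}=\varepsilon\Delta\sigma^{1,\varepsilon}+(2-i)\delta_{x_0},$$ $$(1+(\gamma^\varepsilon)'(\theta_2^\varepsilon))\sigma^{2,\varepsilon}-\mathrm{div}(D_pH_2(x,Du_2^\varepsilon)\sigma^{2,\varepsilon})-(\gamma^\varepsilon)'(\theta_1^\varepsilon)\sigma^{1,\varepsilon}=\varepsilon\Delta\sigma^{2,\varepsilon}+(i-1)\delta_{x_0}$$ in $U$ (sense of distributions), $\sigma^{1,\varepsilon}=\sigma^{2,\varepsilon}=0$ on $\partial U$, with $\delta_{x_0}$ the Dirac measure at $x_0$. It has a unique solution (Fredholm alternative),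 with $\sigma^{j,\varepsilon}\in C^\infty(U\setminus\{x_0\})$. *)

(* Defs.v *)
From HB Require Import structures.
From mathcomp Require Import all_boot all_order all_algebra.
From mathcomp Require Import all_classical all_reals all_analysis.

Set Implicit Arguments.
Unset Strict Implicit.
Unset Printing Implicit Defensive.

Import Order.TTheory GRing.Theory Num.Theory.
Import numFieldNormedType.Exports.

Local Open Scope classical_set_scope.
Local Open Scope ring_scope.

(** The library has Lebesgue measure on R and binary products; the measure on
    n-tuples is the n-fold product, built one coordinate at a time. *)

Section lebesgue_step.
Context {R : realType} (n : nat).
Local Notation TR := (measurableTypeR R).
Variable m : {sigma_finite_measure set (n.-tuple TR) -> \bar R}.

Definition tcons (p : TR * n.-tuple TR) : n.+1.-tuple TR :=
  [tuple of p.1 :: p.2].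

Lemma measurable_tcons : measurable_fun [set: TR * n.-tuple TR] tcons.
Proof. by apply: measurable_cons. Qed.

Definition lebesgue_step : set (n.+1.-tuple TR) -> \bar R :=
  pushforward (lebesgue_measure \x m)%E tcons.

Let mp (A : set (n.+1.-tuple TR)) :
  measurable A -> measurable (tcons @^-1` A).
Proof. by move=> mA; rewrite -[X in measurable X]setTI; exact: measurable_tcons. Qed.

Let step0 : lebesgue_step set0 = 0%E.
Proof. by rewrite /lebesgue_step /pushforward preimage_set0 measure0. Qed.

Let step_ge0 A : (0 <= lebesgue_step A)%E.
Proof. by rewrite /lebesgue_step /pushforward; apply: measure_ge0. Qed.

Let step_sigma_additive : semi_sigma_additive lebesgue_step.
Proof.
move=> F mF tF mUF; rewrite /lebesgue_step /pushforward preimage_bigcup.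
apply: measure_semi_sigma_additive.
- by move=> k; exact: mp.
- apply/trivIsetP => /= i j _ _ ij; rewrite -preimage_setI.
  by move/trivIsetP : tF => /(_ _ _ _ _ ij) ->//; rewrite preimage_set0.
- by rewrite -preimage_bigcup; exact: mp.
Qed.

HB.instance Definition _ := isMeasure.Build _ _ _ lebesgue_step
  step0 step_ge0 step_sigma_additive.

Let step_sigma_finite : sigma_finite setT lebesgue_step.
Proof.
have [F FT Foo] := sigma_finiteT (@lebesgue_measure R).
have [G GT Goo] := sigma_finiteT m.
have bT : measurable_fun [set: n.+1.-tuple TR]
    (fun t => [tuple of behead t] : n.-tuple TR) by exact: measurable_behead.
have hT : measurable_fun [set: n.+1.-tuple TR] (fun t => tnth t ord0 : TR).
  exact: measurable_tnth.
pose B i j := [set t : n.+1.-tuple TR |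
  F i (tnth t ord0) /\ G j [tuple of behead t]].
pose S k := if @unpickle (nat * nat)%type k is Some p then B p.1 p.2 else set0.
exists S.
  rewrite predeqE => t; split=> // _.
  have : setT (tnth t ord0) by []. rewrite FT => -[i _ Fi].
  have : setT ([tuple of behead t] : n.-tuple TR) by []. rewrite GT => -[j _ Gj].
  by exists (pickle (i, j)) => //; rewrite /S pickleK.
move=> k; rewrite /S; case: unpickle => [[i j]|]; last by rewrite measure0.
split => /=.
  have [mF _] := Foo i; have [mG _] := Goo j.
  apply: measurableI.
  - by rewrite -[X in measurable X]setTI; exact: hT.
  - by rewrite -[X in measurable X]setTI; exact: bT.
have [mF Fi] := Foo i; have [mG Gj] := Goo j.
rewrite /lebesgue_step /pushforward.
have -> : tcons @^-1` B i j = F i `*` G j.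
  apply/seteqP; split=> -[x t] [/= A1 A2]; split=> //=.
  - by move: A2; congr (G j _); apply: val_inj.
  - by move: A2; congr (G j _); apply: val_inj.
rewrite product_measure1E//.
by rewrite lte_mul_pinfty// ge0_fin_numE.
Qed.

HB.instance Definition _ := Measure_isSigmaFinite.Build _ _ _ lebesgue_step
  step_sigma_finite.

End lebesgue_step.

(** R^0 is a point, of mass 1. *)
Section lebesgue0.
Context {R : realType}.

Definition lebesgue0 : set (0.-tuple (measurableTypeR R)) -> \bar R :=
  \d_[tuple].
HB.instance Definition _ := Measure.on lebesgue0.
Let sf : sigma_finite setT lebesgue0.
Proof.
by apply: fin_num_fun_sigma_finite; [rewrite measure0|move=> A mA].
Qed.
HB.instance Definition _ := Measure_isSigmaFinite.Build _ _ _ lebesgue0 sf.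

End lebesgue0.

Fixpoint lebesgue_tuple (R : realType) (n : nat) :
    {sigma_finite_measure set (n.-tuple (measurableTypeR R)) -> \bar R} :=
  if n is k.+1 then lebesgue_step (lebesgue_tuple R k) else @lebesgue0 R.

Lemma lebesgue_tuple_box (R : realType) (n : nat)
    (A : 'I_n -> set (measurableTypeR R)) :
  (forall i, measurable (A i)) ->
  lebesgue_tuple R n [set t | forall i, A i (tnth t i)]
  = (\prod_(i < n) lebesgue_measure (A i))%E.
Proof.
elim: n A => [|n IH] A mA.
  rewrite big_ord0 /= /lebesgue0 diracE mem_set//=.
  by case.
rewrite big_ord_recl -(IH (fun i => A (lift ord0 i))) //.
have mB : measurable [set t : n.-tuple (measurableTypeR R) |
    forall i, A (lift ord0 i) (tnth t i)].
  rewrite (_ : mkset _ = \bigcap_(i in [set: 'I_n])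
      ((fun t => tnth t i) @^-1` A (lift ord0 i))); last first.
    by apply/seteqP; split=> [t h i _|t h i]; [exact: h|exact: (h i I)].
  apply: fin_bigcap_measurable => // i _.
  by rewrite -[X in measurable X]setTI; apply: measurable_tnth.
rewrite /= /lebesgue_step /pushforward -product_measure1E//.
congr (_ _); apply/seteqP; split=> -[x t] /=.
- move=> h; split; first exact: (h ord0).
  by move=> i /=; have := h (lift ord0 i); rewrite tnthS.
- move=> [h0 h] i; case: (unliftP ord0 i) => [j ->|->] //=.
  by rewrite tnthS; exact: h.
Qed.

(** R^n is ['rV[R]_n]; its points are identified with n-tuples when integrating. *)

Definition row_of_tuple (R : realType) (n : nat)
    (t : n.-tuple (measurableTypeR R)) : 'rV[R]_n := \row_i tnth t i.

Definition dx_integral (R : realType) (n : nat) (U : set 'rV[R]_n)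
    (f : 'rV[R]_n -> R) : R :=
  \int[lebesgue_tuple R n]_(t in @row_of_tuple R n @^-1` U)
    f (row_of_tuple t).

Definition dx_integrable (R : realType) (n : nat) (U : set 'rV[R]_n)
    (f : 'rV[R]_n -> R) : Prop :=
  (lebesgue_tuple R n).-integrable (@row_of_tuple R n @^-1` U)
    (fun t => (f (row_of_tuple t))%:E).

(** The norm that the library puts on ['rV[R]_n] is the sup norm. *)
Definition dot (R : realType) (n : nat) (p q : 'rV[R]_n) : R :=
  \sum_i p 0 i * q 0 i.

Definition enorm (R : realType) (n : nat) (p : 'rV[R]_n) : R :=
  Num.sqrt (dot p p).

Definition grad (R : realType) (n : nat) (f : 'rV[R]_n -> R) (x : 'rV[R]_n) :
    'rV[R]_n :=
  \row_i 'D_(delta_mx 0 i) f x.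

Definition laplacian (R : realType) (n : nat) (f : 'rV[R]_n -> R)
    (x : 'rV[R]_n) : R :=
  \sum_i 'D_(delta_mx 0 i) ('D_(delta_mx 0 i) f) x.

(** The gradient up to the boundary: for [f] in C^1(closure U) this is the value
    at [x] of the continuous extension to [closure U] of the gradient of [f]. *)
Definition grad_bar (R : realType) (n : nat) (U : set 'rV[R]_n)
    (f : 'rV[R]_n -> R) (x : 'rV[R]_n) : 'rV[R]_n :=
  \row_i lim ('D_(delta_mx 0 i) f y @[y --> within U (nbhs x)]).

(** [U] is meant to be open and [V] finite dimensional. Quantifying over all
    directions [v], rather than over a basis, changes nothing and makes sense on
    [R], on ['rV[R]_n] and on ['rV[R]_n * 'rV[R]_n] alike. *)

Fixpoint Ck_on (R : realType) (V : normedModType R) (k : nat) (U : set V)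
    (f : V -> R) : Prop :=
  (forall x, U x -> {for x, continuous f}) /\
  if k is j.+1 then
    forall v : V, (forall x, U x -> derivable f x v) /\ Ck_on j U ('D_v f)
  else True.

(** C^k(closure U): the partial derivatives up to order k exist in [U] and extend
    continuously to [closure U]; [fv] below is the extended derivative, while [f]
    itself is a function on [closure U]. *)
Fixpoint Ck_closure (R : realType) (V : normedModType R) (k : nat) (U : set V)
    (f : V -> R) : Prop :=
  {within closure U, continuous f} /\
  if k is j.+1 then
    forall v : V, exists fv : V -> R,
      (forall x, U x -> is_derive x v f (fv x)) /\ Ck_closure j U fv
  else True.

Definition smooth_on (R : realType) (V : normedModType R) (U : set V)
    (f : V -> R) : Prop :=
  forall k, Ck_on k U f.

Definition smooth_closure (R : realType) (V : normedModType R) (U : set V)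
    (f : V -> R) : Prop :=
  forall k, Ck_closure k U f.

Definition test_function (R : realType) (n : nat) (U : set 'rV[R]_n)
    (phi : 'rV[R]_n -> R) : Prop :=
  smooth_on setT phi /\
  exists K : set 'rV[R]_n,
    [/\ compact K, K `<=` U & forall x, ~ K x -> phi x = 0].

(** [U] is open, so this is its topological boundary. *)
Definition bdry (R : realType) (n : nat) (U : set 'rV[R]_n) : set 'rV[R]_n :=
  closure U `\` U.

(** Near each boundary point, after relabelling and reorienting the axes, [U] is
    the set of points lying above the graph of a smooth function of the other
    n - 1 coordinates. *)
Definition smooth_boundary (R : realType) (n : nat) (U : set 'rV[R]_n) : Prop :=
  forall x, bdry U x ->
  exists (i : 'I_n) (b : bool) (g : 'rV[R]_(n.-1) -> R),
    smooth_on setT g /\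
    \forall y \near x, U y <-> g (col' i y) < (-1) ^+ b * y 0 i.

Definition smooth_bounded_domain (R : realType) (n : nat)
    (U : set 'rV[R]_n) : Prop :=
  [/\ open U, connected U, bounded_set U & smooth_boundary U].

Record hamiltonian (R : realType) (n : nat) (U : set 'rV[R]_n)
    (H : 'rV[R]_n -> 'rV[R]_n -> R) : Prop := {
  ham_smooth : smooth_closure (U `*` setT) (fun z => H z.1 z.2);
  ham_convex : forall x, closure U x -> convex_function setT (H x);
  ham_superlinear : forall M : R, exists r : R, forall x p,
    closure U x -> 0 < enorm p -> r <= enorm p -> M <= H x p / enorm p;
  ham_DxH_bounded : exists K : R, forall x p,
    closure U x -> enorm (grad_bar U (H ^~ p) x) <= K
}.

Record obstacle (R : realType) (n : nat) (U : set 'rV[R]_n) (alpha : R)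
    (psi : 'rV[R]_n -> R) : Prop := {
  obs_smooth : smooth_closure U psi;
  obs_ge : forall x, closure U x -> alpha <= psi x
}.

Record strict_subsolution (R : realType) (n : nat) (U : set 'rV[R]_n)
    (H : 'rV[R]_n -> 'rV[R]_n -> R) (Phi : 'rV[R]_n -> R) : Prop := {
  sub_C2 : Ck_on 2 U Phi;
  sub_C1_closure : Ck_closure 1 U Phi;
  sub_bdry : forall x, bdry U x -> Phi x = 0;
  sub_lt0 : forall x, closure U x -> Phi x + H x (grad_bar U Phi x) < 0
}.

Definition compatible (R : realType) (n : nat) (U : set 'rV[R]_n)
    (H1 H2 : 'rV[R]_n -> 'rV[R]_n -> R) (psi1 psi2 : 'rV[R]_n -> R) : Prop :=
  exists Phi1 Phi2 : 'rV[R]_n -> R,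
    [/\ strict_subsolution U H1 Phi1, strict_subsolution U H2 Phi2 &
        forall x, closure U x -> - psi2 x <= Phi1 x - Phi2 x <= psi1 x].

Record penalty (R : realType) (gamma : R -> R) : Prop := {
  pen_smooth : smooth_on (setT : set R^o) gamma;
  pen_convex : convex_function (setT : set R^o) gamma;
  pen_ge0 : forall s : R, 0 <= gamma s;
  pen_eq0 : forall s : R, s <= 0 -> gamma s = 0;
  pen_gt0 : forall s : R, 0 < s -> 0 < gamma s;
  pen_derive : forall s : R, 0 < s -> 0 < derive1 gamma s <= 1;
  pen_lim : gamma s @[s --> +oo] --> +oo
}.

Definition gamma_eps (R : realType) (gamma : R -> R) (eps : R) : R -> R :=
  fun s => gamma (s / eps).

Definition theta (R : realType) (n : nat) (u v psi : 'rV[R]_n -> R) :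
    'rV[R]_n -> R :=
  fun x => u x - v x - psi x.

Record penalized_solution (R : realType) (n : nat) (U : set 'rV[R]_n)
    (H1 H2 : 'rV[R]_n -> 'rV[R]_n -> R) (psi1 psi2 : 'rV[R]_n -> R)
    (gamma : R -> R) (eps : R) (u1 u2 : 'rV[R]_n -> R) : Prop := {
  psol_smooth1 : smooth_closure U u1;
  psol_smooth2 : smooth_closure U u2;
  psol_eq1 : forall x, U x ->
    u1 x + H1 x (grad u1 x) + gamma_eps gamma eps (theta u1 u2 psi1 x)
    = eps * laplacian u1 x;
  psol_eq2 : forall x, U x ->
    u2 x + H2 x (grad u2 x) + gamma_eps gamma eps (theta u2 u1 psi2 x)
    = eps * laplacian u2 x;
  psol_bdry : forall x, bdry U x -> u1 x = 0 /\ u2 x = 0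
}.

(** [a * s - div (b * s) - c * t = eps * Laplacian s + k * delta_{x0}] in the sense
    of distributions in [U]: all derivatives of [s] are moved onto the test
    function, and the Dirac mass evaluates it at [x0]. *)
Definition adjoint_equation (R : realType) (n : nat) (U : set 'rV[R]_n)
    (eps : R) (a : 'rV[R]_n -> R) (b : 'rV[R]_n -> 'rV[R]_n)
    (c : 'rV[R]_n -> R) (k : R) (x0 : 'rV[R]_n) (s t : 'rV[R]_n -> R) : Prop :=
  forall phi, test_function U phi ->
    dx_integral U (fun x => a x * s x * phi x + s x * dot (b x) (grad phi x)
                            - c x * t x * phi x)
    = dx_integral U (fun x => eps * (s x * laplacian phi x)) + k * phi x0.

(** An integrable function on [U], smooth in [U] away from the pole [x0], that
    attains the boundary value 0 continuously. *)
Record adjoint_function (R : realType) (n : nat) (U : set 'rV[R]_n)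
    (x0 : 'rV[R]_n) (s : 'rV[R]_n -> R) : Prop := {
  adj_integrable : dx_integrable U s;
  adj_smooth : smooth_on (U `\ x0) s;
  adj_continuous : {within closure U `\ x0, continuous s};
  adj_bdry : forall x, bdry U x -> s x = 0
}.

Record adjoint_solution (R : realType) (n : nat) (U : set 'rV[R]_n)
    (H1 H2 : 'rV[R]_n -> 'rV[R]_n -> R) (psi1 psi2 : 'rV[R]_n -> R)
    (gamma : R -> R) (eps : R) (u1 u2 : 'rV[R]_n -> R) (i : nat)
    (x0 : 'rV[R]_n) (s1 s2 : 'rV[R]_n -> R) : Prop := {
  asol_fun1 : adjoint_function U x0 s1;
  asol_fun2 : adjoint_function U x0 s2;
  asol_eq1 : adjoint_equation U eps
    (fun x => 1 + derive1 (gamma_eps gamma eps) (theta u1 u2 psi1 x))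
    (fun x => grad (H1 x) (grad u1 x))
    (fun x => derive1 (gamma_eps gamma eps) (theta u2 u1 psi2 x))
    (2%:R - i%:R) x0 s1 s2;
  asol_eq2 : adjoint_equation U eps
    (fun x => 1 + derive1 (gamma_eps gamma eps) (theta u2 u1 psi2 x))
    (fun x => grad (H2 x) (grad u2 x))
    (fun x => derive1 (gamma_eps gamma eps) (theta u1 u2 psi1 x))
    (i%:R - 1) x0 s2 s1
}.

(* Main.v *)
(** Write [theta_j], [b_j = D_p H_j(x, D u_j)], and let
      L_j phi = phi_j + gamma'(theta_j) (phi_j - phi_(3-j)) + b_j . D phi_j - eps Lap phi_j
    be the operator whose adjoint governs [sigma]. By the maximum principle [|u_j| <= C0],
    where [C0] bounds [|H_j(x, 0)|]: at an interior maximum the gradient vanishes and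
    [gamma >= 0], while at a minimum over both components [theta_j <= - alpha], so that the
    penalty vanishes. Hence [phi_j = u_j + C0] has values in [[0, 2 C0]], and convexity of
    [H_j] and of [gamma] gives [L_j phi >= alpha gamma'(theta_j)]. Pairing with [sigma]
    formally yields [alpha * sum_j int gamma'(theta_j) sigma^j <= phi_i(x0) <= 2 C0].

    Two points make the pairing rigorous. First, [phi] does not vanish on the boundary and
    the sign of [sigma] is unknown, so [sigma] is replaced by [B(sigma)], with [B] a convex
    C^2 regularisation, at distance [O(delta)], of the positive part vanishing near 0. As
    [sigma] vanishes on the boundary, [B(sigma)] has compact support apart from the pole, and
    cutting off costs nothing. Second, [sigma] is merely integrable at the pole: there one
    mollifies the equation, multiplies it by [B'] of the mollified [sigma] (Kato's
    inequality), and passes to the limit with Fatou's lemma, which loses mass in the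
    harmless direction only. Finally [delta] tends to 0. *)

Require Import Defs.
From mathcomp Require Import all_boot all_order all_algebra.
From mathcomp Require Import all_classical all_reals all_analysis.
From mathcomp Require Import measurable_realfun.
From mathcomp Require Import ring lra.

Set Implicit Arguments.
Unset Strict Implicit.
Unset Printing Implicit Defensive.

Import Order.TTheory GRing.Theory Num.Theory.
Import numFieldNormedType.Exports.

Local Open Scope classical_set_scope.
Local Open Scope ring_scope.

(** * Directional derivatives and Taylor expansions *)

(** The constant [2 * C0 / alpha] must not see [eps], yet two bounds met on the way do:
    [Mg = eps^-1] for the derivative of the rescaled penalty, and [Mb] for the divergence of the
    drift, which involves second derivatives of [u_j]. The estimates are arranged so that both occur
    only with a factor [delta], and disappear as [delta] tends to 0 at fixed [eps].

    In place of an integrable majorant, the mollified integrands are bounded by averages of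
    [|s| + |p|] over small cubes, whose total integral is constant by Tonelli. The delicate term is
    the commutator of mollification with the drift: the derivative of the kernel costs [eta^-1], and
    the Lipschitz drift gives back [eta].

    All derivatives are directional, so continuous partial derivatives are turned into Taylor
    expansions by walking along the axes. The mollifying kernel is a product of values of [gamma], a
    smooth function positive exactly on the positive axis. *)

Lemma is_derive_quotient (R : numFieldType) (V V' W : normedModType R)
    (f : V -> W) (g : V' -> W) (x v : V) (y w : V') (d : W) :
  (forall h : R, f (h *: v + x) - f x = g (h *: w + y) - g y) ->
  is_derive x v f d -> is_derive y w g d.
Proof.
move=> fg [df <-].
have E : (fun h : R => h^-1 *: ((f \o shift x) (h *: v) - f x)) =
         (fun h : R => h^-1 *: ((g \o shift y) (h *: w) - g y)).
  by apply/funext => h /=; rewrite fg.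
split; first by rewrite /derivable -E.
by rewrite /derive -E.
Qed.

Lemma is_derive_line (R : numFieldType) (V W : normedModType R) (f : V -> W)
    (x v : V) (t : R) (d : W) :
  is_derive (x + t *: v) v f d -> is_derive t 1 (fun s => f (x + s *: v)) d.
Proof.
apply: is_derive_quotient => h /=.
congr (f _ - _); rewrite scaler1 scalerDl addrA addrAC addrC; congr (_ + _).
Qed.

Lemma is_derive_line0 (R : numFieldType) (V W : normedModType R) (f : V -> W)
    (x v : V) (d : W) :
  is_derive (0 : R) 1 (fun s : R => f (x + s *: v)) d -> is_derive x v f d.
Proof.
apply: is_derive_quotient => h /=.
by rewrite scaler1 !addr0 scale0r addr0 (addrC x).
Qed.

Lemma is_derive_scale (R : realType) (V : normedModType R) (f : V -> R)
    (x v : V) (c d : R) :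
  is_derive x v f d -> is_derive x (c *: v) f (c * d).
Proof.
move=> df; apply: is_derive_line0.
have df0 : is_derive (c * 0) 1 (fun s : R => f (x + s *: v)) d.
  by rewrite mulr0; apply: is_derive_line; rewrite scale0r addr0.
have dc : is_derive (0 : R) 1 (fun s : R => c * s) c.
  have := @is_deriveZ R R R id c 0 1 1 (is_derive_id _ _).
  by rewrite /GRing.scale /= mulr1.
have := @is_derive1_comp _ (fun s : R => f (x + s *: v)) (fun s => c * s) 0 d c df0 dc.
rewrite mulrC; apply: is_derive_quotient => h /=.
rewrite scaler1 addr0 mulr0 scale0r !addr0 scalerA (mulrC h) (addrC x) scale0r addr0 //.
Qed.

Lemma is_derive_affine (R : realType) (V : normedModType R) (f : V -> R)
    (w x v : V) (c d : R) :
  is_derive (w + c *: x) v f d -> is_derive x v (fun z => f (w + c *: z)) (c * d).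
Proof.
move=> /(@is_derive_scale _ _ _ _ _ c); apply: is_derive_quotient => h.
by rewrite scalerDr !scalerA (mulrC h) addrCA.
Qed.

Lemma is_derive_continuous1 (R : numFieldType) (f : R -> R) (x d : R) :
  is_derive x 1 f d -> {for x, continuous f}.
Proof.
by move=> [df _]; apply: differentiable_continuous; apply/derivable1_diffP.
Qed.

(** The slope [d] is left free: the derivative at 0 gives a Taylor estimate, [d = 0] a Lipschitz
    bound, and [d = 0] with [M = 0] constancy. *)
Lemma mvt_dist (R : realType) (f f' : R -> R) (a d M : R) :
  (forall t : R, `|t| <= `|a| -> is_derive t 1 f (f' t)) ->
  (forall t, `|t| <= `|a| -> `|f' t - d| <= M) ->
  `|f a - f 0 - a * d| <= M * `|a|.
Proof.
move=> df fM.
have cf t : `|t| <= `|a| -> {for t, continuous f}.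
  by move=> /df; exact: is_derive_continuous1.
have [a0|a0|->] := ltgtP a 0; last by rewrite subrr mul0r subr0 normr0 mulr0.
- have [||c] := @MVT _ f f' a 0 a0.
  + move=> t; rewrite in_itv /= => /andP[at0 t0]; apply: df.
    by rewrite !ltr0_norm // lerN2 ltW.
  + apply: continuous_in_subspaceT => t /set_mem /=; rewrite in_itv /= => /andP[at0 t0].
    by apply: cf; rewrite (ltr0_norm a0) ler0_norm // lerN2.
  rewrite in_itv /= => /andP[ac c0] E.
  have -> : f a - f 0 - a * d = a * (f' c - d).
    by rewrite -(opprB (f 0)) E; ring.
  rewrite normrM mulrC ler_wpM2r //; apply: fM.
  by rewrite !ltr0_norm // lerN2 ltW.
- have [||c] := @MVT _ f f' 0 a a0.
  + move=> t; rewrite in_itv /= => /andP[at0 t0]; apply: df.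
    by rewrite !gtr0_norm // ltW.
  + apply: continuous_in_subspaceT => t /set_mem /=; rewrite in_itv /= => /andP[at0 t0].
    by apply: cf; rewrite (gtr0_norm a0) ger0_norm.
  rewrite in_itv /= => /andP[ac c0] E.
  have -> : f a - f 0 - a * d = a * (f' c - d).
    by rewrite E subr0; ring.
  rewrite normrM mulrC ler_wpM2r //; apply: fM.
  by rewrite !gtr0_norm // ltW.
Qed.

(** The increment is walked one basis vector at a time, each leg being an instance of [mvt_dist].
    The base point [z] varies in the induction; bounding [|z - x|] plus the length of the path keeps
    every leg in the ball around [x]. *)
Lemma taylor1_seq (R : realType) (V : normedModType R) (I : eqType) (s : seq I)
    (f : V -> R) (x : V) (r M : R) (e : I -> V) (f' : I -> V -> R) (d : I -> R)
    (c : I -> R) :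
  (forall k, `|e k| <= 1) ->
  (forall k y, `|y - x| < r -> is_derive y (e k) f (f' k y)) ->
  (forall k y, `|y - x| < r -> `|f' k y - d k| <= M) ->
  forall z, `|z - x| + \sum_(k <- s) `|c k| < r ->
  `|f (z + \sum_(k <- s) c k *: e k) - f z - \sum_(k <- s) c k * d k|
    <= M * \sum_(k <- s) `|c k|.
Proof.
move=> e1 df dM; elim: s => [|i s IH] z.
  by move=> _; rewrite !big_nil addr0 subrr subr0 normr0 mulr0.
rewrite !big_cons => zr.
have zi : `|z + c i *: e i - x| <= `|z - x| + `|c i|.
  rewrite addrAC (le_trans (ler_normD _ _)) // lerD2l normrZ.
  by rewrite -[leRHS]mulr1 ler_wpM2l.
have /IH : `|z + c i *: e i - x| + \sum_(k <- s) `|c k| < r.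
  by apply: le_lt_trans zr; rewrite addrA lerD2r.
have near_x t : `|t| <= `|c i| -> `|z + t *: e i - x| < r.
  move=> tc; apply: le_lt_trans zr; rewrite addrAC (le_trans (ler_normD _ _)) //.
  rewrite lerD2l normrZ -[leRHS]mulr1.
  have S0 : 0 <= \sum_(k <- s) `|c k| by apply: sumr_ge0.
  apply: (@le_trans _ _ (`|c i| * 1)); last by rewrite !mulr1 lerDl.
  by rewrite ler_pM.
have := @mvt_dist _ (fun t => f (z + t *: e i)) (fun t => f' i (z + t *: e i))
  (c i) (d i) M (fun t tc => is_derive_line (df i _ (near_x t tc)))
  (fun t tc => dM i _ (near_x t tc)).
rewrite scale0r addr0 => H1 H2; rewrite mulrDr addrA.
apply: le_trans (lerD H1 H2).
apply: le_trans (ler_normD _ _); rewrite le_eqVlt; apply/orP; left; apply/eqP.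
by congr (`|_|); ring.
Qed.

Lemma taylor1 (R : realType) (V : normedModType R) (m : nat) (f : V -> R) (x : V)
    (r M : R) (e : 'I_m -> V) (c : 'I_m -> V -> R) (f' : 'I_m -> V -> R)
    (d : 'I_m -> R) :
  (forall k, `|e k| <= 1) -> (forall k v, `|c k v| <= `|v|) ->
  (forall v, v = \sum_k c k v *: e k) -> 0 <= M ->
  (forall k y, `|y - x| < r -> is_derive y (e k) f (f' k y)) ->
  (forall k y, `|y - x| < r -> `|f' k y - d k| <= M) ->
  forall h, m%:R * `|h| < r ->
  `|f (x + h) - f x - \sum_k c k h * d k| <= M * m%:R * `|h|.
Proof.
move=> e1 cv ce M0 df dM h hr.
have sc : \sum_k `|c k h| <= m%:R * `|h|.
  apply: le_trans (ler_sum _ (fun k _ => cv k h)) _.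
  by rewrite sumr_const card_ord mulr_natl.
have xr : `|x - x| + \sum_k `|c k h| < r.
  by rewrite subrr normr0 add0r (le_lt_trans sc).
have := taylor1_seq e1 df dM xr; rewrite -ce => /le_trans; apply.
by rewrite -mulrA ler_wpM2l.
Qed.

(** Abstract in the basis [e] and its coordinates [c], so that one argument covers rows and pairs of
    rows. *)
Lemma C1_taylor (R : realType) (V : normedModType R) (m : nat) (f : V -> R) (x : V)
    (e : 'I_m -> V) (c : 'I_m -> V -> R) (f' : 'I_m -> V -> R) :
  (forall k, `|e k| <= 1) -> (forall k v, `|c k v| <= `|v|) ->
  (forall v, v = \sum_k c k v *: e k) ->
  (\forall y \near x, forall k, is_derive y (e k) f (f' k y)) ->
  (forall k, {for x, continuous (f' k)}) ->
  forall eps : R, 0 < eps -> \forall h \near (0 : V),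
    `|f (x + h) - f x - \sum_k c k h * f' k x| <= eps * `|h|.
Proof.
move=> e1 cv ce df cf eps eps0.
(* [m.+1] instead of [m] covers dimension 0; the total error [M * m] still stays below [eps]. *)
pose M := eps / m.+1%:R.
have M0 : 0 < M by rewrite divr_gt0.
have : \forall y \near x, forall k, is_derive y (e k) f (f' k y) /\
    `|f' k y - f' k x| <= M.
  have fM : \forall y \near x, forall k, `|f' k y - f' k x| <= M.
    apply: filter_forall => k.
    move: (cf k) => /cvgrPdist_le /(_ _ M0); apply: filterS => y.
    by rewrite distrC.
  by apply: filterS2 df fM => y df' fM' k; split.
move=> /nbhs_ballP[r /= r0 H].
have H1 k y : `|y - x| < r -> is_derive y (e k) f (f' k y).
  by move=> yx; apply: (H y _ k).1; rewrite -ball_normE /= distrC.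
have H2 k y : `|y - x| < r -> `|f' k y - f' k x| <= M.
  by move=> yx; apply: (H y _ k).2; rewrite -ball_normE /= distrC.
have m0 : 0 < r / m.+1%:R by rewrite divr_gt0.
near=> h.
have hr : m%:R * `|h| < r.
  have : `|h| < r / m.+1%:R by near: h; exact: dnbhs0_lt || exact: nbhs0_lt.
  rewrite ltr_pdivlMr // mulrC; apply: le_lt_trans.
  by rewrite ler_wpM2r // ler_nat.
apply: le_trans (taylor1 e1 cv ce (ltW M0) H1 H2 hr) _.
rewrite ler_wpM2r // /M -mulrA ler_piMr ?(ltW eps0) //.
by rewrite mulrC ler_pdivrMr // mul1r ler_nat.
Unshelve. all: by end_near. Qed.

(** A division-free form: [h = 0] is allowed, since both sides vanish there, so the estimate holds
    on a full neighbourhood of 0 and combines directly with other limits. *)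
Lemma is_derive_epsP (R : realType) (V : normedModType R) (f : V -> R) (x v : V)
    (d : R) :
  is_derive x v f d <-> forall eps : R, 0 < eps ->
    \forall h \near (0 : R), `|f (x + h *: v) - f x - h * d| <= eps * `|h|.
Proof.
have E (h eps : R) : h != 0 ->
    (`|d - h^-1 *: (f (h *: v + x) - f x)| <= eps) =
    (`|f (x + h *: v) - f x - h * d| <= eps * `|h|).
  move=> h0; rewrite (addrC x); set A := f _ - f x.
  have -> : d - h^-1 *: A = - (h^-1 * (A - h * d)).
    by rewrite /GRing.scale /=; field.
  by rewrite normrN normrM normfV mulrC ler_pdivrMr ?normr_gt0.
split.
- move=> [df dE] eps eps0.
  have : h^-1 *: (f (h *: v + x) - f x) @[h --> 0^'] --> d by rewrite -dE; exact: df.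
  move=> /cvgrPdist_le /(_ _ eps0).
  rewrite ?near_simpl near_withinE; apply: filterS => h H.
  have [->|h0] := eqVneq h 0; first by rewrite scale0r addr0 subrr mul0r subrr normr0 mulr0.
  by rewrite -E //; exact: H.
- move=> H.
  have cv : h^-1 *: (f (h *: v + x) - f x) @[h --> 0^'] --> d.
    apply/cvgrPdist_le => eps eps0; rewrite ?near_simpl near_withinE.
    by apply: filterS (H eps eps0) => h Hh h0; rewrite E.
  split; first exact: cvgP cv.
  exact: cvg_lim cv.
Qed.

Lemma coord_le_norm (R : realDomainType) (n : nat) (v : 'rV[R]_n) (k : 'I_n) :
  `|v 0 k| <= `|v|.
Proof.
rewrite [leRHS]/Num.norm /= mx_normrE; apply/bigmax_geP; right => /=.
by exists (0, k).
Qed.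

Lemma norm_le_coord (R : realDomainType) (n : nat) (v : 'rV[R]_n) (M : R) :
  0 <= M -> (forall k, `|v 0 k| <= M) -> `|v| <= M.
Proof.
move=> M0 vM; rewrite [leLHS]/Num.norm /= mx_normrE; apply/bigmax_leP; split => //.
by move=> [i k] _ /=; rewrite (ord1 i).
Qed.

Lemma norm_delta_le1 (R : realDomainType) (n : nat) (k : 'I_n) :
  `|delta_mx 0 k : 'rV[R]_n| <= 1.
Proof.
apply: norm_le_coord => // j; rewrite mxE eqxx /=.
by case: (j == k); rewrite ?normr1 ?normr0.
Qed.

Lemma rV_taylor (R : realType) (n : nat) (f : 'rV[R]_n -> R) (x : 'rV[R]_n)
    (f' : 'I_n -> 'rV[R]_n -> R) :
  (\forall y \near x, forall k, is_derive y (delta_mx 0 k) f (f' k y)) ->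
  (forall k, {for x, continuous (f' k)}) ->
  forall eps : R, 0 < eps -> \forall h \near (0 : 'rV[R]_n),
    `|f (x + h) - f x - \sum_k h 0 k * f' k x| <= eps * `|h|.
Proof.
move=> df cf eps eps0.
apply: (C1_taylor (e := fun k => delta_mx 0 k) (c := fun k v => v 0 k)) df cf _ eps0.
- by move=> k; exact: norm_delta_le1.
- by move=> k v; exact: coord_le_norm.
- by move=> v; rewrite {1}[v]row_sum_delta.
Qed.

Lemma is_derive_rV (R : realType) (n : nat) (f : 'rV[R]_n -> R) (x v : 'rV[R]_n)
    (f' : 'I_n -> 'rV[R]_n -> R) :
  (\forall y \near x, forall k, is_derive y (delta_mx 0 k) f (f' k y)) ->
  (forall k, {for x, continuous (f' k)}) ->
  is_derive x v f (\sum_k v 0 k * f' k x).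
Proof.
move=> df cf; apply/is_derive_epsP => eps eps0.
pose c := eps / (`|v| + 1).
have v1 : 0 < `|v| + 1 by rewrite ltr_wpDl.
have c0 : 0 < c by rewrite divr_gt0.
have hv : (h *: v) @[h --> (0 : R)] --> (0 : 'rV[R]_n).
  by rewrite -[X in _ --> X](scale0r v); apply: cvgZl; exact: cvg_id.
have := rV_taylor df cf c0 => /hv; rewrite /= ?near_simpl; apply: filterS => h.
rewrite mulr_sumr; under eq_bigr do rewrite mxE -mulrA.
move=> /le_trans; apply; rewrite normrZ mulrCA mulrC ler_wpM2r //.
by rewrite /c -mulrA ler_piMr ?(ltW eps0) // mulrC ler_pdivrMr // mul1r lerDl.
Qed.

Lemma norm_prod_le (R : realType) (n m : nat) (z : 'rV[R]_n * 'rV[R]_m) (M : R) :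
  `|z.1| <= M -> `|z.2| <= M -> `|z| <= M.
Proof. by move=> ? ?; rewrite prod_normE ge_max; apply/andP. Qed.

(** The norm of a pair is the maximum of the two norms, so the concatenated coordinates, indexed by
    ['I_(n + m)], meet the hypotheses of [C1_taylor]. *)
Lemma prod_taylor (R : realType) (n m : nat) (F : 'rV[R]_n * 'rV[R]_m -> R)
    (z : 'rV[R]_n * 'rV[R]_m)
    (F1 : 'I_n -> 'rV[R]_n * 'rV[R]_m -> R) (F2 : 'I_m -> 'rV[R]_n * 'rV[R]_m -> R) :
  (\forall y \near z, (forall k, is_derive y (delta_mx 0 k, 0) F (F1 k y)) /\
                      (forall l, is_derive y (0, delta_mx 0 l) F (F2 l y))) ->
  (forall k, {for z, continuous (F1 k)}) -> (forall l, {for z, continuous (F2 l)}) ->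
  forall eps : R, 0 < eps -> \forall h \near (0 : 'rV[R]_n * 'rV[R]_m),
    `|F (z + h) - F z - (\sum_k h.1 0 k * F1 k z + \sum_l h.2 0 l * F2 l z)|
      <= eps * `|h|.
Proof.
move=> dF c1 c2 eps eps0.
pose e (i : 'I_(n + m)) : 'rV[R]_n * 'rV[R]_m :=
  match fintype.split i with inl k => (delta_mx 0 k, 0) | inr l => (0, delta_mx 0 l) end.
pose c (i : 'I_(n + m)) (h : 'rV[R]_n * 'rV[R]_m) : R :=
  match fintype.split i with inl k => h.1 0 k | inr l => h.2 0 l end.
pose F' (i : 'I_(n + m)) :=
  match fintype.split i with inl k => F1 k | inr l => F2 l end.
have spl (k : 'I_n) : fintype.split (lshift m k) = inl k by exact: (unsplitK (inl k)).
have spr (l : 'I_m) : fintype.split (rshift n l) = inr l by exact: (unsplitK (inr l)).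
have E h : \sum_k c k h * F' k z =
    \sum_k h.1 0 k * F1 k z + \sum_l h.2 0 l * F2 l z.
  rewrite big_split_ord /=.
  by congr (_ + _); apply: eq_bigr => i _; rewrite /c /F' ?spl ?spr.
suff : \forall h \near (0 : 'rV[R]_n * 'rV[R]_m),
    `|F (z + h) - F z - \sum_k c k h * F' k z| <= eps * `|h|.
  by apply: filterS => h; rewrite E.
apply: (@C1_taylor R _ (n + m) F z e c F' _ _ _ _ _ _ eps0).
- move=> i; rewrite /e; case: (fintype.split i) => j; apply: norm_prod_le => /=;
    by rewrite ?normr0 ?ler01 ?norm_delta_le1.
- move=> i v; rewrite /c prod_normE le_max; case: (fintype.split i) => j;
    by rewrite coord_le_norm ?orbT.
- move=> v; rewrite big_split_ord /=.
  have -> : \sum_(i < n) c (lshift m i) v *: e (lshift m i) = (v.1, 0).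
    rewrite [v.1]row_sum_delta; elim/big_ind2: _ => //= [a b a' b' -> ->|i _].
      by congr (_, _); rewrite addr0.
    by rewrite /c /e spl; congr (_, _); rewrite scaler0.
  have -> : \sum_(i < m) c (rshift n i) v *: e (rshift n i) = (0, v.2).
    rewrite [v.2]row_sum_delta; elim/big_ind2: _ => //= [a b a' b' -> ->|i _].
      by congr (_, _); rewrite addr0.
    by rewrite /c /e spr; congr (_, _); rewrite scaler0.
  by case: v => a b /=; congr (_, _); rewrite /= ?addr0 ?add0r.
- by apply: filterS dF => y [d1 d2] i; rewrite /e /F'; case: (fintype.split i).
- by move=> i; rewrite /F'; case: (fintype.split i).
Qed.

(** The inner map [q] is only derivable along [v]. Its increment is then [O(|h|)], which is all that
    the Taylor expansion of [F] at [(x, q x)] requires. *)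
Lemma is_derive_chain (R : realType) (n m : nat) (F : 'rV[R]_n * 'rV[R]_m -> R)
    (q : 'rV[R]_n -> 'rV[R]_m) (x v : 'rV[R]_n) (q' : 'I_m -> R)
    (F1 : 'I_n -> 'rV[R]_n * 'rV[R]_m -> R) (F2 : 'I_m -> 'rV[R]_n * 'rV[R]_m -> R) :
  (\forall y \near (x, q x),
    (forall k, is_derive y (delta_mx 0 k, 0) F (F1 k y)) /\
    (forall l, is_derive y (0, delta_mx 0 l) F (F2 l y))) ->
  (forall k, {for (x, q x), continuous (F1 k)}) ->
  (forall l, {for (x, q x), continuous (F2 l)}) ->
  (forall l, is_derive x v (fun y => q y 0 l) (q' l)) ->
  is_derive x v (fun y => F (y, q y))
    (\sum_k v 0 k * F1 k (x, q x) + \sum_l q' l * F2 l (x, q x)).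
Proof.
move=> dF c1 c2 dq; apply/is_derive_epsP => eps eps0.
pose C := `|v| + \sum_l `|q' l| + 1.
have S0 : 0 <= \sum_l `|q' l| by apply: sumr_ge0.
have C0 : 0 < C by rewrite /C ltr_wpDl // addr_ge0.
pose D := 1 + \sum_l `|F2 l (x, q x)|.
have D0 : 0 < D by rewrite /D ltr_wpDr //; apply: sumr_ge0.
pose e1 := eps / (2 * C).
have e10 : 0 < e1 by rewrite divr_gt0 // mulr_gt0.
(* The bound 1 accounts for the summand 1 in [C] and gives [|w h| <= C * |h|]; the other bound makes
   the linearisation error of [q], weighted by the partial derivatives [F2], at most half of
   [eps]. *)
pose e2 := Num.min 1 (eps / (2 * D)).
have e20 : 0 < e2 by rewrite lt_min ltr01 /= divr_gt0 // mulr_gt0.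
pose w (h : R) := (h *: v, q (x + h *: v) - q x).
have qH : \forall h \near (0 : R), forall l,
    `|q (x + h *: v) 0 l - q x 0 l - h * q' l| <= e2 * `|h|.
  pose P (l : 'I_m) (h : R) :=
    `|q (x + h *: v) 0 l - q x 0 l - h * q' l| <= e2 * `|h|.
  suff : \forall h \near nbhs (0 : R), forall l, P l h by [].
  apply: filter_forall => l.
  by have /is_derive_epsP := dq l; exact.
have wC : \forall h \near (0 : R), `|w h| <= C * `|h|.
  apply: filterS qH => h qh; apply: norm_prod_le => /=.
    rewrite normrZ mulrC ler_wpM2r // /C -addrA lerDl.
    by rewrite addr_ge0.
  apply: norm_le_coord => [|l]; first by rewrite mulr_ge0 // ltW.
  rewrite !mxE; have := qh l; set a := q _ 0 l - q x 0 l => qhl.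
  have -> : a = (a - h * q' l) + h * q' l by rewrite subrK.
  apply: (le_trans (ler_normD _ _)).
  apply: (@le_trans _ _ (1 * `|h| + (`|q' l|) * `|h|)).
    apply: lerD; last by rewrite normrM mulrC.
    by apply: le_trans qhl _; rewrite ler_wpM2r // /e2 ge_min lexx.
  have ql : `|q' l| <= \sum_l `|q' l|.
    by rewrite [leRHS](bigD1 l) //= lerDl; apply: sumr_ge0.
  have v0 := normr_ge0 v.
  by rewrite -mulrDl ler_wpM2r // /C; lra.
have w0 : w h @[h --> (0 : R)] --> (0 : 'rV[R]_n * 'rV[R]_m).
  apply/cvgrPdist_le => r r0.
  have rC : 0 < r / C by rewrite divr_gt0.
  near=> h.
  rewrite sub0r normrN; apply: (@le_trans _ _ (C * `|h|)); first by near: h.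
  rewrite mulrC -ler_pdivlMr //; near: h; exact: nbhs0_le.
have FH : \forall h \near (0 : R),
    `|F ((x, q x) + w h) - F (x, q x) -
      (\sum_k (w h).1 0 k * F1 k (x, q x) + \sum_l (w h).2 0 l * F2 l (x, q x))|
      <= e1 * `|w h|.
  exact: (w0 _ (prod_taylor dF c1 c2 e10)).
apply: filterS3 qH wC FH => h qh wh.
have -> : (x, q x) + w h = (x + h *: v, q (x + h *: v)).
  by congr (_, _) => /=; rewrite addrC subrK.
move=> Fh.
set A := F _ - F _ in Fh *.
set S1 := \sum_k v 0 k * _; set S2 := \sum_l q' l * _.
have E1 : \sum_k (w h).1 0 k * F1 k (x, q x) = h * S1.
  by rewrite /S1 mulr_sumr; apply: eq_bigr => k _; rewrite /= mxE mulrA.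
rewrite {}E1 in Fh.
have E2 : `|\sum_l (w h).2 0 l * F2 l (x, q x) - h * S2| <= eps / 2 * `|h|.
  rewrite /S2 mulr_sumr -sumrB; apply: le_trans (ler_norm_sum _ _ _) _.
  apply: (@le_trans _ _ (\sum_l (e2 * `|h|) * `|F2 l (x, q x)|)).
    apply: ler_sum => l _; rewrite mulrA -mulrBl normrM ler_wpM2r //.
    by rewrite /= !mxE; exact: qh.
  rewrite -mulr_sumr mulrAC ler_wpM2r //.
  apply: (@le_trans _ _ (eps / (2 * D) * D)); last first.
    by rewrite invfM mulrA mulfVK // gt_eqF.
  apply: ler_pM => //; first exact: ltW.
  - by apply: sumr_ge0.
  - by rewrite /e2 ge_min lexx orbT.
  - by rewrite /D lerDr.
set B := \sum_l (w h).2 0 l * _ in Fh E2.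
have -> : A - h * (S1 + S2) = (A - (h * S1 + B)) + (B - h * S2) by ring.
apply: le_trans (ler_normD _ _) _.
have -> : eps * `|h| = eps / 2 * `|h| + eps / 2 * `|h| by field.
apply: lerD => //; apply: (le_trans Fh).
apply: (@le_trans _ _ (e1 * (C * `|h|))); first by rewrite ler_wpM2l // ltW.
by rewrite mulrA ler_wpM2r // /e1 invfM mulrA mulfVK // gt_eqF.
Unshelve. all: by end_near. Qed.

(** * Local maxima, convexity, and a smooth positive part *)

Lemma is_deriveM_fun (R : realType) (V : normedModType R) (f g : V -> R) (x v : V)
    (df dg : R) :
  is_derive x v f df -> is_derive x v g dg ->
  is_derive x v (fun y => f y * g y) (df * g x + f x * dg).
Proof.
by move=> Df Dg; have := is_deriveM Df Dg; rewrite /GRing.scale /= addrC (mulrC df).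
Qed.

Lemma is_deriveD_fun (R : realType) (V : normedModType R) (f g : V -> R) (x v : V)
    (df dg : R) :
  is_derive x v f df -> is_derive x v g dg ->
  is_derive x v (fun y => f y + g y) (df + dg).
Proof. by move=> Df Dg; have := is_deriveD Df Dg. Qed.

Lemma is_deriveB_fun (R : realType) (V : normedModType R) (f g : V -> R) (x v : V)
    (df dg : R) :
  is_derive x v f df -> is_derive x v g dg ->
  is_derive x v (fun y => f y - g y) (df - dg).
Proof. by move=> Df Dg; have := is_deriveB Df Dg. Qed.

Lemma is_deriveZ_fun (R : realType) (V : normedModType R) (c : R) (f : V -> R)
    (x v : V) (df : R) :
  is_derive x v f df -> is_derive x v (fun y => c * f y) (c * df).
Proof. by move=> Df; have := is_deriveZ c Df. Qed.

Lemma is_derive_comp1 (R : realType) (V : normedModType R) (g : R -> R) (f : V -> R)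
    (x v : V) (df dg : R) :
  is_derive x v f df -> is_derive (f x) 1 g dg ->
  is_derive x v (fun y => g (f y)) (dg * df).
Proof.
move=> Df Dg; apply: is_derive_line0.
have E : f x = f (x + (0 : R) *: v) by rewrite scale0r addr0.
rewrite E in Dg.
apply: (@is_derive1_comp _ g (fun s : R => f (x + s *: v)) 0 dg df) => //.
by apply: is_derive_line; rewrite scale0r addr0.
Qed.

(** If [d > 0], then [g (x + c *: v) > 0] for small [c > 0], and by the mean value theorem [f]
    increases along the line, against maximality. Derivability of [g] at the single point [x] is
    enough. *)
Lemma is_derive_local_max (R : realType) (V : normedModType R) (f g : V -> R)
    (x v : V) (d : R) :
  (\forall y \near x, is_derive y v f (g y)) -> is_derive x v g d ->
  (\forall y \near x, f y <= f x) -> g x = 0 /\ d <= 0.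
Proof.
move=> df dg fmax.
have lv : (x + t *: v) @[t --> (0 : R)] --> x.
  rewrite -[X in _ --> X]addr0 -[X in _ + X](scale0r v).
  by apply: cvgD; [exact: cvg_cst|apply: cvgZl; exact: cvg_id].
have H0 : \forall y \near x, is_derive y v f (g y) /\ f y <= f x.
  by apply: filterS2 df fmax => y.
move: (lv _ H0) => /nbhs_ballP[r /= r0 rH].
have dphi (t : R) : `|t| < r ->
    is_derive t 1 (fun s => f (x + s *: v)) (g (x + t *: v)).
  move=> tr; apply: is_derive_line; apply: (rH t _).1.
  by rewrite -ball_normE /= sub0r normrN.
have mphi t : `|t| < r -> f (x + t *: v) <= f x.
  move=> tr; apply: (rH t _).2.
  by rewrite -ball_normE /= sub0r normrN.
have gx0 : g x = 0.
  have d0 : is_derive (0 : R) 1 (fun s => f (x + s *: v)) 0.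
    apply: (@derive1_at_max _ _ (- r) r).
    - by rewrite ge0_cp // ltW.
    - move=> t; rewrite in_itv /= => rt.
      by have [] := dphi t _; rewrite ?ltr_norml.
    - by rewrite in_itv /= oppr_lt0 r0.
    - move=> t; rewrite in_itv /= => rt.
      by rewrite scale0r addr0 mphi // ltr_norml.
  have := dphi 0; rewrite normr0 scale0r addr0 => /(_ r0) d1.
  by rewrite -(@derive_val _ _ _ _ _ _ _ d1) (@derive_val _ _ _ _ _ _ _ d0).
split => //; rewrite leNgt; apply/negP => d0.
have d20 : 0 < d / 2 by rewrite divr_gt0.
have /is_derive_epsP/(_ _ d20) := dg.
move=> /nbhs_ballP[r' /= r'0 r'H].
pose s := Num.min r r' / 2.
have s0 : 0 < s by rewrite divr_gt0 // lt_min r0 r'0.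
have sr : s < r.
  by rewrite ltr_pdivrMr // (le_lt_trans (_ : _ <= r)) ?ge_min ?lexx // ltr_pMr // ltr1n.
have sr' : s < r'.
  by rewrite ltr_pdivrMr // (le_lt_trans (_ : _ <= r')) ?ge_min ?lexx ?orbT // ltr_pMr // ltr1n.
have [||c] := @MVT _ (fun t => f (x + t *: v)) (fun t => g (x + t *: v)) 0 s s0.
- move=> t; rewrite in_itv /= => /andP[t0 ts]; apply: dphi.
  by rewrite gtr0_norm // (lt_trans ts).
- apply: continuous_in_subspaceT => t /set_mem /=; rewrite in_itv /= => /andP[t0 ts].
  apply: is_derive_continuous1; apply: dphi.
  by rewrite ger0_norm // (le_lt_trans ts).
rewrite in_itv /= => /andP[c0 cs]; rewrite subr0 => E.
have : g (x + c *: v) * s <= 0.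
  by rewrite -E scale0r addr0 subr_le0 mphi // gtr0_norm.
apply/negP; rewrite -ltNge; apply: mulr_gt0 => //.
have := r'H c; rewrite -ball_normE /= sub0r normrN gtr0_norm // => /(_ (lt_trans cs sr')).
rewrite gx0 subr0 ler_norml => /andP[+ _].
have : 0 < c * d by apply: mulr_gt0.
by move=> ? ?; lra.
Qed.

(** Convexity bounds each difference quotient on the segment by [f y - f x]; only the derivative
    along [y - x] enters. *)
Lemma convex_above_tangent (R : realType) (V : normedModType R) (f : V -> R)
    (x y : V) (d : R) :
  convex_function setT f -> is_derive x (y - x) f d -> f x + d <= f y.
Proof.
move=> cf df; rewrite -lerBrDl; apply/ler_addgt0Pr => e e0.
have /is_derive_epsP/(_ _ e0)/nbhs_ballP[r /= r0 rH] := df.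
pose h := Num.min (r / 2) 1.
have h0 : 0 < h by rewrite lt_min ltr01 divr_gt0.
have h1 : h <= 1 by rewrite ge_min lexx orbT.
have hr : h < r.
  by rewrite (le_lt_trans (_ : _ <= r / 2)) ?ge_min ?lexx // ltr_pdivrMr // ltr_pMr // ltr1n.
have := rH h; rewrite -ball_normE /= sub0r normrN gtr0_norm // => /(_ hr).
rewrite ler_norml => /andP[+ _].
have := cf (Itv01 (ltW h0) h1) y x; rewrite !in_setT => /(_ erefl erefl).
have -> : conv (Itv01 (ltW h0) h1) (y : convex_lmodType V) x = x + h *: (y - x).
  rewrite /conv /= scalerBl scale1r scalerBr addrC addrA addrAC.
  by rewrite -!addrA; congr (_ + _); rewrite addrC.
have -> : conv (Itv01 (ltW h0) h1) (f y : R^o) (f x) = h * f y + (1 - h) * f x.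
  by [].
move=> H1 H2; rewrite -(ler_pM2l h0).
by rewrite mulrDr mulrBr; lra.
Qed.

(** The quadratic bound makes the glued function flat at 0. It is applied twice, to a cubic and to a
    quadratic germ, which gives the two derivatives of [pcubic]. *)
Lemma is_derive_trunc (R : realType) (g g' : R -> R) (C : R) :
  (forall r : R, 0 < r -> is_derive r 1 g (g' r)) ->
  (forall r, 0 < r -> `|g r| <= C * r ^+ 2) ->
  forall r : R, is_derive r 1 (fun s => if 0 < s then g s else 0)
    (if 0 < r then g' r else 0).
Proof.
move=> dg gC r; have [r0|r0|/esym r0] := ltgtP 0 r.
- apply: near_eq_is_derive (dg r r0).
  near=> s; rewrite ifT //; near: s; exact: lt_nbhsr || exact: nbhs_right_gt.
- apply: near_eq_is_derive (is_derive_cst _ _ _).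
  near=> s; rewrite ifF //; apply/negbTE; rewrite -leNgt ltW //; near: s.
  exact: lt_nbhsl.
- rewrite {r}r0; apply/is_derive_epsP => e e0.
  have C0 : 0 <= `|C| + 1 by rewrite addr_ge0.
  have C1 : 0 < `|C| + 1 by rewrite ltr_wpDl.
  have eC : 0 < e / (`|C| + 1) by rewrite divr_gt0.
  near=> h; rewrite /= ltxx mulr0 !subr0 add0r [_%:A]mulr1.
  case: ifP => h0; last by rewrite normr0 mulr_ge0 // ltW.
  apply: le_trans (gC h h0) _; rewrite gtr0_norm // expr2 mulrA ler_pM2r //.
  apply: (@le_trans _ _ ((`|C| + 1) * h)).
    rewrite ler_pM2r // (le_trans (ler_norm _)) // lerDl //.
  rewrite mulrC -ler_pdivlMr //; apply: le_trans (ler_norm _) _; near: h.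
  apply/nbhs_ballP; exists (e / (`|C| + 1)) => //= y.
  by rewrite -ball_normE /= sub0r normrN => /ltW.
Unshelve. all: by end_near. Qed.

Section soft_positive_part.
Variable R : realType.

(** For [r > 0] this equals [r - 2 + (2 + 3 * r) / (1 + r) ^+ 2]: a rational function that is C^2
    across 0, convex, with slope in [[0, 1]], and within 2 of the positive part. *)
Definition pcubic (r : R) : R := if 0 < r then r ^+ 3 / (1 + r) ^+ 2 else 0.
Definition pcubic1 (r : R) : R :=
  if 0 < r then (r ^+ 3 + 3 * r ^+ 2) / (1 + r) ^+ 3 else 0.
Definition pcubic2 (r : R) : R := if 0 < r then 6 * r / (1 + r) ^+ 4 else 0.

Lemma is_derive_ratio (f : R -> R) (p p' : R) (k : nat) (r : R) :
  0 < r -> is_derive r 1 f p' -> f r = p ->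
  is_derive r 1 (fun s => f s / (1 + s) ^+ k.+1)
    ((p' * (1 + r) - p * k.+1%:R) / (1 + r) ^+ k.+2).
Proof.
move=> r0 df fr.
have r1 : 1 + r != 0 by rewrite gt_eqF // addr_gt0.
have d1 : is_derive r 1 (fun s : R => 1 + s) 1.
  have := is_deriveD_fun (is_derive_cst (1 : R) r 1) (is_derive_id r 1).
  by rewrite add0r.
have dk := @is_deriveX _ _ _ k.+1 r 1 1 d1.
have nz : ((fun s : R => 1 + s) ^+ k.+1) r != 0 by rewrite exprfctE expf_neq0.
have H := is_deriveM_fun df (is_deriveV nz dk).
rewrite (_ : (fun s => _) = fun y => f y * (((fun s : R => 1 + s) ^+ k.+1) y)^-1); last first.
  by apply/funext => s; rewrite exprfctE.
apply: is_derive_eq H _; rewrite exprfctE fr /GRing.scale /= !exprS.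
have t0 : (1 + r) ^+ k != 0 by rewrite expf_neq0.
by field; rewrite t0.
Qed.

Lemma is_derive_pcubic (r : R) : is_derive r 1 pcubic (pcubic1 r).
Proof.
apply: (@is_derive_trunc _ (fun r => r ^+ 3 / (1 + r) ^+ 2)
  (fun r => (r ^+ 3 + 3 * r ^+ 2) / (1 + r) ^+ 3) 1).
- move=> {}r r0.
  have r1 : 1 + r != 0 by rewrite gt_eqF // addr_gt0.
  have d3 : is_derive r 1 (fun s : R => s ^+ 3) (3 * r ^+ 2).
    by have := @is_deriveX _ _ id 3 r 1 1 (is_derive_id r 1);
       rewrite exprfctE /GRing.scale /= mulr1.
  apply: is_derive_eq (@is_derive_ratio _ _ _ 1 _ r0 d3 erefl) _.
  by field.
- move=> {}r r0.
  have r1 : 0 < 1 + r by rewrite addr_gt0.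
  rewrite ger0_norm; last by rewrite divr_ge0 // exprn_ge0 // ltW.
  rewrite mul1r ler_pdivrMr ?exprn_gt0 //.
  rewrite exprSr ler_pM2l ?exprn_gt0 //.
  by rewrite expr2; nra.
Qed.

Lemma is_derive_pcubic1 (r : R) : is_derive r 1 pcubic1 (pcubic2 r).
Proof.
apply: (@is_derive_trunc _ (fun r => (r ^+ 3 + 3 * r ^+ 2) / (1 + r) ^+ 3)
  (fun r => 6 * r / (1 + r) ^+ 4) 3).
- move=> {}r r0.
  have r1 : 1 + r != 0 by rewrite gt_eqF // addr_gt0.
  have d3 : is_derive r 1 (fun s : R => s ^+ 3) (3 * r ^+ 2).
    by have := @is_deriveX _ _ id 3 r 1 1 (is_derive_id r 1);
       rewrite exprfctE /GRing.scale /= mulr1.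
  have d2 : is_derive r 1 (fun s : R => s ^+ 2) (2 * r).
    by have := @is_deriveX _ _ id 2 r 1 1 (is_derive_id r 1);
       rewrite exprfctE /GRing.scale /= mulr1 expr1.
  have d := is_deriveD_fun d3 (is_deriveZ_fun 3 d2).
  apply: is_derive_eq (@is_derive_ratio _ _ _ 2 _ r0 d erefl) _.
  by field.
- move=> {}r r0.
  have r1 : 0 < 1 + r by rewrite addr_gt0.
  rewrite ger0_norm; last first.
    by rewrite divr_ge0 ?exprn_ge0 ?addr_ge0 ?mulr_ge0 ?exprn_ge0 // ltW.
  rewrite ler_pdivrMr ?exprn_gt0 // -subr_ge0.
  have -> : 3 * r ^+ 2 * (1 + r) ^+ 3 - (r ^+ 3 + 3 * r ^+ 2) =
    r ^+ 3 * (8 + 9 * r + 3 * r ^+ 2) by ring.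
  by rewrite mulr_ge0 ?addr_ge0 ?mulr_ge0 ?exprn_ge0 // ltW.
Qed.

Lemma pcubic2_continuous : continuous pcubic2.
Proof.
have -> : pcubic2 = fun r => 6 * Num.max r 0 / (1 + Num.max r 0) ^+ 4.
  apply/funext => r; rewrite /pcubic2; by case: (ltP 0 r) => r0; rewrite ?mulr0 ?mul0r.
move=> r.
have m0 : 0 <= Num.max r 0 by rewrite le_max lexx orbT.
have cm : {for r, continuous (fun s : R => Num.max s 0)}.
  by apply: (@continuous_max _ _ id (fun=> 0)) => //; exact: cst_continuous.
apply: cvgM; first by apply: cvgM; [exact: cvg_cst|exact: cm].
apply: cvgV; first by rewrite expf_neq0 // gt_eqF // ltr_wpDr.
apply: (@continuous_comp _ _ _ (fun s : R => 1 + Num.max s 0) (fun s : R => s ^+ 4)).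
  by apply: cvgD; [exact: cvg_cst|exact: cm].
exact: exprn_continuous.
Qed.

Variables (delta : R) (delta_gt0 : 0 < delta).

(** [softpos] vanishes on a neighbourhood of 0, not only on the negative axis:
    [softpos (s x)] is then supported away from the zero set of [s]. *)
Definition softpos (r : R) : R := delta * pcubic (delta^-1 * r - 1).
Definition softpos1 (r : R) : R := pcubic1 (delta^-1 * r - 1).
Definition softpos2 (r : R) : R := delta^-1 * pcubic2 (delta^-1 * r - 1).

Let dd : delta != 0 := lt0r_neq0 delta_gt0.

Let is_derive_arg (r : R) : is_derive r 1 (fun s : R => delta^-1 * s - 1) delta^-1.
Proof.
have := is_deriveB_fun (is_deriveZ_fun delta^-1 (is_derive_id r 1)) (is_derive_cst (1 : R) r 1).
by rewrite mulr1 subr0.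
Qed.

Lemma is_derive_softpos (r : R) : is_derive r 1 softpos (softpos1 r).
Proof.
have := is_deriveZ_fun delta (is_derive_comp1 (is_derive_arg r) (is_derive_pcubic _)).
by rewrite mulrCA mulfV // mulr1.
Qed.

Lemma is_derive_softpos1 (r : R) : is_derive r 1 softpos1 (softpos2 r).
Proof.
have := is_derive_comp1 (is_derive_arg r) (is_derive_pcubic1 _).
by rewrite mulrC.
Qed.

Lemma softpos_continuous : continuous softpos.
Proof. by move=> r; apply: is_derive_continuous1 (is_derive_softpos r). Qed.

Lemma softpos1_continuous : continuous softpos1.
Proof. by move=> r; apply: is_derive_continuous1 (is_derive_softpos1 r). Qed.

Lemma softpos2_continuous : continuous softpos2.
Proof.
move=> r; apply: cvgM; first exact: cvg_cst.
apply: (@continuous_comp _ _ _ (fun s : R => delta^-1 * s - 1) pcubic2).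
  by apply: is_derive_continuous1 (is_derive_arg r).
exact: pcubic2_continuous.
Qed.

Let pcubic1_ge0 r : 0 <= pcubic1 r.
Proof.
rewrite /pcubic1; case: ifP => // r0; by rewrite divr_ge0 ?exprn_ge0 ?addr_ge0 ?mulr_ge0 ?exprn_ge0 // ltW.
Qed.

Let pcubic1_le1 r : pcubic1 r <= 1.
Proof.
rewrite /pcubic1; case: ifP => // r0.
by rewrite ler_pdivrMr ?exprn_gt0 ?addr_gt0 // mul1r; nra.
Qed.

Lemma softpos1_ge0 r : 0 <= softpos1 r. Proof. exact: pcubic1_ge0. Qed.

Lemma softpos1_le1 r : softpos1 r <= 1. Proof. exact: pcubic1_le1. Qed.

Lemma softpos2_ge0 r : 0 <= softpos2 r.
Proof.
rewrite /softpos2 mulr_ge0 ?invr_ge0 ?(ltW delta_gt0) // /pcubic2 //.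
move: (delta^-1 * r - 1) => m; case: ifP => // m0.
by rewrite divr_ge0 ?mulr_ge0 ?exprn_ge0 ?addr_ge0 // ltW.
Qed.

Let arg_le0 r : r <= delta -> (0 < delta^-1 * r - 1) = false.
Proof.
by move=> rd; apply/negbTE; rewrite -leNgt subr_le0 mulrC ler_pdivrMr // mul1r.
Qed.

Lemma softpos_eq0 r : r <= delta -> softpos r = 0.
Proof. by move=> rd; rewrite /softpos /pcubic arg_le0 // mulr0. Qed.

Lemma softpos1_eq0 r : r <= delta -> softpos1 r = 0.
Proof. by move=> rd; rewrite /softpos1 /pcubic1 arg_le0. Qed.

Let argP r : delta < r -> exists2 m, 0 < m & r = delta * (1 + m) /\ delta^-1 * r - 1 = m.
Proof.
move=> rd; exists (delta^-1 * r - 1).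
  by rewrite subr_gt0 mulrC ltr_pdivlMr // mul1r.
by split => //; field.
Qed.

Lemma softpos_ge0 r : 0 <= softpos r.
Proof.
rewrite /softpos mulr_ge0 ?(ltW delta_gt0) // /pcubic.
move: (delta^-1 * r - 1) => m; case: ifP => // m0.
by rewrite divr_ge0 ?exprn_ge0 ?addr_ge0 // ltW.
Qed.

Lemma softpos_le r : 0 <= r -> softpos r <= r.
Proof.
move=> r0; have [rd|/argP[m m0 [-> E]]] := leP r delta; first by rewrite softpos_eq0.
rewrite /softpos E ler_pM2l //.
rewrite /pcubic m0 ler_pdivrMr ?exprn_gt0 ?addr_gt0 //.
by nra.
Qed.

Lemma softpos_norm_le r : `|softpos r| <= `|r|.
Proof.
rewrite ger0_norm ?softpos_ge0 //; have [r0|r0] := leP 0 r.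
  by rewrite ger0_norm ?softpos_le.
by rewrite softpos_eq0 // (le_trans (ltW r0)) // ltW.
Qed.

(** One [delta] is lost to the shift of the argument, two more to the asymptote [r - 2] of
    [pcubic]. *)
Lemma le_softpos r : r <= softpos r + 3 * delta.
Proof.
have [rd|/argP[m m0 [-> E]]] := leP r delta.
  by rewrite softpos_eq0 //; have := ltW delta_gt0; lra.
rewrite /softpos E.
have -> : delta * pcubic m + 3 * delta = delta * (pcubic m + 3) by ring.
rewrite ler_pM2l // /pcubic m0.
have m1 : 1 + m != 0 by rewrite gt_eqF // addr_gt0.
rewrite -subr_ge0.
have -> : m ^+ 3 / (1 + m) ^+ 2 + 3 - (1 + m) = (2 + 3 * m) / (1 + m) ^+ 2 by field.
by rewrite divr_ge0 ?exprn_ge0 ?addr_ge0 ?mulr_ge0 // ltW.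
Qed.

(** The tangent inequality at [r] evaluated at 0, where [softpos] vanishes; here checked on the
    explicit formula. *)
Lemma softpos1M_ge r : softpos r <= softpos1 r * r.
Proof.
have [rd|/argP[m m0 [-> E]]] := leP r delta.
  by rewrite softpos_eq0 // softpos1_eq0 // mul0r.
rewrite /softpos /softpos1 E.
rewrite mulrCA ler_pM2l // /pcubic /pcubic1 m0.
have m1 : 1 + m != 0 by rewrite gt_eqF // addr_gt0.
rewrite -subr_ge0.
have -> : (m ^+ 3 + 3 * m ^+ 2) / (1 + m) ^+ 3 * (1 + m) - m ^+ 3 / (1 + m) ^+ 2
  = 3 * m ^+ 2 / (1 + m) ^+ 2 by field.
by rewrite divr_ge0 ?mulr_ge0 ?exprn_ge0 ?addr_ge0 // ltW.
Qed.

(** This gap is the factor that multiplies the divergence of the drift in Kato's inequality; its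
    smallness removes [Mb] from the final bound. *)
Lemma softpos1M_le r : softpos1 r * r - softpos r <= 3 * delta.
Proof.
have [rd|/argP[m m0 [-> E]]] := leP r delta.
  by rewrite softpos_eq0 // softpos1_eq0 // mul0r subr0 mulr_ge0 // ltW.
rewrite /softpos /softpos1 E.
rewrite mulrCA -mulrBr mulrC ler_pM2r // /pcubic /pcubic1 m0.
have m1 : 1 + m != 0 by rewrite gt_eqF // addr_gt0.
have -> : (m ^+ 3 + 3 * m ^+ 2) / (1 + m) ^+ 3 * (1 + m) - m ^+ 3 / (1 + m) ^+ 2
  = 3 * m ^+ 2 / (1 + m) ^+ 2 by field.
by rewrite ler_pdivrMr ?exprn_gt0 ?addr_gt0 //; nra.
Qed.

End soft_positive_part.

(** * Integration over the row space *)

Section row_measurability.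
Context {R : realType} {n : nat}.
Local Notation row := (@row_of_tuple R n).

Lemma measurable_row_cube (x : 'rV[R]_n) (r : R) :
  measurable (row @^-1` [set y | forall i, `|x 0 i - y 0 i| < r]).
Proof.
have -> : row @^-1` [set y | forall i, `|x 0 i - y 0 i| < r] =
    \bigcap_(i in [set: 'I_n]) ((fun t => tnth t i) @^-1` ball (x 0 i) r).
  apply/seteqP; split => t /= H i; first by move=> _; have := H i; rewrite mxE.
  by have := H i I; rewrite /= mxE.
apply: fin_bigcap_measurable => // i _.
rewrite -[X in measurable X]setTI; apply: measurable_tnth => //.
exact: measurable_ball.
Qed.

(** The sigma-algebra on tuples is a product one, so an open set is written as the countable union
    of the cubes with rational centre and radius [1 / (k + 1)] that it contains. *)
Lemma measurable_row_open (O : set 'rV[R]_n) : open O -> measurable (row @^-1` O).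
Proof.
move=> oO.
pose C (p : 'rV[rat]_n * nat) : set 'rV[R]_n :=
  [set y | forall i, `|map_mx ratr p.1 0 i - y 0 i| < p.2.+1%:R^-1].
pose S (p : 'rV[rat]_n * nat) := if `[< C p `<=` O >] then C p else set0.
have -> : row @^-1` O = \bigcup_p (row @^-1` S p).
  apply/seteqP; split => t /=; last first.
    by move=> [p _]; rewrite /S /=; case: asboolP => // CO; exact: CO.
  move=> Ot.
  have /nbhs_ballP[e /= e0 eO] : nbhs (row t) O by exact: open_nbhs_nbhs.
  have [k ke] : exists k : nat, k.+1%:R^-1 < e / 2.
    have e20 : 0 < e / 2 by rewrite divr_gt0.
    have [k _ H] := near_infty_natSinv_lt (PosNum e20).
    by exists k; apply: (H k) => /=.
  have [q qP] : exists q : 'rV[rat]_n, forall i,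
      `|ratr (q 0 i) - row t 0 i| < k.+1%:R^-1.
    have /choice[q qP] : forall i, exists q : rat, `|ratr q - row t 0 i| < k.+1%:R^-1.
      move=> i.
      have [|q] := @rat_in_itvoo R (row t 0 i - k.+1%:R^-1) (row t 0 i + k.+1%:R^-1).
        by rewrite ltrBlDr -addrA ltrDl addr_gt0 // invr_gt0.
      rewrite in_itv /= => qi; exists q.
      by rewrite ltr_distl.
    by exists (\row_i q i) => i; rewrite mxE.
  exists (q, k) => //; rewrite /S asboolT.
    by move=> i; rewrite /= mxE; exact: qP.
  move=> y /= Cy; apply: eO; rewrite -ball_normE /=.
  apply: (@le_lt_trans _ _ (k.+1%:R^-1 + k.+1%:R^-1)); last first.
    by rewrite (splitr e) ltrD.
  apply: norm_le_coord => [|i]; first by rewrite addr_ge0.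
  rewrite !mxE; have := Cy i; have := qP i; rewrite !mxE => H1 H2.
  rewrite (_ : _ + - _ = (tnth t i - ratr (q 0 i)) + (ratr (q 0 i) - y 0 i)); last by ring.
  by rewrite (le_trans (ler_normD _ _)) // lerD // ltW // distrC.
apply: countable_bigcupT_measurable; first exact: countableP.
move=> p; rewrite /S; case: asboolP => _; last by rewrite preimage_set0.
exact: measurable_row_cube.
Qed.

Lemma measurable_row_continuous (D : set 'rV[R]_n) (f : 'rV[R]_n -> R) :
  open D -> (forall x, D x -> {for x, continuous f}) ->
  measurable_fun (row @^-1` D) (fun t => f (row t)).
Proof.
move=> oD cf; apply: (measurability _ (RGenOpens.measurableE R)).
move=> _ [_ [a [b ->] <-]].
have oO : @open R `]a, b[%classic by exact: interval_open.
have -> : row @^-1` D `&` (fun t => f (row t)) @^-1` `]a, b[ =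
    row @^-1` (D `&` f @^-1` `]a, b[%classic) by [].
apply: measurable_row_open.
rewrite openE => x [Dx Ox]; rewrite /interior; apply: filterI.
  exact: open_nbhs_nbhs.
by apply: (cf x Dx); exact: open_nbhs_nbhs.
Qed.

End row_measurability.

Section whole_space_integral.
Context {R : realType} {n : nat}.
Implicit Types (f g : 'rV[R]_n -> R) (c : R).

Definition rV_measurable f :=
  measurable_fun setT (fun t : n.-tuple (measurableTypeR R) => f (row_of_tuple t)).

Lemma rV_measurable_continuous f : continuous f -> rV_measurable f.
Proof.
move=> cf; have := @measurable_row_continuous R n setT f openT (fun x _ => cf x).
by rewrite preimage_setT.
Qed.

Lemma rV_measurableM f g :
  rV_measurable f -> rV_measurable g -> rV_measurable (fun x => f x * g x).
Proof. exact: measurable_funM. Qed.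

Lemma rV_measurableD f g :
  rV_measurable f -> rV_measurable g -> rV_measurable (fun x => f x + g x).
Proof. exact: measurable_funD. Qed.

Lemma rV_measurableB f g :
  rV_measurable f -> rV_measurable g -> rV_measurable (fun x => f x - g x).
Proof. exact: measurable_funB. Qed.

Lemma rV_measurable_comp (h : R -> R) f :
  continuous h -> rV_measurable f -> rV_measurable (fun x => h (f x)).
Proof.
by move=> ch mf; apply: measurableT_comp => //; exact: continuous_measurable_fun.
Qed.

Lemma rV_measurable_indic (O : set 'rV[R]_n) :
  open O -> rV_measurable (\1_O).
Proof.
move=> oO; rewrite /rV_measurable.
exact: measurable_indic (measurable_row_open oO).
Qed.

Local Notation rinteg := (dx_integrable [set: 'rV[R]_n]).
Local Notation rint := (dx_integral [set: 'rV[R]_n]).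

Lemma rintE f : rint f = \int[lebesgue_tuple R n]_t f (row_of_tuple t).
Proof. by rewrite /dx_integral preimage_setT. Qed.

Lemma rintegE f : rinteg f =
  (lebesgue_tuple R n).-integrable setT (fun t => (f (row_of_tuple t))%:E).
Proof. by rewrite /dx_integrable preimage_setT. Qed.

Lemma patch_row (U : set 'rV[R]_n) f :
  (fun t : n.-tuple (measurableTypeR R) => f (row_of_tuple t)) \_ (@row_of_tuple R n @^-1` U) =
  (fun t => (f \_ U) (row_of_tuple t)).
Proof.
apply/funext => t; rewrite /patch.
by congr (if _ then _ else _); apply/idP/idP => /set_mem H; exact: mem_set.
Qed.

(** The calculus of integrals is developed on the whole space only; integrals over [U] enter through
    extension by zero. *)
Lemma dx_integral_patch (U : set 'rV[R]_n) f : dx_integral U f = rint (f \_ U).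
Proof. by rewrite rintE /dx_integral Rintegral_mkcond patch_row. Qed.

Lemma dx_integrable_patch (U : set 'rV[R]_n) f :
  open U -> dx_integrable U f <-> rinteg (f \_ U).
Proof.
move=> oU; rewrite rintegE /dx_integrable.
have mU := measurable_row_open oU.
rewrite (_ : (fun t => ((f \_ U) (row_of_tuple t))%:E) =
  (fun t => (f (row_of_tuple t))%:E) \_ (@row_of_tuple R n @^-1` U)).
  have := integrable_restrict (lebesgue_tuple R n) mU measurableT
    (fun t => (f (row_of_tuple t))%:E).
  by rewrite setTI.
apply/funext => t; have := congr1 (fun h => h t) (patch_row U f).
by rewrite /patch /= => <-; case: ifP.
Qed.

Lemma rinteg_measurable f : rinteg f -> rV_measurable f.
Proof. by rewrite rintegE => /integrableP[/measurable_EFinP]. Qed.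

Lemma eq_rint f g : f =1 g -> rint f = rint g.
Proof. by move=> /funext ->. Qed.

Lemma rintegD f g : rinteg f -> rinteg g -> rinteg (fun x => f x + g x).
Proof. by rewrite !rintegE => If Ig; exact: (integrableD measurableT If Ig). Qed.

Lemma rintegB f g : rinteg f -> rinteg g -> rinteg (fun x => f x - g x).
Proof. by rewrite !rintegE => If Ig; exact: (integrableB measurableT If Ig). Qed.

Lemma rintegZ c f : rinteg f -> rinteg (fun x => c * f x).
Proof. by rewrite !rintegE => If; exact: (integrableZl measurableT c If). Qed.

Lemma rinteg_norm f : rinteg f -> rinteg (fun x => `|f x|).
Proof. by rewrite !rintegE => If; exact: (integrable_norm If). Qed.

Lemma rinteg0 : rinteg (fun=> 0).
Proof. by rewrite rintegE; exact: integrable0. Qed.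

Lemma rinteg_sum (I : Type) (s : seq I) (F : I -> 'rV[R]_n -> R) :
  (forall i, rinteg (F i)) -> rinteg (fun x => \sum_(i <- s) F i x).
Proof.
move=> IF; elim: s => [|i s IH].
  by under eq_fun do rewrite big_nil; exact: rinteg0.
by under eq_fun do rewrite big_cons; exact: rintegD.
Qed.

Lemma rintD f g : rinteg f -> rinteg g ->
  rint (fun x => f x + g x) = rint f + rint g.
Proof. by rewrite !rintegE !rintE => If Ig; exact: RintegralD. Qed.

Lemma rintB f g : rinteg f -> rinteg g ->
  rint (fun x => f x - g x) = rint f - rint g.
Proof. by rewrite !rintegE !rintE => If Ig; exact: RintegralB. Qed.

Lemma rintZ c f : rinteg f -> rint (fun x => c * f x) = c * rint f.
Proof. by rewrite rintegE !rintE => If; exact: RintegralZl. Qed.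

Lemma rint0 : rint (fun=> 0) = 0.
Proof. by rewrite rintE /Rintegral integral0. Qed.

Lemma rint_sum (I : Type) (s : seq I) (F : I -> 'rV[R]_n -> R) :
  (forall i, rinteg (F i)) ->
  rint (fun x => \sum_(i <- s) F i x) = \sum_(i <- s) rint (F i).
Proof.
move=> IF; elim: s => [|i s IH].
  by under eq_fun do rewrite big_nil; rewrite big_nil rint0.
under eq_fun do rewrite big_cons.
by rewrite rintD ?IH ?big_cons //; exact: rinteg_sum.
Qed.

Lemma le_rint f g : rinteg f -> rinteg g -> (forall x, f x <= g x) ->
  rint f <= rint g.
Proof. by rewrite !rintegE !rintE => If Ig fg; exact: le_Rintegral. Qed.

Lemma rint_ge0 f : (forall x, 0 <= f x) -> 0 <= rint f.
Proof. by move=> f0; rewrite rintE; exact: Rintegral_ge0. Qed.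

Lemma norm_rint_le f g : rinteg f -> rinteg g -> (forall x, `|f x| <= g x) ->
  `|rint f| <= rint g.
Proof.
move=> If Ig fg; apply: (@le_trans _ _ (rint (fun x => `|f x|))).
  by move: If; rewrite rintegE !rintE => If; exact: le_normr_Rintegral.
by apply: le_rint => //; exact: rinteg_norm.
Qed.

Lemma rinteg_le f g : rV_measurable f -> rinteg g -> (forall x, `|f x| <= `|g x|) ->
  rinteg f.
Proof.
rewrite !rintegE => mf Ig fg.
apply: (le_integrable measurableT _ _ Ig).
  exact/measurable_EFinP.
by move=> t _ /=; rewrite lee_fin.
Qed.

Lemma rintegM_bounded g f (M : R) :
  rinteg g -> rV_measurable f -> (forall x, `|f x| <= M) ->
  rinteg (fun x => g x * f x).
Proof.
move=> Ig mf fM; apply: (@rinteg_le _ (fun x => M * g x)).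
- by apply: rV_measurableM => //; exact: rinteg_measurable.
- exact: rintegZ.
- move=> x; rewrite !normrM mulrC ler_wpM2r //.
  by rewrite (le_trans (fM x)) // ler_norm.
Qed.

(** The norm of a row is the sup norm, so this closed ball is a product of intervals, of measure
    [(2 * r) ^+ n]. *)
Definition cube (x : 'rV[R]_n) (r : R) : set 'rV[R]_n := [set y | `|x - y| <= r].

Lemma cubeP x (r : R) y : 0 <= r -> cube x r y <-> forall i, `|x 0 i - y 0 i| <= r.
Proof.
move=> r0; split => [H i|H].
  by apply: le_trans H; have := coord_le_norm (x - y) i; rewrite !mxE.
by apply: norm_le_coord => // i; rewrite !mxE.
Qed.

Lemma row_cubeE x (r : R) : 0 <= r ->
  @row_of_tuple R n @^-1` (cube x r) =
  [set t | forall i, `[x 0 i - r, x 0 i + r]%classic (tnth t i)].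
Proof.
move=> r0; apply/seteqP; split => t /=.
  by move=> /(cubeP _ _ r0) H i; have := H i; rewrite mxE in_itv /= ler_distlC.
move=> H; apply/(cubeP _ _ r0) => i; have := H i.
by rewrite mxE /= in_itv /= ler_distlC.
Qed.

Lemma measurable_cube x (r : R) : 0 <= r -> measurable (@row_of_tuple R n @^-1` (cube x r)).
Proof.
move=> r0; rewrite row_cubeE //.
rewrite (_ : [set t | _] = \bigcap_(i in [set: 'I_n])
    ((fun t : n.-tuple (measurableTypeR R) => tnth t i) @^-1` `[x 0 i - r, x 0 i + r]%classic)).
  apply: fin_bigcap_measurable => // i _.
  by rewrite -[X in measurable X]setTI; apply: measurable_tnth => //; exact: measurable_itv.
by apply/seteqP; split=> [t h i _|t h i]; [exact: h|exact: (h i I)].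
Qed.

Lemma measure_cube x (r : R) : 0 <= r ->
  lebesgue_tuple R n (@row_of_tuple R n @^-1` (cube x r)) = ((2 * r) ^+ n)%:E.
Proof.
move=> r0; rewrite row_cubeE //.
rewrite (lebesgue_tuple_box (A := fun i => `[x 0 i - r, x 0 i + r]%classic)); last first.
  by move=> i; exact: measurable_itv.
have E i : lebesgue_measure `[x 0 i - r, x 0 i + r]%classic = (2 * r)%:E.
  rewrite lebesgue_measure_itv /= lte_fin.
  case: ifPn => [_|]; first by rewrite -EFinB; congr (_%:E); ring.
  rewrite -leNgt => H; have -> : r = 0 by apply/le_anti; rewrite r0 andbT; lra.
  by rewrite mulr0.
under eq_bigr do rewrite E.
by rewrite prodEFin prodr_const card_ord.
Qed.

Lemma rV_measurable_cube x (r : R) : 0 <= r -> rV_measurable (\1_(cube x r)).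
Proof.
move=> r0; rewrite /rV_measurable.
exact: measurable_indic (measurable_cube x r0).
Qed.

Lemma rinteg_cube x (r : R) : 0 <= r -> rinteg (\1_(cube x r)).
Proof.
move=> r0; rewrite rintegE.
apply/integrableP; split.
  by apply/measurable_EFinP; exact: (rV_measurable_cube x r0).
rewrite (_ : (fun t => _) = fun t => (\1_(@row_of_tuple R n @^-1` cube x r) t)%:E).
  rewrite integral_indic ?setIT //.
    by rewrite [X in (X < _)%E](measure_cube x r0) ltry.
  exact: measurable_cube.
apply/funext => t /=; rewrite ger0_norm //.
Qed.

Lemma rint_cube x (r : R) : 0 <= r -> rint (\1_(cube x r)) = (2 * r) ^+ n.
Proof.
move=> r0; rewrite rintE /Rintegral.
rewrite (_ : (fun t => _) = fun t => (\1_(@row_of_tuple R n @^-1` cube x r) t)%:E) //.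
rewrite integral_indic ?setIT //; last exact: measurable_cube.
by rewrite [X in fine X](measure_cube x r0).
Qed.

Lemma norm_rint_cube f (x : 'rV[R]_n) (r M : R) :
  0 <= r -> rinteg f -> (forall y, `|f y| <= M * \1_(cube x r) y) ->
  `|rint f| <= M * (2 * r) ^+ n.
Proof.
move=> r0 If fM; have Ic := rinteg_cube x r0.
by rewrite -(rint_cube x r0) -rintZ //; apply: norm_rint_le => //; exact: rintegZ.
Qed.

Lemma rinteg_bounded_supp f (r M : R) :
  0 <= r -> rV_measurable f -> (forall x, `|f x| <= M) ->
  (forall x, r < `|x| -> f x = 0) -> rinteg f.
Proof.
move=> r0 mf fM f0; apply: (@rinteg_le _ (fun x => M * \1_(cube 0 r) x)) => //.
  by apply: rintegZ; exact: rinteg_cube.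
move=> x; rewrite indicE; case: (ltP r `|x|) => xr; first by rewrite f0 // normr0.
rewrite mem_set; last by rewrite /cube /= sub0r normrN.
by rewrite mulr1 (le_trans (fM x)) // ler_norm.
Qed.

Lemma compact_cube (r : R) : compact [set x : 'rV[R]_n | `|x| <= r].
Proof.
apply: bounded_closed_compact.
  exists r; split; first exact: num_real.
  by move=> M rM x /= /le_trans; apply; exact: ltW.
have -> : [set x : 'rV[R]_n | `|x| <= r] = Num.norm @^-1` [set y : R | y <= r] by [].
apply: preimage_closed; last exact: closed_le.
by move=> x _; exact: norm_continuous.
Qed.

Lemma continuous_bounded_supp f (r : R) :
  continuous f -> (forall x, r < `|x| -> f x = 0) ->
  exists2 M : R, 0 <= M & forall x, `|f x| <= M.
Proof.
move=> cf f0.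
have /compact_bounded[M [Mr MH]] : compact (f @` [set x : 'rV[R]_n | `|x| <= r]).
  apply: continuous_compact; last exact: compact_cube.
  by apply: continuous_subspaceT.
exists (`|M| + 1); first by rewrite addr_ge0.
move=> x; case: (ltP r `|x|) => xr.
  by rewrite f0 // normr0 addr_ge0.
apply: MH; last by exists x.
by rewrite (le_lt_trans (ler_norm _)) // ltrDl.
Qed.

Lemma rinteg_continuous_supp f (r : R) :
  continuous f -> (forall x, r < `|x| -> f x = 0) -> rinteg f.
Proof.
move=> cf f0; have [M M0 fM] := continuous_bounded_supp cf f0.
apply: (@rinteg_bounded_supp _ (Num.max r 0) M) => //.
- by rewrite le_max lexx orbT.
- exact: rV_measurable_continuous.
- by move=> x; rewrite gt_max => /andP[/f0].
Qed.

End whole_space_integral.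

Notation rinteg := (dx_integrable [set: 'rV[_]_ _]).
Notation rint := (dx_integral [set: 'rV[_]_ _]).

(** * Fubini and the divergence theorem *)

Section fubini_row.
Context {R : realType} {n : nat}.
Local Notation TR := (measurableTypeR R).

Definition cons_row (x : R) (v : 'rV[R]_n) : 'rV[R]_n.+1 :=
  \row_j (if unlift ord0 j is Some k then v 0 k else x).

Lemma row_tcons (x : TR) (t : n.-tuple TR) :
  row_of_tuple (tcons (x, t)) = cons_row x (row_of_tuple t).
Proof.
apply/rowP => j; rewrite !mxE; case: unliftP => [k ->|->] /=.
  by rewrite mxE tnthS.
by rewrite tnth0.
Qed.

Let integrable_tcons (f : n.+1.-tuple TR -> \bar R) :
  (lebesgue_tuple R n.+1).-integrable setT f ->
  (lebesgue_measure \x lebesgue_tuple R n)%E.-integrable setT (f \o @tcons R n).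
Proof.
move=> /integrableP[mf foo]; apply/integrableP; split.
  by apply: measurableT_comp => //; exact: measurable_tcons.
apply: le_lt_trans foo.
have -> : (\int[lebesgue_tuple R n.+1]_x `|f x| =
    \int[pushforward (lebesgue_measure \x lebesgue_tuple R n)%E (@tcons R n)]_x `|f x|)%E.
  by apply: eq_measure_integral => [|A mA _]; [exact: measurable_tcons|].
rewrite ge0_integral_pushforward ?preimage_setT //.
  exact: measurable_tcons.
exact: measurableT_comp.
Qed.

Let integral_tcons (f : n.+1.-tuple TR -> \bar R) :
  (lebesgue_tuple R n.+1).-integrable setT f ->
  (\int[lebesgue_tuple R n.+1]_t f t =
   \int[lebesgue_measure \x lebesgue_tuple R n]_p f (tcons p))%E.
Proof.
move=> If; have Ip := integrable_tcons If.
have -> : (\int[lebesgue_tuple R n.+1]_x f x =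
    \int[pushforward (lebesgue_measure \x lebesgue_tuple R n)%E (@tcons R n)]_x f x)%E.
  by apply: eq_measure_integral => [|A mA _]; [exact: measurable_tcons|].
rewrite integral_pushforward ?preimage_setT //.
  exact: measurable_tcons.
exact: measurable_int If.
Qed.

(** Fubini in the weak form that the divergence theorem needs. This order serves derivatives in a
    coordinate other than the first, [rint_eq0_lines] those in the first. *)
Lemma rint_eq0_rows (g : 'rV[R]_n.+1 -> R) : rinteg g ->
  (forall x, rinteg (fun v => g (cons_row x v))) ->
  (forall x, rint (fun v => g (cons_row x v)) = 0) -> rint g = 0.
Proof.
rewrite rintegE => Ig Igx g0; rewrite rintE /Rintegral integral_tcons //.
rewrite -(integral12_prod_meas1 (integrable_tcons Ig)).
rewrite integral0_eq // => x _; rewrite /fubini_F /=.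
under eq_integral do rewrite row_tcons.
have := g0 x; have := Igx x; rewrite rintegE rintE /Rintegral => I0 E0.
by rewrite -[LHS]fineK ?E0 //; exact: integrable_fin_num.
Qed.

Lemma rint_eq0_lines (g : 'rV[R]_n.+1 -> R) : rinteg g ->
  (forall v, \int[lebesgue_measure]_(x in (setT : set TR)) (g (cons_row x v))%:E = 0)%E ->
  rint g = 0.
Proof.
rewrite rintegE => Ig g0; rewrite rintE /Rintegral integral_tcons //.
rewrite -(integral21_prod_meas1 (integrable_tcons Ig)).
rewrite integral0_eq // => t _; rewrite /fubini_G /=.
by under eq_integral do rewrite row_tcons.
Qed.

End fubini_row.

Section divergence.
Context {R : realType}.

Lemma cons_row_ge (n : nat) (x : R) (v : 'rV[R]_n) :
  `|v| <= `|cons_row x v| /\ `|x| <= `|cons_row x v|.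
Proof.
split; last first.
  by have := coord_le_norm (cons_row x v) ord0; rewrite mxE unlift_none.
apply: norm_le_coord => // k.
by have := coord_le_norm (cons_row x v) (lift ord0 k); rewrite mxE liftK.
Qed.

Lemma cons_row_continuous_r (n : nat) (x : R) : continuous (@cons_row R n x).
Proof.
move=> v; apply/(@cvgrPdist_le R _ _ (nbhs v) (nbhs_filter v)) => e e0.
apply/nbhs_ballP; exists e => //= w; rewrite -ball_normE /= => vw.
apply: le_trans (ltW vw).
apply: norm_le_coord => // j; rewrite !mxE.
case: unliftP => [k _|_]; last by rewrite subrr normr0.
by have := coord_le_norm (v - w) k; rewrite !mxE.
Qed.

Lemma cons_row_continuous_l (n : nat) (v : 'rV[R]_n) :
  continuous (fun x : R => cons_row x v).
Proof.
move=> x; apply/cvgrPdist_le => e e0.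
apply/nbhs_ballP; exists e => //= y vw.
apply: le_trans (ltW vw).
apply: norm_le_coord => // j; rewrite !mxE.
by case: unliftP => [k _|_]; rewrite ?subrr ?normr0.
Qed.

Lemma integral_derive_supp (G g : R -> R) (r : R) :
  (forall x : R, is_derive x 1 G (g x)) -> continuous g ->
  (forall x, r < `|x| -> G x = 0) -> (forall x, r < `|x| -> g x = 0) ->
  (\int[lebesgue_measure]_(x in (setT : set (measurableTypeR R))) (g x)%:E = 0)%E.
Proof.
move=> dG cg G0 g0.
pose a : R := `|r| + 1.
have a0 : 0 < a by rewrite ltr_wpDl.
have ra : r < a by rewrite (le_lt_trans (ler_norm _)) // ltrDl.
have Na : - a < a by rewrite ltrNl (lt_trans _ a0) // oppr_lt0.
have cG : continuous G by move=> x; exact: is_derive_continuous1 (dG x).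
transitivity (\int[lebesgue_measure]_(x in `[(- a)%R, a]%classic) (g x)%:E)%E.
  rewrite [RHS]integral_mkcond; apply: eq_integral => x _; rewrite patchE.
  case: ifPn => // xa; rewrite g0 //; rewrite (lt_le_trans ra) // leNgt.
  apply: contra xa => xa; rewrite inE /= in_itv /=.
  by rewrite -ler_norml ltW.
rewrite (continuous_FTC2 Na (F := G)).
- by rewrite !G0 ?subee // ?normrN gtr0_norm.
- exact: continuous_subspaceT.
- split.
  + by move=> x _; have [] := dG x.
  + by apply: cvg_at_right_filter; exact: cG.
  + by apply: cvg_at_left_filter; exact: cG.
- by move=> x _; rewrite derive1E; have [_ ->] := dG x.
Qed.

(** Induction on the dimension: a derivative in the first coordinate is integrated along lines by
    the fundamental theorem of calculus, any other one is treated with the first coordinate frozen.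
    Integration by parts below always consists in applying this to a product. *)
Lemma rint_derive_supp (n : nat) (k : 'I_n) (G g : 'rV[R]_n -> R) (r : R) :
  (forall x, is_derive x (delta_mx 0 k) G (g x)) -> continuous g ->
  (forall x, r < `|x| -> G x = 0) -> (forall x, r < `|x| -> g x = 0) ->
  rint g = 0.
Proof.
elim: n k G g => [[]//|n IH] k G g dG cg G0 g0.
have Ig : rinteg g by exact: rinteg_continuous_supp cg g0.
case: (unliftP ord0 k) => [j kj|k0].
- have cgx x : continuous (fun v => g (cons_row x v)).
    by move=> v; apply: continuous_comp; [exact: cons_row_continuous_r|exact: cg].
  have g0x x v : r < `|v| -> g (cons_row x v) = 0.
    by move=> rv; apply: g0; rewrite (lt_le_trans rv) // (cons_row_ge x v).1.
  apply: rint_eq0_rows => // x; first exact: rinteg_continuous_supp (cgx x) (g0x x).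
  apply: (IH j (fun v => G (cons_row x v))) => //.
  + move=> v; apply: is_derive_quotient (dG (cons_row x v)) => h.
    congr (G _ - G _); apply/rowP => i; rewrite !mxE.
    rewrite kj; case: unliftP => [l ->|->]; rewrite ?mxE ?eqxx /=.
      by rewrite (inj_eq (@lift_inj _ ord0)).
    by rewrite mulr0 add0r.
  + by move=> v rv; apply: G0; rewrite (lt_le_trans rv) // (cons_row_ge x v).1.
  + by move=> v rv; exact: g0x.
- apply: rint_eq0_lines => // v.
  apply: (@integral_derive_supp (fun x => G (cons_row x v)) _ r).
  + move=> x; apply: is_derive_quotient (dG (cons_row x v)) => h.
    congr (G _ - G _); apply/rowP => i; rewrite !mxE.
    rewrite k0; case: unliftP => [l ->|->]; rewrite ?eqxx /=.
      by rewrite mulr0 add0r.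
    by [].
  + move=> x; apply: (continuous_comp (@cons_row_continuous_l n v x)); exact: cg.
  + by move=> x rx; apply: G0; rewrite (lt_le_trans rx) // (cons_row_ge x v).2.
  + by move=> x rx; apply: g0; rewrite (lt_le_trans rx) // (cons_row_ge x v).2.
Qed.

End divergence.

(** * Smooth functions, bumps and mollification *)

Section smooth_whole_space.
Context {R : realType} {V : normedModType R}.
Implicit Types f g : V -> R.

Lemma Ck_on_continuous k (U : set V) f x : Ck_on k U f -> U x -> {for x, continuous f}.
Proof. by case: k => [|k] [cf _]; exact: cf. Qed.

Lemma Ck_on_is_derive k (U : set V) f x v :
  Ck_on k.+1 U f -> U x -> is_derive x v f ('D_v f x).
Proof. by move=> [_ /(_ v)[df _]] Ux; apply: derivableP; exact: df. Qed.

Lemma Ck_onS k (U : set V) f : Ck_on k.+1 U f -> Ck_on k U f.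
Proof.
elim: k f => [|k IH] f [cf df]; first by split.
by split => // v; have [dv cv] := df v; split => //; exact: IH.
Qed.

Let derive_fun f f' v : (forall x, is_derive x v f (f' x)) -> 'D_v f = f'.
Proof. by move=> df; apply/funext => x; have [_ ->] := df x. Qed.

Lemma Ck_onI k f (f' : V -> V -> R) :
  continuous f -> (forall v x, is_derive x v f (f' v x)) ->
  (forall v, Ck_on k setT (f' v)) -> Ck_on k.+1 setT f.
Proof.
move=> cf df cf'; split=> [x _|v]; first exact: cf.
by rewrite (derive_fun (df v)); split => // x _; have [] := df v x.
Qed.

Lemma Ck_on_cst k (c : R) : Ck_on k setT (fun _ : V => c).
Proof.
elim: k c => [|k IH] c; first by split=> // x _; exact: cst_continuous.
by refine (@Ck_onI k _ (fun _ _ => 0) _ _ _) => [x|v]; [exact: cst_continuous|exact: IH].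
Qed.

Lemma Ck_onD k f g : Ck_on k setT f -> Ck_on k setT g ->
  Ck_on k setT (fun x => f x + g x).
Proof.
elim: k f g => [|k IH] f g Cf Cg.
  by split => // x _; apply: cvgD; [exact: (Ck_on_continuous Cf)|exact: (Ck_on_continuous Cg)].
apply: (@Ck_onI _ _ (fun v x => 'D_v f x + 'D_v g x)).
- by move=> x; apply: cvgD; [exact: (Ck_on_continuous Cf)|exact: (Ck_on_continuous Cg)].
- by move=> v x; apply: is_deriveD_fun; [exact: (Ck_on_is_derive _ Cf)|exact: (Ck_on_is_derive _ Cg)].
- by move=> v; apply: IH; [exact: (Cf.2 v).2|exact: (Cg.2 v).2].
Qed.

Lemma Ck_onM k f g : Ck_on k setT f -> Ck_on k setT g ->
  Ck_on k setT (fun x => f x * g x).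
Proof.
elim: k f g => [|k IH] f g Cf Cg.
  by split => // x _; apply: cvgM; [exact: (Ck_on_continuous Cf)|exact: (Ck_on_continuous Cg)].
apply: (@Ck_onI _ _ (fun v x => 'D_v f x * g x + f x * 'D_v g x)).
- by move=> x; apply: cvgM; [exact: (Ck_on_continuous Cf)|exact: (Ck_on_continuous Cg)].
- by move=> v x; apply: is_deriveM_fun; [exact: (Ck_on_is_derive _ Cf)|exact: (Ck_on_is_derive _ Cg)].
- move=> v; apply: Ck_onD; apply: IH; [exact: (Cf.2 v).2|exact: Ck_onS|exact: Ck_onS|exact: (Cg.2 v).2].
Qed.

Lemma smooth_cst (c : R) : smooth_on setT (fun _ : V => c).
Proof. by move=> k; exact: Ck_on_cst. Qed.

Lemma smoothM f g : smooth_on setT f -> smooth_on setT g ->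
  smooth_on setT (fun x => f x * g x).
Proof. by move=> Sf Sg k; exact: Ck_onM. Qed.

Lemma smooth_prod (I : Type) (s : seq I) (F : I -> V -> R) :
  (forall i, smooth_on setT (F i)) -> smooth_on setT (fun x => \prod_(i <- s) F i x).
Proof.
move=> SF; elim: s => [|i s IH].
  by under eq_fun do rewrite big_nil; exact: smooth_cst.
by under eq_fun do rewrite big_cons; exact: smoothM.
Qed.

Lemma smooth_derive f v : smooth_on setT f -> smooth_on setT ('D_v f).
Proof. by move=> Sf k; exact: ((Sf k.+1).2 v).2. Qed.

Lemma smooth_continuous f : smooth_on setT f -> continuous f.
Proof. by move=> Sf x; exact: (Ck_on_continuous (Sf 0)). Qed.

Lemma smooth_is_derive f x v : smooth_on setT f -> is_derive x v f ('D_v f x).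
Proof. by move=> Sf; exact: (Ck_on_is_derive v (Sf 1)). Qed.

(** Each derivative of the composite is the constant [L v] times a composite of the same kind, so
    the induction closes on itself. *)
Lemma Ck_on_comp_linear (h : R -> R) (l : V -> R) (L : V -> R) k :
  continuous l -> (forall v x, is_derive x v l (L v)) ->
  smooth_on (setT : set R^o) h -> Ck_on k setT (fun x => h (l x)).
Proof.
move=> cl dl.
have Sc (h1 : R -> R) : smooth_on (setT : set R^o) h1 -> continuous h1.
  by move=> S1 s; exact: ((S1 0).1 s I).
elim: k h => [|k IH] h Sh.
  by split => // x _; apply: continuous_comp; [exact: cl|exact: Sc].
apply: (@Ck_onI _ _ (fun v x => L v * 'D_1 h (l x))).
- by move=> x; apply: continuous_comp; [exact: cl|exact: Sc].
- move=> v x; rewrite mulrC; apply: (is_derive_comp1 (dl v x)).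
  by apply: derivableP; exact: (((Sh 1).2 1).1 (l x) I).
- move=> v; apply: Ck_onM; first exact: Ck_on_cst.
  by apply: (IH (fun s => 'D_1 h s)) => j; exact: ((Sh j.+1).2 1).2.
Qed.

Lemma smooth_comp_linear (h : R -> R) (l : V -> R) (L : V -> R) :
  continuous l -> (forall v x, is_derive x v l (L v)) ->
  smooth_on (setT : set R^o) h -> smooth_on setT (fun x => h (l x)).
Proof. by move=> cl dl Sh k; exact: Ck_on_comp_linear dl Sh. Qed.

Lemma smooth_affine f (w : V) (c : R) :
  smooth_on setT f -> smooth_on setT (fun x => f (w + c *: x)).
Proof.
move=> Sf k; elim: k f Sf => [|k IH] f Sf.
  split => // x _; apply: continuous_comp; last exact: smooth_continuous.
  by apply: cvgD; [exact: cvg_cst|apply: cvgZr; exact: cvg_id].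
apply: (@Ck_onI _ _ (fun v x => c * 'D_v f (w + c *: x))).
- move=> x; apply: continuous_comp; last exact: smooth_continuous.
  by apply: cvgD; [exact: cvg_cst|apply: cvgZr; exact: cvg_id].
- by move=> v x; apply: is_derive_affine; exact: smooth_is_derive.
- by move=> v; apply: Ck_onM; [exact: Ck_on_cst|apply: (IH (fun s => 'D_v f s)); exact: smooth_derive].
Qed.

Lemma derive_affine f (w x v : V) (c : R) :
  smooth_on setT f -> 'D_v (fun z => f (w + c *: z)) x = c * 'D_v f (w + c *: x).
Proof. by move=> Sf; have [_] := is_derive_affine (smooth_is_derive (w + c *: x) v Sf). Qed.

Lemma rsub_continuous (y : V) : continuous (fun x : V => y - x).
Proof. by move=> x; apply: cvgB; [exact: cvg_cst|exact: cvg_id]. Qed.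

Lemma ladd_continuous (y : V) : continuous (fun x : V => y + x).
Proof. by move=> x; apply: cvgD; [exact: cvg_cst|exact: cvg_id]. Qed.

Lemma lipschitz_at_continuous f (y : V) (C : R) :
  0 <= C -> (forall h, `|f (y + h) - f y| <= C * `|h|) -> {for y, continuous f}.
Proof.
move=> C0 H; apply/cvgrPdist_le => e e0.
have C1 : 0 < C + 1 by rewrite ltr_wpDl.
apply/nbhs_ballP; exists (e / (C + 1)); first by rewrite /= divr_gt0.
move=> z; rewrite -ball_normE /= => yz.
rewrite distrC (_ : z = y + (z - y)); last by rewrite addrC subrK.
apply: (le_trans (H _)).
apply: (@le_trans _ _ ((C + 1) * `|z - y|)); first by rewrite ler_wpM2r // lerDl.
by rewrite mulrC -ler_pdivlMr // distrC ltW.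
Qed.

End smooth_whole_space.

Section bump.
Context {R : realType} {n : nat}.

(** Neither sign nor mass is prescribed, so that the class is stable under derivatives. *)
Definition bump (r : R) (k : 'rV[R]_n -> R) : Prop :=
  smooth_on setT k /\ forall x, r < `|x| -> k x = 0.

Lemma bump_continuous r k : bump r k -> continuous k.
Proof. by move=> [Sk _]; exact: smooth_continuous. Qed.

Lemma near_norm_gt (r : R) (x : 'rV[R]_n) : r < `|x| -> \forall y \near x, r < `|y|.
Proof.
move=> rx; have rx0 : 0 < `|x| - r by rewrite subr_gt0.
apply/nbhs_ballP; exists (`|x| - r) => //= y; rewrite -ball_normE /= => xy.
by have := ler_dist_dist x y; move=> /ler_normlP[_ ?]; lra.
Qed.

Lemma bump_derive r k v : bump r k -> bump r ('D_v k).
Proof.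
move=> [Sk k0]; split; first exact: smooth_derive.
move=> x rx; rewrite (_ : 0 = 'D_v (cst 0 : 'rV[R]_n -> R) x); last by rewrite derive_cst.
apply: near_eq_derive; apply: filterS (near_norm_gt rx) => y ry.
by rewrite k0.
Qed.

Lemma bump_bounded r k : bump r k -> exists2 M : R, 0 <= M & forall x, `|k x| <= M.
Proof. by move=> Bk; have [_ k0] := Bk; exact: continuous_bounded_supp (bump_continuous Bk) k0. Qed.

Lemma partials_lipschitz (f : 'rV[R]_n -> R) (f' : 'I_n -> 'rV[R]_n -> R) (M : R) :
  0 <= M -> (forall k x, is_derive x (delta_mx 0 k) f (f' k x)) ->
  (forall k x, `|f' k x| <= M) ->
  forall x h, `|f (x + h) - f x| <= M * n%:R * `|h|.
Proof.
move=> M0 df fM x h.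
(* The partial derivatives are bounded everywhere, so the radius may depend on [h]; this one
   contains the whole path. The slopes are 0. *)
have := @taylor1 R _ n f x (n%:R * `|h| + 1) M (fun k => delta_mx 0 k)
  (fun k v => v 0 k) f' (fun=> 0) _ _ _ M0 _ _ h.
under eq_bigr do rewrite mulr0.
rewrite big1_eq subr0; apply.
- by move=> k; exact: norm_delta_le1.
- by move=> k v; exact: coord_le_norm.
- by move=> v; rewrite {1}[v]row_sum_delta.
- by move=> k y _; rewrite subr0.
- by rewrite ltrDl.
Qed.

Lemma bump_lipschitz r k : bump r k ->
  exists2 L : R, 0 <= L & forall x h, `|k (x + h) - k x| <= L * `|h|.
Proof.
move=> Bk.
have /choice[M MP] : forall i : 'I_n, exists M : R, 0 <= M /\ forall x, `|'D_(delta_mx 0 i) k x| <= M.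
  by move=> i; have [M M0 kM] := bump_bounded (bump_derive (delta_mx 0 i) Bk); exists M.
pose M1 := \sum_i M i.
have M10 : 0 <= M1 by apply: sumr_ge0 => i _; exact: (MP i).1.
exists (M1 * n%:R); first by rewrite mulr_ge0.
apply: (@partials_lipschitz _ (fun i => 'D_(delta_mx 0 i) k)) => //.
  by move=> i x; exact: smooth_is_derive Bk.1.
move=> i x; apply: le_trans ((MP i).2 x) _.
by rewrite /M1 (bigD1 i) //= lerDl; apply: sumr_ge0 => j _; exact: (MP j).1.
Qed.

Lemma bump_reflect r k (y : 'rV[R]_n) : bump r k ->
  continuous (fun x : 'rV[R]_n => k (y - x)) /\ forall x, r + `|y| < `|x| -> k (y - x) = 0.
Proof.
move=> Bk; split.
  move=> x; apply: (@continuous_comp _ _ _ (fun x : 'rV[R]_n => y - x) k); last first.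
    exact: (bump_continuous Bk).
  exact: rsub_continuous.
move=> x xr; have [_ k0] := Bk; apply: k0.
by have := ler_normD (x - y) y; rewrite subrK distrC; lra.
Qed.

Definition conv (g k : 'rV[R]_n -> R) (y : 'rV[R]_n) : R :=
  rint (fun x => g x * k (y - x)).

Lemma rinteg_conv g r k y : rinteg g -> bump r k ->
  rinteg (fun x => g x * k (y - x)).
Proof.
move=> Ig Bk; have [M M0 kM] := bump_bounded Bk.
apply: (@rintegM_bounded _ _ _ _ M) => //.
by apply: rV_measurable_continuous; have [] := bump_reflect y Bk.
Qed.

Lemma conv_continuous g r k : rinteg g -> bump r k -> continuous (conv g k).
Proof.
move=> Ig Bk y; have [L L0 kL] := bump_lipschitz Bk.
pose N := rint (fun x => `|g x|).
have N0 : 0 <= N by apply: rint_ge0 => x.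
have H h : `|conv g k (y + h) - conv g k y| <= (L * N) * `|h|.
  have Ic := rinteg_conv (y + h) Ig Bk; have Ic' := rinteg_conv y Ig Bk.
  rewrite /conv -rintB // mulrAC -rintZ; last exact: rinteg_norm.
  apply: norm_rint_le.
  - exact: rintegB.
  - by apply: rintegZ; exact: rinteg_norm.
  - move=> x; rewrite -mulrBr normrM mulrC ler_wpM2r //.
    by rewrite addrAC kL.
by apply: (lipschitz_at_continuous _ H); rewrite mulr_ge0.
Qed.

(** All derivatives fall on the kernel, so [g] need only be integrable. The Lipschitz bound on
    ['D_v k] makes the pointwise error [O(h^2)] uniformly in [x], and integrating against [|g|]
    keeps this order. *)
Lemma conv_is_derive g r k y v : rinteg g -> bump r k ->
  is_derive y v (conv g k) (conv g ('D_v k) y).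
Proof.
move=> Ig Bk; have Bk' := bump_derive v Bk.
have [L L0 kL] := bump_lipschitz Bk'.
pose N := rint (fun x => `|g x|).
have N0 : 0 <= N by apply: rint_ge0 => x.
apply/is_derive_epsP => e e0.
pose C := L * `|v| * N.
have C0 : 0 <= C by rewrite !mulr_ge0.
have H h : `|conv g k (y + h *: v) - conv g k y - h * conv g ('D_v k) y|
    <= C * `|h| * `|h|.
  have Ic := rinteg_conv (y + h *: v) Ig Bk; have Ic' := rinteg_conv y Ig Bk.
  have Ic'' := rinteg_conv y Ig Bk'.
  rewrite /conv -rintB // -rintZ // -rintB; last 2 first.
  - exact: rintegB.
  - exact: rintegZ.
  have -> : C * `|h| * `|h| = L * `|v| * `|h| * `|h| * N by rewrite /C; ring.
  rewrite -rintZ; last exact: rinteg_norm.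
  apply: norm_rint_le.
  - by apply: rintegB; [exact: rintegB|exact: rintegZ].
  - by apply: rintegZ; exact: rinteg_norm.
  - move=> x; rewrite mulrCA -!mulrBr normrM mulrC ler_wpM2r //.
    have D1 (t : R) : is_derive t 1 (fun t => k (y - x + t *: v)) ('D_v k (y - x + t *: v)).
      by apply: is_derive_line; exact: smooth_is_derive Bk.1.
    have D2 (t : R) : `|t| <= `|h| ->
        `|'D_v k (y - x + t *: v) - 'D_v k (y - x)| <= L * `|v| * `|h|.
      move=> th; apply: (le_trans (kL _ _)); rewrite normrZ -mulrA ler_wpM2l //.
      by rewrite mulrC ler_wpM2l.
    have := mvt_dist (fun t _ => D1 t) D2.
    by rewrite scale0r addr0 (addrAC y).
have Ce : 0 < e / (C + 1) by rewrite divr_gt0 // ltr_wpDl.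
apply/nbhs_ballP; exists (e / (C + 1)) => //= h hC.
apply: (le_trans (H h)); rewrite ler_wpM2r //.
apply: (@le_trans _ _ ((C + 1) * `|h|)); first by rewrite ler_wpM2r // lerDl.
rewrite mulrC -ler_pdivlMr ?ltr_wpDl // ltW //.
by move: hC; rewrite /ball /= sub0r normrN.
Qed.

End bump.

Section mollifier.
Context {R : realType} {n : nat}.
Implicit Types k : 'rV[R]_n -> R.

Lemma is_derive_reflect k (y x v : 'rV[R]_n) : smooth_on setT k ->
  is_derive x v (fun z => k (y - z)) (- 'D_v k (y - x)).
Proof.
move=> Sk; have := is_derive_affine (w := y) (c := -1) (smooth_is_derive (y + -1 *: x) v Sk).
rewrite scaleN1r mulN1r => H.
have -> : (fun z => k (y - z)) = fun z => k (y + -1 *: z).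
  by apply/funext => z; rewrite scaleN1r.
exact: H.
Qed.

Lemma rint_bump_derive r k (j : 'I_n) (y : 'rV[R]_n) : bump r k ->
  rint (fun x => 'D_(delta_mx 0 j) k (y - x)) = 0.
Proof.
move=> Bk; have Bk' := bump_derive (delta_mx 0 j) Bk.
have [ck k0] := bump_reflect y Bk; have [ck' k0'] := bump_reflect y Bk'.
have H : rint (fun x => - 'D_(delta_mx 0 j) k (y - x)) = 0.
  apply: (@rint_derive_supp _ _ j (fun x => k (y - x)) _ (r + `|y|)) => //.
  - by move=> x; apply: is_derive_reflect; exact: Bk.1.
  - by move=> x; apply: (continuousN (ck' x)).
  - by move=> x rx; rewrite k0' // oppr0.
have Ik : rinteg (fun x => 'D_(delta_mx 0 j) k (y - x)).
  exact: rinteg_continuous_supp ck' k0'.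
by apply: oppr_inj; rewrite oppr0 -H -[LHS]mulN1r -rintZ //; apply: eq_rint => x; rewrite mulN1r.
Qed.

(** Translation invariance from the divergence theorem: as a function of [y] the integral has
    partial derivatives [rint_bump_derive], all zero. Convolving with the indicator of a large cube
    brings it under [conv_is_derive], and Taylor with error 0 gives constancy. *)
Lemma rint_bump_translate r k (y : 'rV[R]_n) : 0 <= r -> bump r k ->
  rint (fun x => k (y - x)) = rint (fun x => k (0 - x)).
Proof.
(* [R1] exceeds [n * |y|], the bound on the path from 0 to [y], and [|y|] itself. For centres within
   [R1] the support of the translated bump stays in the cube of radius [r + R1], where the indicator
   is 1. *)
move=> r0 Bk; pose R1 := n%:R * `|y| + `|y| + 1.
have R10 : 0 <= r + R1 by rewrite !addr_ge0 ?mulr_ge0.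
pose g : 'rV[R]_n -> R := \1_(cube 0 (r + R1)).
have Ig : rinteg g by exact: rinteg_cube.
have convE k1 z : bump r k1 -> `|z| < R1 -> conv g k1 z = rint (fun x => k1 (z - x)).
  move=> Bk1 zR; apply: eq_rint => x; rewrite /g indicE.
  case: (boolP (x \in _)) => [_|]; first by rewrite mul1r.
  rewrite notin_setE /cube /= sub0r normrN => /negP; rewrite -ltNge => xR.
  rewrite mul0r; have [_ k0] := Bk1; rewrite k0 //.
  by have := ler_normD (x - z) z; rewrite subrK distrC; lra.
have := @taylor1 R _ n (conv g k) 0 R1 0 (fun j => delta_mx 0 j)
  (fun j v => v 0 j) (fun j => conv g ('D_(delta_mx 0 j) k)) (fun=> 0).
move=> /(_ (fun j => norm_delta_le1 R j) (fun j v => coord_le_norm v j)).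
move=> /(_ (fun v => row_sum_delta v) (lexx 0)).
move=> /(_ (fun j z _ => conv_is_derive z _ Ig Bk)).
have D0 : forall (j : 'I_n) z, `|z - 0| < R1 -> `|conv g ('D_(delta_mx 0 j) k) z - 0| <= 0.
  move=> j z; rewrite subr0 => zR.
  by rewrite convE ?(rint_bump_derive _ _ Bk) ?subrr ?normr0 //; exact: bump_derive.
have ny : 0 <= n%:R * `|y| by rewrite mulr_ge0.
have y0 := normr_ge0 y.
have nyR : n%:R * `|y| < R1 by rewrite /R1; lra.
have yR : `|y| < R1 by rewrite /R1; lra.
move=> /(_ D0 y nyR).
under eq_bigr do rewrite mulr0.
rewrite big1_eq subr0 !mul0r normr_le0 add0r subr_eq0 => /eqP.
by rewrite !convE // normr0; rewrite /R1; lra.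
Qed.

Variable gamma : R -> R.
Hypothesis pen : penalty gamma.

(** As [gamma] is positive exactly on the positive axis, each factor is a smooth even function of
    [z 0 i], positive exactly for [|z 0 i| < 1]. *)
Definition kernel (z : 'rV[R]_n) : R := \prod_i (gamma (1 - z 0 i) * gamma (1 + z 0 i)).

Lemma kernel_ge0 z : 0 <= kernel z.
Proof. by apply: prodr_ge0 => i _; rewrite mulr_ge0 ?(pen_ge0 pen). Qed.

Lemma kernelN z : kernel (- z) = kernel z.
Proof. by apply: eq_bigr => i _; rewrite mxE opprK mulrC. Qed.

Lemma kernel_gt0 z : `|z| < 1 -> 0 < kernel z.
Proof.
move=> z1; apply: prodr_gt0 => i _.
have := le_lt_trans (coord_le_norm z i) z1; rewrite ltr_norml => /andP[? ?].
by rewrite mulr_gt0 // (pen_gt0 pen); lra.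
Qed.

Lemma coord_is_derive (i : 'I_n) (x v : 'rV[R]_n) :
  is_derive x v (fun z : 'rV[R]_n => z 0 i) (v 0 i).
Proof.
apply/is_derive_epsP => e e0; apply/nbhs_ballP; exists 1 => //= h _.
rewrite !mxE [X in `|X|](_ : _ = 0); last by ring.
by rewrite normr0 mulr_ge0 // ltW.
Qed.

Lemma kernel_bump : bump 1 kernel.
Proof.
split.
  apply: (@smooth_prod R _ _ (index_enum 'I_n)
    (fun (i : 'I_n) (z : 'rV[R]_n) => gamma (1 - z 0 i) * gamma (1 + z 0 i))) => i.
  have cc : continuous (fun z : 'rV[R]_n => z 0 i) by exact: coord_continuous.
  apply: smoothM.
    refine (@smooth_comp_linear _ 'rV[R]_n gamma (fun z => 1 - z 0 i) (fun v => 0 - v 0 i) _ _ _).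
    - move=> z; apply: (@continuous_comp _ _ _ _ (fun s : R => 1 - s) z (cc z)).
      exact: (@rsub_continuous R R^o 1).
    - by move=> v x; apply: is_deriveB_fun; exact: coord_is_derive.
    - exact: pen_smooth pen.
  refine (@smooth_comp_linear _ 'rV[R]_n gamma (fun z => 1 + z 0 i) (fun v => 0 + v 0 i) _ _ _).
  - move=> z; apply: (@continuous_comp _ _ _ _ (fun s : R => 1 + s) z (cc z)).
    exact: (@ladd_continuous R R^o 1).
  - by move=> v x; apply: is_deriveD_fun; exact: coord_is_derive.
  - exact: pen_smooth pen.
move=> z z1.
have /existsP[i] : [exists i : 'I_n, 1 < `|z 0 i|].
  apply: contraLR z1; rewrite negb_exists => /forallP H; rewrite -leNgt.
  by apply: norm_le_coord => // i; rewrite leNgt H.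
move=> zi; rewrite /kernel (bigD1 i) //=.
suff -> : gamma (1 - z 0 i) * gamma (1 + z 0 i) = 0 by rewrite mul0r.
have [zp|zn] := leP 0 (z 0 i).
  by rewrite (pen_eq0 pen) ?mul0r // subr_le0 ltW // -(ger0_norm zp).
rewrite [X in _ * X](pen_eq0 pen) ?mulr0 //.
by move: zi; rewrite ltr0_norm // => ?; lra.
Qed.

Lemma kernel_lower : exists2 c : R, 0 < c & forall z, `|z| <= 2^-1 -> c <= kernel z.
Proof.
have [||c cK H] := @EVT_min_rV R n kernel [set x : 'rV[R]_n | `|x| <= 2^-1] _ (@compact_cube R n _).
- by exists 0; rewrite /= normr0 invr_ge0.
- by apply: continuous_subspaceT; exact: bump_continuous kernel_bump.
exists (kernel c).
  apply: kernel_gt0; move: cK; rewrite inE /= => /le_lt_trans; apply.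
  by rewrite invf_lt1 // ltr1n.
by move=> z z2; apply: H; rewrite inE.
Qed.

(** The summand 0 gives the shape [w + c *: x] of [smooth_affine] and [derive_affine]. *)
Definition scaled_kernel (eta : R) (z : 'rV[R]_n) : R := kernel (0 + eta^-1 *: z).

Lemma scaled_kernel_bump eta : 0 < eta -> bump eta (scaled_kernel eta).
Proof.
move=> e0; split; first by apply: smooth_affine; exact: kernel_bump.1.
move=> z ez; rewrite /scaled_kernel add0r; have [_ k0] := kernel_bump; apply: k0.
by rewrite normrZ gtr0_norm ?invr_gt0 // mulrC ltr_pdivlMr // mul1r.
Qed.

Definition mass (eta : R) : R := rint (fun x => scaled_kernel eta (0 - x)).

Definition mollifier (eta : R) (z : 'rV[R]_n) : R :=
  (mass eta)^-1 * scaled_kernel eta z.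

(** The mass is compared with the cube of radius [eta / 2], on which the kernel is at least [c].
    This lower bound of the right order replaces a change of variables. *)
Lemma mass_lower : exists2 c : R, 0 < c & forall eta, 0 < eta -> c * eta ^+ n <= mass eta.
Proof.
have [c c0 kc] := kernel_lower; exists c => // eta e0.
have e20 : 0 <= eta / 2 by rewrite divr_ge0 // ltW.
rewrite (_ : eta ^+ n = rint (\1_(cube (0 : 'rV[R]_n) (eta / 2)))); last first.
  by rewrite rint_cube //; congr (_ ^+ _); field.
rewrite -rintZ; last exact: rinteg_cube.
have Be := scaled_kernel_bump e0.
apply: le_rint.
- by apply: rintegZ; exact: rinteg_cube.
- by have [ck k0] := bump_reflect 0 Be; exact: rinteg_continuous_supp ck k0.
- move=> x; rewrite indicE; case: (boolP (x \in _)) => xc; last first.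
    by rewrite mulr0 kernel_ge0.
  rewrite mulr1; apply: kc; rewrite add0r normrZ gtr0_norm ?invr_gt0 //.
  by move: xc; rewrite inE /cube /= => xc; rewrite mulrC ler_pdivrMr // mulrC.
Qed.

Lemma mass_gt0 eta : 0 < eta -> 0 < mass eta.
Proof.
move=> e0; have [c c0 H] := mass_lower.
by apply: lt_le_trans (H _ e0); rewrite mulr_gt0 // exprn_gt0.
Qed.

Lemma mollifier_bump eta : 0 < eta -> bump eta (mollifier eta).
Proof.
move=> e0; have [S k0] := scaled_kernel_bump e0; split.
  by apply: smoothM => //; exact: smooth_cst.
by move=> x ex; rewrite /mollifier k0 // mulr0.
Qed.

Lemma mollifier_ge0 eta z : 0 < eta -> 0 <= mollifier eta z.
Proof. by move=> e0; rewrite mulr_ge0 ?kernel_ge0 // invr_ge0 ltW // mass_gt0. Qed.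

Lemma mollifierN eta z : mollifier eta (- z) = mollifier eta z.
Proof. by rewrite /mollifier /scaled_kernel !add0r scalerN kernelN. Qed.

Lemma rint_mollifier eta y : 0 < eta -> rint (fun x => mollifier eta (y - x)) = 1.
Proof.
move=> e0; have Be := scaled_kernel_bump e0; rewrite /mollifier.
rewrite rintZ; last by have [ck k0] := bump_reflect y Be; exact: rinteg_continuous_supp ck k0.
by rewrite (rint_bump_translate y (ltW e0) Be) mulVf // gt_eqF // mass_gt0.
Qed.

Lemma mollifier_bound : exists2 M : R, 0 <= M & forall eta, 0 < eta ->
  (forall z, `|mollifier eta z| <= M * eta ^- n) /\
  (forall j z, `|'D_(delta_mx 0 j) (mollifier eta) z| <= M * eta ^- n / eta).
Proof.
have [c c0 mc] := mass_lower.
have [M0 M00 kM] := bump_bounded kernel_bump.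
have /choice[M MP] : forall i : 'I_n, exists M : R, 0 <= M /\ forall x, `|'D_(delta_mx 0 i) kernel x| <= M.
  by move=> i; have [M M1 H] := bump_bounded (bump_derive (delta_mx 0 i) kernel_bump); exists M.
have SM : 0 <= \sum_i M i by apply: sumr_ge0 => i _; exact: (MP i).1.
(* A common bound for the kernel and all its first partial derivatives, so that one constant serves
   both estimates. *)
pose N := M0 + \sum_i M i.
exists (c^-1 * N); first by rewrite mulr_ge0 ?invr_ge0 ?(ltW c0) // addr_ge0.
move=> eta e0.
have en : 0 < eta ^+ n by rewrite exprn_gt0.
have mi : `|(mass eta)^-1| <= c^-1 * eta ^- n.
  rewrite gtr0_norm ?invr_gt0 ?mass_gt0 // -invfM lef_pV2 ?posrE ?mass_gt0 //.
    exact: mc.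
  by rewrite mulr_gt0.
split=> [z|j z].
  rewrite /mollifier normrM mulrAC ler_pM // (le_trans (kM _)) //.
  by rewrite /N lerDl.
have Sk := kernel_bump.1.
have -> : 'D_(delta_mx 0 j) (mollifier eta) z =
    (mass eta)^-1 * (eta^-1 * 'D_(delta_mx 0 j) kernel (0 + eta^-1 *: z)).
  rewrite -derive_affine //.
  by have [_ <-] := is_deriveZ_fun (mass eta)^-1
    (smooth_is_derive z (delta_mx 0 j) (scaled_kernel_bump e0).1).
rewrite normrM.
rewrite [`|_^-1 * _|]normrM [`|eta^-1|]gtr0_norm ?invr_gt0 //.
have -> : c^-1 * N * eta ^- n / eta = (c^-1 * eta ^- n) * (eta^-1 * N) by ring.
rewrite ler_pM ?mulr_ge0 ?invr_ge0 ?(ltW e0) //.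
rewrite ler_wpM2l ?invr_ge0 ?(ltW e0) // (le_trans ((MP j).2 _)) // /N.
rewrite (bigD1 j) //= addrCA lerDl addr_ge0 //.
by apply: sumr_ge0 => i _; exact: (MP i).1.
Qed.

End mollifier.

(** * Averages over cubes and approximation *)

Section cube_average.
Context {R : realType} {n : nat}.
Local Notation TR := (measurableTypeR R).
Local Notation T := (n.-tuple TR).
Local Notation mu := (lebesgue_tuple R n).
Local Notation row := (@row_of_tuple R n).

Lemma EFin_rint (f : 'rV[R]_n -> R) : rinteg f ->
  (rint f)%:E = (\int[mu]_t (f (row t))%:E)%E.
Proof.
by rewrite rintegE rintE /Rintegral => If; rewrite fineK //; exact: integrable_fin_num.
Qed.

Let near_diag (r : R) : set (T * T) := [set z | cube (row z.2) r (row z.1)].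

Let measurable_near_diag (r : R) : 0 <= r -> measurable (near_diag r).
Proof.
move=> r0.
have -> : near_diag r = \bigcap_(i in [set: 'I_n])
    ((fun z : T * T => tnth z.2 i - tnth z.1 i) @^-1` `[- r, r]%classic).
  apply/seteqP; split => z.
    move=> /(cubeP _ _ r0) H i _; have := H i.
    by rewrite !mxE /= in_itv /= ler_norml.
  move=> H; apply/(cubeP _ _ r0) => i; have := H i I.
  by rewrite !mxE /= in_itv /= ler_norml.
apply: fin_bigcap_measurable => // i _.
rewrite -[X in measurable X]setTI.
have m1 : measurable_fun setT (fun z : T * T => tnth z.1 i : TR).
  by apply: (measurableT_comp (measurable_tnth i)); exact: measurable_fst.
have m2 : measurable_fun setT (fun z : T * T => tnth z.2 i : TR).
  by apply: (measurableT_comp (measurable_tnth i)); exact: measurable_snd.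
by apply: (measurable_funB m2 m1) => //; exact: measurable_itv.
Qed.

Definition cube_sum (g : 'rV[R]_n -> R) (r : R) (y : 'rV[R]_n) : R :=
  rint (fun x => g x * \1_(cube y r) x).

Lemma rinteg_mul_cube (g : 'rV[R]_n -> R) (r : R) y : 0 <= r -> rinteg g ->
  rinteg (fun x => g x * \1_(cube y r) x).
Proof.
move=> r0 Ig; apply: (@rintegM_bounded _ _ _ _ 1) => //.
  exact: rV_measurable_cube.
by move=> x; rewrite indicE; case: (_ \in _); rewrite ?normr1 ?normr0.
Qed.

Let phi (g : 'rV[R]_n -> R) (r : R) (z : T * T) : \bar R :=
  (g (row z.1) * \1_(near_diag r) z)%:E.

Let measurable_phi (g : 'rV[R]_n -> R) (r : R) : 0 <= r -> rinteg g -> measurable_fun setT (phi g r).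
Proof.
move=> r0 Ig; apply/measurable_EFinP; apply: measurable_funM.
  by apply: (measurableT_comp (rinteg_measurable Ig)); exact: measurable_fst.
exact: measurable_indic (measurable_near_diag r0).
Qed.

Let phi_ge0 (g : 'rV[R]_n -> R) (r : R) : (forall x, 0 <= g x) -> forall z, (0 <= phi g r z)%E.
Proof. by move=> g0 z; rewrite lee_fin mulr_ge0. Qed.

Let indic_diag r z : \1_(near_diag r) z = \1_(cube (row z.2) r) (row z.1) :> R.
Proof. by rewrite !indicE; congr (nat_of_bool _)%:R; apply/idP/idP => /set_mem H; exact: mem_set. Qed.

Let phiE (g : 'rV[R]_n -> R) (r : R) : 0 <= r -> rinteg g -> forall u : T,
  (\int[mu]_t phi g r (t, u) = (cube_sum g r (row u))%:E)%E.
Proof.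
move=> r0 Ig u; rewrite EFin_rint; last exact: rinteg_mul_cube.
by apply: eq_integral => t _; rewrite /phi indic_diag.
Qed.

(** Tonelli: being within [r] is a symmetric relation, so each point [x] is counted with the measure
    of the cube centred at [x]. *)
Let integral_cube_sum (g : 'rV[R]_n -> R) (r : R) : 0 <= r -> rinteg g -> (forall x, 0 <= g x) ->
  (\int[mu]_u (cube_sum g r (row u))%:E = ((2 * r) ^+ n * rint g)%:E)%E.
Proof.
move=> r0 Ig g0.
transitivity (\int[mu]_u \int[mu]_t phi g r (t, u))%E.
  by apply: eq_integral => u _; rewrite phiE.
rewrite -(fubini_tonelli (phi g r) (measurable_phi r0 Ig) (phi_ge0 r g0)).
have IgE : mu.-integrable setT (fun t => (g (row t))%:E) by rewrite -rintegE.
rewrite EFinM (EFin_rint Ig) -(integralZl measurableT IgE).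
apply: eq_integral => t _; rewrite /phi /fubini_F /=.
have E u : (g (row t) * \1_(near_diag r) (t, u))%:E =
    ((g (row t))%:E * (\1_(row @^-1` cube (row t) r) u)%:E)%E.
  rewrite -EFinM indic_diag /= !indicE; congr (_ * (nat_of_bool _)%:R)%:E.
  by apply/idP/idP => /set_mem H; apply: mem_set; move: H; rewrite /cube /= distrC.
under eq_integral do rewrite E.
have mC : measurable_fun setT (fun u : T => (\1_(row @^-1` cube (row t) r) u)%:E : \bar R).
  by apply/measurable_EFinP; exact: measurable_indic (measurable_cube _ r0).
have C0 u : (setT : set T) u -> (0 <= (\1_(row @^-1` cube (row t) r) u)%:E :> \bar R)%E.
  by move=> _; rewrite lee_fin.
have gt0 : (0 <= (g (row t))%:E)%E by rewrite lee_fin.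
rewrite (ge0_integralZl mu measurableT mC C0 gt0).
rewrite integral_indic //; last exact: measurable_cube.
by rewrite setIT [X in (_ * X)%E](measure_cube _ r0) muleC.
Qed.

Lemma rinteg_cube_sum (g : 'rV[R]_n -> R) (r : R) : 0 <= r -> rinteg g -> (forall x, 0 <= g x) ->
  rinteg (cube_sum g r).
Proof.
move=> r0 Ig g0; rewrite rintegE; apply/integrableP; split.
  have -> : (fun t : T => (cube_sum g r (row t))%:E) =
      (fun u => \int[mu]_t phi g r (t, u))%E by apply/funext => u; rewrite phiE.
  exact: (measurable_fun_fubini_tonelli_G (phi g r) (measurable_phi r0 Ig) (phi_ge0 r g0)).
under eq_integral.
  move=> t _; rewrite gee0_abs; last first.
    by rewrite lee_fin; apply: rint_ge0 => x; rewrite mulr_ge0.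
  over.
by rewrite integral_cube_sum // ltry.
Qed.

Lemma rint_cube_sum (g : 'rV[R]_n -> R) (r : R) : 0 <= r -> rinteg g -> (forall x, 0 <= g x) ->
  rint (cube_sum g r) = (2 * r) ^+ n * rint g.
Proof.
move=> r0 Ig g0; apply: EFin_inj; rewrite EFin_rint ?integral_cube_sum //.
exact: rinteg_cube_sum.
Qed.

(** A point is a cube of radius 0, of measure [0 ^+ n], which is 0 because [n > 0]. The pole can
    thus be left out of integrals. *)
Lemma rint_point (f : 'rV[R]_n -> R) (x0 : 'rV[R]_n) : (0 < n)%N ->
  rinteg f ->
  (\int[mu]_(t in ~` (row @^-1` [set x0])) (f (row t))%:E = (rint f)%:E)%E.
Proof.
move=> n0 If; rewrite EFin_rint //.
have E : [set x0] = cube x0 0.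
  apply/seteqP; split => x /=; first by move=> ->; rewrite /cube /= subrr normr0.
  by rewrite /cube /= normr_le0 subr_eq0 => /eqP.
have mN : measurable (row @^-1` cube x0 0) by exact: measurable_cube.
have IfE : mu.-integrable setT (fun t => (f (row t))%:E) by rewrite -rintegE.
have N0 : mu (row @^-1` cube x0 0) = 0%E.
  by rewrite [LHS](measure_cube x0 (lexx 0)) mulr0 expr0n eqn0Ngt n0.
by rewrite E (negligible_integral mN measurableT IfE N0) setTD.
Qed.

End cube_average.

Section approximation.
Context {R : realType} {n : nat} (gamma : R -> R) (pen : penalty gamma).
Local Notation rho eta := (@mollifier R n gamma eta).

(** The factor [eta ^- n] cancels the measure of the cube, leaving a bound free of [eta]. *)
Lemma small_average (h : 'rV[R]_n -> R) (y : 'rV[R]_n) (eta e K : R) :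
  0 < eta -> rinteg h ->
  (forall x, `|h x| <= e * K * eta ^- n * \1_(cube y eta) x) ->
  `|rint h| <= e * (K * 2 ^+ n).
Proof.
move=> e0 Ih H; apply: le_trans (norm_rint_cube (ltW e0) Ih H) _.
rewrite exprMn le_eqVlt; apply/orP; left; apply/eqP.
have : eta ^+ n != 0 by rewrite expf_neq0 // gt_eqF.
by move: (eta ^+ n) => z z0; field.
Qed.

Lemma mollifier_cube (K eta : R) (y x : 'rV[R]_n) : 0 < eta -> 0 <= K ->
  (forall z, `|rho eta z| <= K * eta ^- n) ->
  `|rho eta (y - x)| <= K * eta ^- n * \1_(cube y eta) x.
Proof.
move=> e0 K0 H; rewrite indicE; case: (boolP (x \in _)) => [_|]; first by rewrite mulr1.
rewrite notin_setE /cube /= => /negP; rewrite -ltNge => xy.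
by rewrite (mollifier_bump pen e0).2 // normr0 mulr0.
Qed.

Lemma mollifier_derive_cube (K eta : R) (j : 'I_n) (y x : 'rV[R]_n) : 0 < eta -> 0 <= K ->
  (forall z, `|'D_(delta_mx 0 j) (rho eta) z| <= K * eta ^- n / eta) ->
  `|'D_(delta_mx 0 j) (rho eta) (y - x)| <= K * eta ^- n / eta * \1_(cube y eta) x.
Proof.
move=> e0 K0 H; rewrite indicE; case: (boolP (x \in _)) => [_|]; first by rewrite mulr1.
rewrite notin_setE /cube /= => /negP; rewrite -ltNge => xy.
by rewrite (bump_derive (delta_mx 0 j) (mollifier_bump pen e0)).2 // normr0 mulr0.
Qed.

Variables (K : R) (K0 : 0 <= K).
Hypothesis KP : forall eta, 0 < eta ->
  (forall z, `|rho eta z| <= K * eta ^- n) /\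
  (forall j z, `|'D_(delta_mx 0 j) (rho eta) z| <= K * eta ^- n / eta).

(** Continuity is asked at the single point [y], so that integrable functions with a pole elsewhere
    are covered. *)
Lemma cvg_conv_mollifier (g : 'rV[R]_n -> R) (y : 'rV[R]_n) (eta : nat -> R) :
  rinteg g -> {for y, continuous g} -> (forall m, 0 < eta m) ->
  eta m @[m --> \oo] --> 0 ->
  conv g (rho (eta m)) y @[m --> \oo] --> g y.
Proof.
move=> Ig cg eta0 etal; apply/cvgrPdist_le => e e0.
pose e1 := e / (K * 2 ^+ n + 1).
have C0 : 0 < K * 2 ^+ n + 1 by rewrite ltr_wpDl // mulr_ge0 // exprn_ge0.
have e10 : 0 < e1 by rewrite divr_gt0.
have /nbhs_ballP[d /= d0 dP] : \forall x \near y, `|g y - g x| <= e1.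
  by move/cvgrPdist_le : cg; exact.
move/cvgrPdist_lt : etal => /(_ _ d0); apply: filterS => m.
rewrite sub0r normrN gtr0_norm // => md.
have Bm : bump (eta m) (rho (eta m)) by exact: mollifier_bump.
have I1 := rinteg_conv y Ig Bm.
have I2 : rinteg (fun x => g y * rho (eta m) (y - x)).
  by apply: rintegZ; have [ck k0] := bump_reflect y Bm; exact: rinteg_continuous_supp ck k0.
have -> : g y - conv g (rho (eta m)) y = rint (fun x => g y * rho (eta m) (y - x) - g x * rho (eta m) (y - x)).
  rewrite rintB // rintZ ?rint_mollifier ?mulr1 //.
  by have [ck k0] := bump_reflect y Bm; exact: rinteg_continuous_supp ck k0.
apply: (@le_trans _ _ (e1 * (K * 2 ^+ n))).
  apply: (@small_average _ y (eta m)) => //; first exact: rintegB.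
  move=> x; rewrite -mulrBl normrM.
  have := mollifier_cube y x (eta0 m) K0 (KP (eta0 m)).1.
  rewrite indicE; case: (boolP (x \in _)) => [|_]; last first.
    by rewrite !mulr0 normr_le0 => /eqP ->; rewrite normr0 mulr0.
  rewrite inE /cube /= !mulr1 => xy H; rewrite -mulrA ler_pM //.
  by apply: dP; rewrite -ball_normE /= (le_lt_trans xy).
rewrite /e1 -mulrA ler_piMr ?(ltW e0) // mulrC ler_pdivrMr // mul1r lerDl //.
Qed.

(** The normalisation uses the radius and not the side of the cube, whence the limit
    [2 ^+ n * g y]. *)
Lemma cvg_cube_sum (g : 'rV[R]_n -> R) (y : 'rV[R]_n) (eta : nat -> R) :
  rinteg g -> {for y, continuous g} -> (forall m, 0 < eta m) ->
  eta m @[m --> \oo] --> 0 ->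
  eta m ^- n * cube_sum g (eta m) y @[m --> \oo] --> 2 ^+ n * g y.
Proof.
move=> Ig cg eta0 etal; apply/cvgrPdist_le => e e0.
pose e1 := e / 2 ^+ n.
have e10 : 0 < e1 by rewrite divr_gt0 // exprn_gt0.
have /nbhs_ballP[d /= d0 dP] : \forall x \near y, `|g y - g x| <= e1.
  by move/cvgrPdist_le : cg; exact.
move/cvgrPdist_lt : etal => /(_ _ d0); apply: filterS => m.
rewrite sub0r normrN gtr0_norm // => md.
have em := ltW (eta0 m).
have en : eta m ^+ n != 0 by rewrite expf_neq0 // gt_eqF.
have I1 := rinteg_mul_cube y em Ig.
have I2 : rinteg (fun x => g y * \1_(cube y (eta m)) x) by apply: rintegZ; exact: rinteg_cube.
have -> : 2 ^+ n * g y - eta m ^- n * cube_sum g (eta m) y =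
    rint (fun x => eta m ^- n * (g y * \1_(cube y (eta m)) x - g x * \1_(cube y (eta m)) x)).
  rewrite rintZ ?rintB //; last exact: rintegB.
  rewrite rintZ ?rint_cube //; last exact: rinteg_cube.
  rewrite mulrBr exprMn; congr (_ - _); by field.
apply: (@le_trans _ _ (e1 * (1 * 2 ^+ n))); last first.
  by rewrite mul1r /e1 mulfVK // expf_neq0.
apply: (@small_average _ y (eta m)) => //; first by apply: rintegZ; exact: rintegB.
move=> x; rewrite -mulrBl mulr1 normrM mulrC [X in _ <= X](_ : _ = e1 * \1_(cube y (eta m)) x * eta m ^- n); last by ring.
rewrite [`|eta m ^- n|]ger0_norm ?invr_ge0 ?exprn_ge0 // ler_wpM2r ?invr_ge0 ?exprn_ge0 //.
rewrite normrM indicE; case: (boolP (x \in _)) => [|_]; last first.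
  by rewrite !mulr0 normr0 mulr0.
rewrite inE /cube /= !mulr1 normr1 mulr1 => xy.
by apply: dP; rewrite -ball_normE /= (le_lt_trans xy).
Qed.

(** Integration by parts moves the derivative onto [(x - y) 0 i], against a kernel of mass 1. These
    moments extract the diagonal derivatives of the drift from the commutator. *)
Lemma rint_first_moment (eta : R) (i j : 'I_n) (y : 'rV[R]_n) : 0 < eta ->
  rinteg (fun x => (x - y) 0 i * 'D_(delta_mx 0 j) (rho eta) (y - x)) /\
  rint (fun x => (x - y) 0 i * 'D_(delta_mx 0 j) (rho eta) (y - x)) = (i == j)%:R.
Proof.
move=> e0; have Be : bump eta (rho eta) by exact: mollifier_bump.
have Be' := bump_derive (delta_mx 0 j) Be.
have [ck k0] := bump_reflect y Be; have [ck' k0'] := bump_reflect y Be'.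
have ci : continuous (fun x : 'rV[R]_n => (x - y) 0 i).
  have -> : (fun x : 'rV[R]_n => (x - y) 0 i) = fun x => - (y - x) 0 i.
    by apply/funext => x; rewrite !mxE opprB.
  move=> x; apply: continuousN.
  apply: (@continuous_comp _ _ _ (fun x : 'rV[R]_n => y - x) (fun z : 'rV[R]_n => z 0 i)).
    exact: rsub_continuous.
  exact: coord_continuous.
have I1 : rinteg (fun x => (x - y) 0 i * 'D_(delta_mx 0 j) (rho eta) (y - x)).
  apply: (@rinteg_continuous_supp _ _ _ (eta + `|y|)).
    by move=> x; apply: (continuousM (ci x) (ck' x)).
  by move=> x xr; rewrite k0' // mulr0.
have I2 : rinteg (fun x => rho eta (y - x)) by exact: rinteg_continuous_supp ck k0.
split => //.
have H : rint (fun x => (i == j)%:R * rho eta (y - x) +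
    (x - y) 0 i * - 'D_(delta_mx 0 j) (rho eta) (y - x)) = 0.
  apply: (@rint_derive_supp _ _ j (fun x => (x - y) 0 i * rho eta (y - x)) _ (eta + `|y|)).
  - move=> x; apply: is_deriveM_fun; last exact: is_derive_reflect Be.1.
    have := is_deriveB_fun (coord_is_derive i x (delta_mx 0 j)) (is_derive_cst (y 0 i) x (delta_mx 0 j)).
    rewrite subr0 mxE eqxx /= => D; apply: is_derive_quotient D => h.
    by rewrite /cst !mxE.
  - have c1 : continuous (fun x : 'rV[R]_n => (i == j)%:R * rho eta (y - x)).
      move=> x; apply: (@continuousM _ _ (fun=> (i == j)%:R) _ x) (ck x).
      exact: cst_continuous.
    have c2 : continuous (fun x : 'rV[R]_n =>
        (x - y) 0 i * - 'D_(delta_mx 0 j) (rho eta) (y - x)).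
      by move=> x; exact: (continuousM (ci x) (continuousN (ck' x))).
    by move=> x; exact: (continuousD (c1 x) (c2 x)).
  - by move=> x xr; rewrite k0 // mulr0.
  - by move=> x xr; rewrite k0 // k0' // oppr0 !mulr0 addr0.
apply/esym/eqP; rewrite -subr_eq0 -H.
rewrite -[X in X - _](mulr1) -(rint_mollifier pen y e0) -rintZ // -rintB //; last exact: rintegZ.
by apply/eqP/eq_rint => x; rewrite mulrN.
Qed.

End approximation.

(** * Kato's inequality on the whole space *)

Section continuity_of_sums.
Context {R : realType} {T : topologicalType}.
Implicit Types f g : T -> R.

Lemma contM f g : continuous f -> continuous g -> continuous (fun x => f x * g x).
Proof. by move=> cf cg x; exact: (continuousM (cf x) (cg x)). Qed.

Lemma contD f g : continuous f -> continuous g -> continuous (fun x => f x + g x).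
Proof. by move=> cf cg x; exact: (continuousD (cf x) (cg x)). Qed.

Lemma contN f : continuous f -> continuous (fun x => - f x).
Proof. by move=> cf x; exact: (continuousN (cf x)). Qed.

Lemma contB f g : continuous f -> continuous g -> continuous (fun x => f x - g x).
Proof. by move=> cf cg; apply: contD => //; exact: contN. Qed.

Lemma contZ c f : continuous f -> continuous (fun x => c * f x).
Proof. by move=> cf; apply: contM => // x; exact: cst_continuous. Qed.

Lemma cont_comp (h : R -> R) f : continuous h -> continuous f -> continuous (fun x => h (f x)).
Proof. by move=> ch cf x; apply: (continuous_comp (cf x)); exact: ch. Qed.

Lemma cont_sum (I : Type) (r : seq I) (F : I -> T -> R) :
  (forall i, continuous (F i)) -> continuous (fun x => \sum_(i <- r) F i x).
Proof.
move=> cF; elim: r => [|i r IH].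
  by under eq_fun do rewrite big_nil; move=> x; exact: cst_continuous.
by under eq_fun do rewrite big_cons; exact: contD.
Qed.

Lemma cvg_sum_seq (I : Type) (r : seq I) (F : I -> nat -> R) (l : I -> R) :
  (forall i, F i m @[m --> \oo] --> l i) ->
  \sum_(i <- r) F i m @[m --> \oo] --> \sum_(i <- r) l i.
Proof.
move=> cF; elim: r => [|i r IH].
  by under eq_fun do rewrite big_nil; rewrite big_nil; exact: cvg_cst.
under eq_fun do rewrite big_cons; rewrite big_cons.
by apply: cvgD => //; exact: cF.
Qed.

End continuity_of_sums.

Lemma limn_einf_le (R : realType) (u a : nat -> \bar R) (l : \bar R) :
  (forall m, (u m <= a m)%E) -> a m @[m --> \oo] --> l -> (limn_einf u <= l)%E.
Proof.
move=> ua al; rewrite limn_einf_lim -(cvg_lim _ al) //.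
apply: lee_lim; [exact: is_cvg_einfs|exact: cvgP al|].
apply: nearW => m; apply: le_trans (ua m).
by apply: ereal_inf_lbound; exists m => /=.
Qed.

Lemma kato_rearrange (R : realType) (a s g f r : R) :
  a + s + f + r = 0 -> g + f = - (a + (s - g)) - r.
Proof. by lra. Qed.

(** [P] is the convexity term, dropped because it is nonnegative. The first hypothesis will come
    from [softpos1 <= 1], so the Dirac term loses its factor [h]. *)
Lemma kato_le (R : realType) (d psi h q r k P : R) :
  psi * (h * (k * r)) <= psi * (k * r) -> 0 <= P ->
  d - psi * (h * q) <= d + psi * (h * (- q - k * r)) + P + k * (psi * r).
Proof.
move=> H P0.
have -> : psi * (h * (- q - k * r)) = - (psi * (h * q)) - psi * (h * (k * r)) by ring.
have -> : k * (psi * r) = psi * (k * r) by ring.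
by lra.
Qed.

Section local_kato.
Context {R : realType} {n : nat} (n_gt0 : (0 < n)%N).
Variables (gamma : R -> R) (pen : penalty gamma).
Variables (s p : 'rV[R]_n -> R) (x0 : 'rV[R]_n).
Hypotheses (Is : rinteg s) (Ip : rinteg p).
Hypothesis cs : forall x, x <> x0 -> {for x, continuous s}.
Hypothesis cp : forall x, x <> x0 -> {for x, continuous p}.
Variables (b : 'I_n -> 'rV[R]_n -> R) (db : 'I_n -> 'I_n -> 'rV[R]_n -> R) (rr : R).
Hypothesis cb : forall j, continuous (b j).
Hypothesis cdb : forall i j, continuous (db i j).
Hypothesis bP : forall i j x, is_derive x (delta_mx 0 i) (b j) (db i j x).
Hypothesis b_supp : forall j x, rr < `|x| -> b j x = 0.
Hypothesis db_supp : forall i j x, rr < `|x| -> db i j x = 0.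
Variables (psi : 'rV[R]_n -> R) (psi1 psi2 : 'I_n -> 'rV[R]_n -> R).
Hypothesis psi_ge0 : forall x, 0 <= psi x.
Hypotheses (cpsi : continuous psi) (cpsi1 : forall i, continuous (psi1 i))
  (cpsi2 : forall i, continuous (psi2 i)).
Hypothesis psiP : forall i x, is_derive x (delta_mx 0 i) psi (psi1 i x).
Hypothesis psi1P : forall i x, is_derive x (delta_mx 0 i) (psi1 i) (psi2 i x).
Hypothesis psi_supp : forall x, rr < `|x| -> psi x = 0.
Hypothesis psi1_supp : forall i x, rr < `|x| -> psi1 i x = 0.
Hypothesis psi2_supp : forall i x, rr < `|x| -> psi2 i x = 0.
Variables (eps k delta : R).
Hypotheses (eps_ge0 : 0 <= eps) (k_ge0 : 0 <= k) (delta_gt0 : 0 < delta).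
Variable eta : nat -> R.
Hypotheses (eta_gt0 : forall m, 0 < eta m) (eta_cvg : eta m @[m --> \oo] --> 0).

Local Notation e i := (delta_mx 0 i : 'rV[R]_n).
Let rho m := @mollifier R n gamma (eta m).

(** The adjoint equation tested with [x |-> rho m (y - x)]. On a domain this is an admissible test
    function only for [y] well inside, hence the restriction to points where [psi] does not
    vanish. *)
Hypothesis mollified_eq : forall m y, psi y <> 0 ->
  conv p (rho m) y + \sum_j conv (fun x => s x * b j x) ('D_(e j) (rho m)) y
  + eps * (\sum_j conv s ('D_(e j) ('D_(e j) (rho m))) y) + k * rho m (y - x0) = 0.

Let B := softpos delta. Let B1 := softpos1 delta. Let B2 := softpos2 delta.
Let cB : continuous B. Proof. exact: softpos_continuous. Qed.
Let cB1 : continuous B1. Proof. exact: softpos1_continuous. Qed.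
Let cB2 : continuous B2. Proof. exact: softpos2_continuous. Qed.

Let Brho m : bump (eta m) (rho m). Proof. exact: mollifier_bump. Qed.
Let Brho1 m i : bump (eta m) ('D_(e i) (rho m)). Proof. exact: bump_derive. Qed.
Let Brho2 m i : bump (eta m) ('D_(e i) ('D_(e i) (rho m))). Proof. exact: bump_derive. Qed.

(** * The mollified equation, multiplied by [psi * B'] and integrated by parts *)

Let f m := conv s (rho m).
Let f1 m i := conv s ('D_(e i) (rho m)).
Let f2 m i := conv s ('D_(e i) ('D_(e i) (rho m))).

Let cf m : continuous (f m). Proof. exact: conv_continuous Is (Brho m). Qed.
Let cf1 m i : continuous (f1 m i). Proof. exact: conv_continuous Is (Brho1 m i). Qed.
Let cf2 m i : continuous (f2 m i). Proof. exact: conv_continuous Is (Brho2 m i). Qed.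
Let df m i x : is_derive x (e i) (f m) (f1 m i x).
Proof. exact: conv_is_derive Is (Brho m). Qed.
Let df1 m i x : is_derive x (e i) (f1 m i) (f2 m i x).
Proof. exact: conv_is_derive Is (Brho1 m i). Qed.

Let divp y := \sum_i (db i i y * psi y + b i y * psi1 i y).
Let lapp y := \sum_i psi2 i y.
Let divb y := \sum_i db i i y.

(** The sum is the commutator [div ((s b) * rho) - b . D (s * rho)], which tends to [s div b] off
    the pole. Isolating it leaves [b . D f], to which the chain rule for [B] applies. *)
Let Q m y := conv p (rho m) y +
  \sum_j (conv (fun x => s x * b j x) ('D_(e j) (rho m)) y - b j y * f1 m j y).

Let F y := B (s y) * (divp y - eps * lapp y) - psi y * (B1 (s y) * (p y + s y * divb y)).
Let Fm m y := B (f m y) * (divp y - eps * lapp y) - psi y * (B1 (f m y) * Q m y).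

Let cdivp : continuous divp.
Proof. by apply: cont_sum => i; apply: contD; apply: contM. Qed.

Let clapp : continuous lapp. Proof. exact: cont_sum. Qed.

Let cdivb : continuous divb. Proof. by apply: cont_sum => i; exact: cdb. Qed.

Let Isb j : rinteg (fun x => s x * b j x).
Proof.
have [M M0 bM] := continuous_bounded_supp (@cb j) (@b_supp j).
by apply: (rintegM_bounded Is _ bM); exact: rV_measurable_continuous.
Qed.

Let cQ m : continuous (Q m).
Proof.
apply: contD; first exact: conv_continuous Ip (Brho m).
apply: cont_sum => j; apply: contB; first exact: conv_continuous (Isb j) (Brho1 m j).
exact: contM.
Qed.

Let cFm m : continuous (Fm m).
Proof.
apply: contB; apply: contM => //; first exact: cont_comp.
  by apply: contB => //; exact: contZ.
by apply: contM => //; exact: cont_comp.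
Qed.

Let Fm_supp m x : rr < `|x| -> Fm m x = 0.
Proof.
move=> xr; rewrite /Fm psi_supp // mul0r subr0 /divp /lapp big1 ?big1 ?mulr0 ?subr0 ?mulr0 //.
  by move=> i _; rewrite psi2_supp.
by move=> i _; rewrite psi_supp // psi1_supp // !mulr0 addr0.
Qed.

Let IFm m : rinteg (Fm m).
Proof. exact: rinteg_continuous_supp (@cFm m) (@Fm_supp m). Qed.

(* The [i]-th derivatives of [b i * psi * B f] and of [psi1 i * B f - psi * (B f)_i]:
   both integrate to 0. *)
Let dG m i y := (db i i y * psi y + b i y * psi1 i y) * B (f m y)
  + (b i y * psi y) * (B1 (f m y) * f1 m i y).
Let dH m i y := (psi2 i y * B (f m y) + psi1 i y * (B1 (f m y) * f1 m i y))
  - (psi1 i y * (B1 (f m y) * f1 m i y)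
     + psi y * ((B2 (f m y) * f1 m i y) * f1 m i y + B1 (f m y) * f2 m i y)).

Let cBf m : continuous (fun y => B (f m y)). Proof. exact: cont_comp. Qed.
Let cB1f m : continuous (fun y => B1 (f m y)). Proof. exact: cont_comp. Qed.
Let cB2f m : continuous (fun y => B2 (f m y)). Proof. exact: cont_comp. Qed.

Let cdG m i : continuous (dG m i).
Proof.
have c1 := contD (contM (@cdb i i) cpsi) (contM (@cb i) (@cpsi1 i)).
have c2 := contM (contM (@cb i) cpsi) (contM (@cB1f m) (@cf1 m i)).
exact: contD (contM c1 (@cBf m)) c2.
Qed.

Let cdH m i : continuous (dH m i).
Proof.
have c1 := contM (@cpsi1 i) (contM (@cB1f m) (@cf1 m i)).
have c2 := contM (contM (@cB2f m) (@cf1 m i)) (@cf1 m i).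
have c3 := contM (@cB1f m) (@cf2 m i).
exact: contB (contD (contM (@cpsi2 i) (@cBf m)) c1)
  (contD c1 (contM cpsi (contD c2 c3))).
Qed.

Let rint_dG m i : rinteg (dG m i) /\ rint (dG m i) = 0.
Proof.
have z y : rr < `|y| -> dG m i y = 0.
  by move=> yr; rewrite /dG psi_supp // psi1_supp // !(mulr0, mul0r, addr0).
split; first exact: rinteg_continuous_supp (@cdG m i) z.
apply: (@rint_derive_supp _ _ i (fun y => (b i y * psi y) * B (f m y)) _ rr) => //.
- move=> y; apply: is_deriveM_fun; first by apply: is_deriveM_fun.
  exact: is_derive_comp1 (df m i y) (is_derive_softpos _ _).
- by move=> y yr; rewrite psi_supp // mulr0 mul0r.
Qed.

Let rint_dH m i : rinteg (dH m i) /\ rint (dH m i) = 0.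
Proof.
have z y : rr < `|y| -> dH m i y = 0.
  by move=> yr; rewrite /dH psi_supp // psi1_supp // psi2_supp // !mul0r !addr0 subr0.
split; first exact: rinteg_continuous_supp (@cdH m i) z.
apply: (@rint_derive_supp _ _ i
  (fun y => psi1 i y * B (f m y) - psi y * (B1 (f m y) * f1 m i y)) _ rr) => //.
- move=> y; apply: is_deriveB_fun.
    apply: is_deriveM_fun => //.
    exact: is_derive_comp1 (df m i y) (is_derive_softpos _ _).
  apply: is_deriveM_fun => //; apply: is_deriveM_fun => //.
  exact: is_derive_comp1 (df m i y) (is_derive_softpos1 _ _).
- by move=> y yr; rewrite psi_supp // psi1_supp // !mul0r subr0.
Qed.

(* Convexity of [B] enters here: the term [B2 (f m y) * |grad f|^2] is dropped. *)
Let Fm_le m y : Fm m y <=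
  \sum_i (dG m i y - eps * dH m i y) + k * (psi y * rho m (x0 - y)).
Proof.
(* The terms with [psi1 * B' * f1] cancel inside [dH]. What is left besides the first term of [Fm]
   is [psi * B'] times the differential operator in the mollified equation, and the convexity
   term. *)
have -> : \sum_i (dG m i y - eps * dH m i y) =
    B (f m y) * (divp y - eps * lapp y)
    + psi y * (B1 (f m y) * (\sum_i b i y * f1 m i y + eps * \sum_i f2 m i y))
    + eps * (psi y * (B2 (f m y) * \sum_i (f1 m i y) ^+ 2)).
  rewrite /divp /lapp !mulr_sumr -sumrB mulr_sumr -big_split /= !mulr_sumr.
  rewrite -!big_split /=; apply: eq_bigr => i _; rewrite /dG /dH; ring.
have P0 : 0 <= eps * (psi y * (B2 (f m y) * \sum_i (f1 m i y) ^+ 2)).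
  apply: mulr_ge0 => //; apply: mulr_ge0; first exact: psi_ge0.
  apply: mulr_ge0; first exact: softpos2_ge0.
  by apply: sumr_ge0 => i _; exact: sqr_ge0.
have rho0 : 0 <= rho m (x0 - y) by exact: mollifier_ge0.
(* The equation carries the mollified Dirac mass at [y - x0]; evenness turns its pairing with [psi]
   into a convolution evaluated at [x0]. *)
have -> : rho m (x0 - y) = rho m (y - x0) by rewrite -opprB /rho mollifierN.
rewrite -/(rho m) in rho0.
have rho0' : 0 <= rho m (y - x0) by exact: mollifier_ge0.
have [z|/eqP z] := eqVneq (psi y) 0.
  by rewrite /Fm z !mul0r subr0 !mulr0 !addr0 lexx.
have E := mollified_eq m z.
have -> : \sum_i b i y * f1 m i y + eps * \sum_i f2 m i y = - Q m y - k * rho m (y - x0).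
  by rewrite /Q sumrB; apply: kato_rearrange; exact: E.
apply: kato_le => //; apply: ler_wpM2l => //.
by apply: ler_piMl; [exact: mulr_ge0|exact: softpos1_le1].
Qed.

Let rint_Fm_le m : rint (Fm m) <= k * conv psi (rho m) x0.
Proof.
have Ipsi : rinteg psi by exact: rinteg_continuous_supp cpsi psi_supp.
have IC := rinteg_conv x0 Ipsi (Brho m).
have IS i : rinteg (fun y => dG m i y - eps * dH m i y).
  by apply: rintegB; [exact: (rint_dG m i).1|apply: rintegZ; exact: (rint_dH m i).1].
have IR := rintegD (rinteg_sum (index_enum 'I_n) IS) (rintegZ k IC).
apply: le_trans (le_rint (IFm m) IR (Fm_le m)) _.
rewrite rintD; [|exact: rinteg_sum|exact: rintegZ].
rewrite rint_sum // rintZ // big1 ?add0r // => i _.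
rewrite rintB; [|exact: (rint_dG m i).1|apply: rintegZ; exact: (rint_dH m i).1].
by rewrite rintZ ?(rint_dG m i).2 ?(rint_dH m i).2 ?mulr0 ?subr0 //; exact: (rint_dH m i).1.
Qed.

(** * Domination by averages over small cubes, and pointwise limits off the pole *)

Let g x := `|s x| + `|p x|.

Let g_ge0 x : 0 <= g x. Proof. by rewrite addr_ge0. Qed.
Let Ig : rinteg g. Proof. by apply: rintegD; exact: rinteg_norm. Qed.

Let average m y := eta m ^- n * cube_sum g (eta m) y.

Let b_lipschitz : exists2 L : R, 0 <= L & forall j x h, `|b j (x + h) - b j x| <= L * `|h|.
Proof.
have /choice[M MP] : forall ij : 'I_n * 'I_n, exists M : R,
    0 <= M /\ forall x, `|db ij.1 ij.2 x| <= M.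
  move=> [i j]; have [M M0 H] := continuous_bounded_supp (@cdb i j) (@db_supp i j).
  by exists M.
pose M1 := \sum_ij M ij.
have M10 : 0 <= M1 by apply: sumr_ge0 => ij _; exact: (MP ij).1.
exists (M1 * n%:R); first by rewrite mulr_ge0.
move=> j; apply: (@partials_lipschitz _ _ _ (fun i => db i j)) => // i x.
apply: le_trans ((MP (i, j)).2 x) _.
by rewrite /M1 (bigD1 (i, j)) //= lerDl; apply: sumr_ge0 => ij _; exact: (MP ij).1.
Qed.

Let dominated (h : 'rV[R]_n -> R) m y (A : R) : 0 <= A -> rinteg h ->
  (forall x, `|h x| <= g x * (A * eta m ^- n * \1_(cube y (eta m)) x)) ->
  `|rint h| <= A * average m y.
Proof.
move=> A0 Ih H.
have Ic := rinteg_mul_cube y (ltW (eta_gt0 m)) Ig.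
have -> : A * average m y =
    rint (fun x => A * eta m ^- n * (g x * \1_(cube y (eta m)) x)).
  by rewrite rintZ // mulrA.
apply: norm_rint_le => //; first exact: (rintegZ _ Ic).
by move=> x; rewrite [leRHS]mulrCA; exact: H.
Qed.

(** As a single integral the commutator exhibits [b j x - b j y], at most [L * eta m] on the support
    of the kernel, which offsets the extra [eta^-1] of the differentiated kernel. *)
Let remainderE m j y :
  rinteg (fun x => s x * (b j x - b j y) * 'D_(e j) (rho m) (y - x)) /\
  conv (fun x => s x * b j x) ('D_(e j) (rho m)) y - b j y * f1 m j y =
  rint (fun x => s x * (b j x - b j y) * 'D_(e j) (rho m) (y - x)).
Proof.
have I1 := rinteg_conv y (Isb j) (Brho1 m j).
have I2 := rintegZ (b j y) (rinteg_conv y Is (Brho1 m j)).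
have E x : s x * (b j x - b j y) * 'D_(e j) (rho m) (y - x) =
    s x * b j x * 'D_(e j) (rho m) (y - x) - b j y * (s x * 'D_(e j) (rho m) (y - x)).
  by move: ('D_(e j) (rho m) (y - x)) => d; ring.
split; first by under eq_fun do rewrite E; exact: rintegB.
by under [in RHS]eq_rint do rewrite E; rewrite rintB // rintZ //; exact: (rinteg_conv y Is (Brho1 m j)).
Qed.

(* The integral of [average m] does not depend on [m], so this bound, although not
   uniform in [m], is enough to apply Fatou to [Fm m + C * average m]. *)
Let Fm_dominated : exists2 C : R, 0 <= C & forall m y, `|Fm m y| <= C * average m y.
Proof.
have [K K0 KP] := @mollifier_bound R n gamma pen.
have [L L0 LP] := b_lipschitz.
have [P P0 psiP'] := continuous_bounded_supp cpsi psi_supp.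
have cD : continuous (fun y => divp y - eps * lapp y).
  by apply: contB => //; exact: contZ.
have [D D0 DP] : exists2 D : R, 0 <= D & forall y, `|divp y - eps * lapp y| <= D.
  apply: (continuous_bounded_supp cD (r := rr)) => y yr.
  rewrite /divp /lapp !big1 ?mulr0 ?subr0 // => i _; first by rewrite psi2_supp.
  by rewrite psi_supp // psi1_supp // !mulr0 addr0.
(* [K * D] bounds the term with [B (f m y)], as [|B r| <= |r|]; in the other term [P] bounds [psi],
   [K] the mollified [p] and [L * K] each of the [n] commutators. *)
pose C := K * D + P * (K + n%:R * (L * K)).
exists C; first by rewrite /C !(addr_ge0, mulr_ge0).
move=> m y.
have G0 : 0 <= average m y.
  rewrite /average mulr_ge0 ?invr_ge0 ?exprn_ge0 ?(ltW (eta_gt0 m)) //.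
  by apply: rint_ge0 => x; rewrite mulr_ge0.
have ker x : `|rho m (y - x)| <= K * eta m ^- n * \1_(cube y (eta m)) x.
  exact: (mollifier_cube pen y x (eta_gt0 m) K0 (KP _ (eta_gt0 m)).1).
have ker1 j x : `|'D_(e j) (rho m) (y - x)| <= K * eta m ^- n / eta m * \1_(cube y (eta m)) x.
  exact: (mollifier_derive_cube pen y x (eta_gt0 m) K0 ((KP _ (eta_gt0 m)).2 j)).
have H1 : `|f m y| <= K * average m y.
  apply: dominated => //; first exact: rinteg_conv Is (Brho m).
  by move=> x; rewrite normrM ler_pM // /g lerDl.
have H2 : `|conv p (rho m) y| <= K * average m y.
  apply: dominated => //; first exact: rinteg_conv Ip (Brho m).
  by move=> x; rewrite normrM ler_pM // /g lerDr.
have H3 j : `|conv (fun x => s x * b j x) ('D_(e j) (rho m)) y - b j y * f1 m j y|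
    <= L * K * average m y.
  have [Ir ->] := remainderE m j y.
  apply: dominated => //; first by rewrite mulr_ge0.
  move=> x; rewrite -mulrA normrM ler_pM //; first by rewrite /g lerDl.
  rewrite normrM; have := ker1 j x.
  rewrite indicE; case: (boolP (x \in _)) => [|_]; last first.
    by rewrite !mulr0 normr_le0 => /eqP ->; rewrite normr0 mulr0.
  rewrite inE /cube /= !mulr1 => xy H.
  have e0 := eta_gt0 m.
  apply: (@le_trans _ _ ((L * eta m) * (K * eta m ^- n / eta m))).
    apply: ler_pM => //.
    apply: (@le_trans _ _ (L * `|x - y|)).
      by have := LP j y (x - y); rewrite (addrC y) subrK.
    by rewrite ler_wpM2l // distrC.
  rewrite le_eqVlt; apply/orP; left; apply/eqP.
  have : eta m != 0 by rewrite gt_eqF.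
  move: (eta m) (eta m ^- n) => z w z0; by field.
have H4 : `|Q m y| <= (K + n%:R * (L * K)) * average m y.
  rewrite /Q mulrDl; apply: le_trans (ler_normD _ _) _; apply: lerD => //.
  apply: le_trans (ler_norm_sum _ _ _) _.
  apply: (le_trans (ler_sum _ (fun j _ => H3 j))).
  by rewrite sumr_const card_ord -[leRHS]mulrA mulr_natl.
rewrite /Fm (le_trans (ler_normB _ _)) // /C mulrDl lerD //.
  rewrite normrM mulrAC ler_pM // (le_trans (softpos_norm_le _ _)) //.
rewrite normrM -mulrA ler_pM // normrM ger0_norm ?softpos1_ge0 //.
apply: le_trans H4; rewrite ler_piMl //.
exact: softpos1_le1.
Qed.

(** Near [y], [s x * (b j x - b j y)] is [s y] times the linear part of [b j], whose first moments
    give [db j j y], plus two errors: the product of the increments of [s] and [b j], and the Taylor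
    remainder of [b j]. Both are small compared with [eta m], which beats the [eta^-1] of the
    kernel. *)
Let cvg_remainder j y : y <> x0 ->
  conv (fun x => s x * b j x) ('D_(e j) (rho m)) y - b j y * f1 m j y @[m --> \oo]
  --> s y * db j j y.
Proof.
move=> yx0.
have [K K0 KP] := @mollifier_bound R n gamma pen.
have [L L0 LP] := b_lipschitz.
apply/cvgrPdist_le => er er0.
pose C := (L + `|s y|) * (K * 2 ^+ n) + 1.
have C0 : 0 < C by rewrite ltr_wpDl // !(mulr_ge0, addr_ge0) // exprn_ge0.
pose e1 := er / C.
have e10 : 0 < e1 by rewrite divr_gt0.
have cs1 : \forall x \near y, `|s y - s x| <= e1.
  by have /cvgrPdist_le := cs yx0; exact.
have tb : \forall h \near (0 : 'rV[R]_n),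
    `|b j (y + h) - b j y - \sum_i h 0 i * db i j y| <= e1 * `|h|.
  apply: (@rV_taylor _ _ (b j) y (fun i => db i j)) => //.
    by apply: filterE => z i; exact: bP.
  by move=> i; exact: cdb.
have [d1 /= d10 d1P] := (nbhs_ballP _ _).1 cs1.
have [d2 /= d20 d2P] := (nbhs_ballP _ _).1 tb.
move/cvgrPdist_lt : eta_cvg => /(_ (Num.min d1 d2)).
rewrite lt_min d10 d20 => /(_ isT); apply: filterS => m.
have e0 := eta_gt0 m.
rewrite sub0r normrN gtr0_norm // lt_min => /andP[md1 md2].
have [Ir ->] := remainderE m j y.
pose c i := s y * db i j y.
have Im i := (rint_first_moment pen i j y e0).1.
have Em i := (rint_first_moment pen i j y e0).2.
have -> : s y * db j j y =
    rint (fun x => \sum_i c i * ((x - y) 0 i * 'D_(e j) (rho m) (y - x))).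
  rewrite rint_sum; last by move=> i; apply: rintegZ; exact: Im.
  rewrite (bigD1 j) //= big1 ?addr0.
    by rewrite rintZ ?Em ?eqxx ?mulr1 //; exact: Im.
  by move=> i ij; rewrite rintZ ?Em ?(negbTE ij) ?mulr0 //; exact: Im.
have Is1 : rinteg (fun x => \sum_i c i * ((x - y) 0 i * 'D_(e j) (rho m) (y - x))).
  by apply: rinteg_sum => i; apply: rintegZ; exact: Im.
rewrite distrC -rintB //.
apply: (@le_trans _ _ (e1 * (L + `|s y|) * (K * 2 ^+ n))); last first.
  rewrite -mulrA /e1 -mulrA ler_piMr ?(ltW er0) // mulrC ler_pdivrMr // mul1r.
  by rewrite /C lerDl.
apply: (@small_average _ _ _ y (eta m)) => //; first exact: rintegB.
move=> x; under eq_bigr do rewrite mulrA.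
rewrite -mulr_suml -mulrBl normrM.
have := mollifier_derive_cube pen y x e0 K0 ((KP _ e0).2 j).
rewrite -/(rho m) indicE; case: (boolP (x \in _)) => [|_]; last first.
  by rewrite !mulr0 normr_le0 => /eqP ->; rewrite normr0 mulr0.
rewrite inE /cube /= !mulr1 => xy H.
have xy' : `|x - y| <= eta m by rewrite distrC.
have Bk : `|s x * (b j x - b j y) - \sum_i c i * (x - y) 0 i|
    <= e1 * (L + `|s y|) * eta m.
  have -> : s x * (b j x - b j y) - \sum_i c i * (x - y) 0 i =
      (s x - s y) * (b j x - b j y)
      + s y * (b j x - b j y - \sum_i (x - y) 0 i * db i j y).
    have -> : \sum_i c i * (x - y) 0 i = s y * \sum_i (x - y) 0 i * db i j y.
      by rewrite mulr_sumr; apply: eq_bigr => i _; rewrite /c mulrA mulrAC -mulrA.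
    by move: (\sum_i _) => S; ring.
  rewrite [leRHS](_ : _ = e1 * (L * eta m) + `|s y| * (e1 * eta m)); last first.
    by move: (`|s y|) (eta m) => v z; ring.
  apply: le_trans (ler_normD _ _) _; apply: lerD; rewrite normrM.
    apply: ler_pM => //.
      by rewrite distrC; apply: d1P; rewrite -ball_normE /= (le_lt_trans xy).
    apply: (@le_trans _ _ (L * `|x - y|)); last by rewrite ler_wpM2l.
    by have := LP j y (x - y); rewrite (addrC y) subrK.
  apply: ler_wpM2l => //.
  have := d2P (x - y); rewrite -ball_normE /= sub0r normrN (addrC y) subrK.
  move=> /(_ (le_lt_trans xy' md2)) /le_trans; apply.
  by rewrite ler_wpM2l // ltW.
apply: (le_trans (ler_pM _ _ Bk H)) => //.
rewrite le_eqVlt; apply/orP; left; apply/eqP.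
have : eta m != 0 by rewrite gt_eqF.
move: (eta m) (eta m ^- n) (L + _) => z w v z0; by field.
Qed.

Let cvg_Fm y : y <> x0 -> Fm m y @[m --> \oo] --> F y.
Proof.
move=> yx0.
have [K K0 KP] := @mollifier_bound R n gamma pen.
have cvs : f m y @[m --> \oo] --> s y.
  exact: (cvg_conv_mollifier pen K0 KP Is (cs yx0) eta_gt0 eta_cvg).
have cvp : conv p (rho m) y @[m --> \oo] --> p y.
  exact: (cvg_conv_mollifier pen K0 KP Ip (cp yx0) eta_gt0 eta_cvg).
have cvQ : Q m y @[m --> \oo] --> p y + s y * divb y.
  rewrite /divb mulr_sumr; apply: cvgD => //.
  by apply: cvg_sum_seq => j; exact: cvg_remainder.
have cvB : B (f m y) @[m --> \oo] --> B (s y).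
  by apply: (cvg_comp _ _ cvs); exact: cB.
have cvB1 : B1 (f m y) @[m --> \oo] --> B1 (s y).
  by apply: (cvg_comp _ _ cvs); exact: cB1.
apply: cvgB; first by apply: cvgM => //; exact: cvg_cst.
by apply: cvgM; [exact: cvg_cst|exact: cvgM].
Qed.

Let cdp : continuous (fun y => divp y - eps * lapp y).
Proof. by apply: contB => //; exact: contZ. Qed.

Let IF : rinteg F.
Proof.
have ms := rinteg_measurable Is; have mp := rinteg_measurable Ip.
have [P P0 psiP'] := continuous_bounded_supp cpsi psi_supp.
have [D D0 DP] : exists2 D : R, 0 <= D & forall y, `|divp y - eps * lapp y| <= D.
  apply: (continuous_bounded_supp cdp (r := rr)) => y yr.
  rewrite /divp /lapp !big1 ?mulr0 ?subr0 // => i _; first by rewrite psi2_supp.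
  by rewrite psi_supp // psi1_supp // !mulr0 addr0.
have [M M0 MP] : exists2 M : R, 0 <= M & forall y, `|divb y| <= M.
  apply: (continuous_bounded_supp (@cdivb) (r := rr)) => y yr.
  by rewrite /divb big1 // => i _; rewrite db_supp.
pose C := D + P * (1 + M).
have C0 : 0 <= C by rewrite /C !(addr_ge0, mulr_ge0).
apply: (@rinteg_le _ _ _ (fun y => C * g y)).
- apply: rV_measurableB; apply: rV_measurableM.
  + exact: rV_measurable_comp.
  + exact: rV_measurable_continuous.
  + exact: rV_measurable_continuous.
  + apply: rV_measurableM; first exact: rV_measurable_comp.
    by apply: rV_measurableD => //; apply: rV_measurableM => //; exact: rV_measurable_continuous.
- exact: rintegZ.
- move=> y; rewrite [leRHS]ger0_norm ?mulr_ge0 //.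
  rewrite /F /C mulrDl; apply: le_trans (ler_normB _ _) _; apply: lerD; rewrite normrM.
    rewrite mulrC; apply: ler_pM => //; apply: le_trans (softpos_norm_le _ _) _ => //.
    by rewrite /g lerDl.
  rewrite -mulrA; apply: ler_pM => //.
  rewrite normrM ger0_norm ?softpos1_ge0 //.
  apply: (@le_trans _ _ `|p y + s y * divb y|); first by rewrite ler_piMl //; exact: softpos1_le1.
  apply: le_trans (ler_normD _ _) _; rewrite mulrDl mul1r; apply: lerD; first by rewrite /g lerDr.
  by rewrite normrM mulrC; apply: ler_pM => //; rewrite /g lerDl.
Qed.

Lemma local_kato (h := fun y =>
    B (s y) * (\sum_i (db i i y * psi y + b i y * psi1 i y) - eps * \sum_i psi2 i y)
    - psi y * (B1 (s y) * (p y + s y * \sum_i db i i y))) :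
  rinteg h /\ rint h <= k * psi x0.
Proof.
split; first exact: IF.
have [K K0 KP] := @mollifier_bound R n gamma pen.
rewrite /h -/(rint F).
have [C C0 CP] := Fm_dominated.
have Ipsi : rinteg psi by exact: rinteg_continuous_supp cpsi psi_supp.
have em m := ltW (eta_gt0 m).
(* The pointwise limit of [C * average m], with the same integral as each of these functions. Hence
   it cancels from both sides of Fatou's inequality. *)
pose G y := C * (2 ^+ n * g y).
have IG : rinteg G by apply: rintegZ; apply: rintegZ.
have Icube m : rinteg (cube_sum g (eta m)) by exact: rinteg_cube_sum.
have Iav m : rinteg (fun y => C * average m y) by apply: rintegZ; apply: rintegZ.
pose H m y := C * average m y + Fm m y.
have IH m : rinteg (H m) by exact: rintegD.
have H0 m y : 0 <= H m y.
  have := CP m y; rewrite ler_norml => /andP[+ _].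
  by rewrite /H; move: (average m y) => z; lra.
(* Fatou is applied off the pole, where the pointwise limits are known; by [rint_point] no integral
   changes. *)
pose D := ~` (@row_of_tuple R n @^-1` [set x0]).
have mD : measurable D.
  apply: measurableC.
  rewrite (_ : [set x0] = cube x0 0); first exact: measurable_cube.
  apply/seteqP; split => x /=; first by move=> ->; rewrite /cube /= subrr normr0.
  by rewrite /cube /= normr_le0 subr_eq0 => /eqP.
have := @fatou _ _ R (lebesgue_tuple R n) D mD
  (fun m t => (H m (row_of_tuple t))%:E) _ _.
have -> : (\int[lebesgue_tuple R n]_(x in D)
    limn_einf (fun m => (H m (row_of_tuple x))%:E) =
    (rint (fun y => G y + F y))%:E)%E.
  rewrite -(rint_point x0 n_gt0 (rintegD IG IF)) //.
  apply: eq_integral => t; rewrite inE => tx0.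
  have cH : (H m (row_of_tuple t))%:E @[m --> \oo] -->
      (G (row_of_tuple t) + F (row_of_tuple t))%:E.
    apply: cvg_EFin; first exact: nearW.
    have tx : row_of_tuple t <> x0 by [].
    apply: cvgD; last exact: cvg_Fm.
    apply: cvgM; first exact: cvg_cst.
    apply: cvg_cube_sum => //.
    apply: (@continuousD _ _ _ (fun x => `|s x|) (fun x => `|p x|)).
      by apply: (continuous_comp (cs tx)); exact: norm_continuous.
    by apply: (continuous_comp (cp tx)); exact: norm_continuous.
  by rewrite is_cvg_limn_einfE; [exact: cvg_lim cH|exact: cvgP cH].
have rG : rint G = C * (2 ^+ n * rint g) by rewrite /G rintZ ?rintZ //; exact: rintegZ.
have rav m : rint (fun y => C * average m y) = C * (2 ^+ n * rint g).
  rewrite rintZ; last exact: rintegZ.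
  rewrite /average rintZ // rint_cube_sum //; congr (_ * _).
  rewrite exprMn; have : eta m ^+ n != 0 by rewrite expf_neq0 // gt_eqF.
  by move: (eta m ^+ n) (rint g) => z w z0; field.
have cl : (rint G + k * conv psi (rho m) x0)%:E @[m --> \oo] --> (rint G + k * psi x0)%:E.
  apply: cvg_EFin; first exact: nearW.
  apply: cvgD; first exact: cvg_cst.
  apply: cvgM; first exact: cvg_cst.
  exact: (cvg_conv_mollifier pen K0 KP Ipsi (cpsi (x := x0)) eta_gt0 eta_cvg).
move=> FH.
have : ((rint (fun y => G y + F y))%:E <= (rint G + k * psi x0)%:E)%E.
  apply: le_trans (FH _ _) _.
  - move=> m; apply: measurable_funTS; apply/measurable_EFinP.
    exact: rinteg_measurable (IH m).
  - by move=> m t _; rewrite lee_fin.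
  apply: limn_einf_le cl => m.
  rewrite (rint_point x0 n_gt0 (IH m)) lee_fin /H rintD // rav rG lerD2l.
  exact: rint_Fm_le.
by rewrite lee_fin rintD // lerD2l.
Qed.

End local_kato.

(** * Kato's inequality on a domain *)

Section patching.
Context {R : realType} {V : normedModType R}.
Variables (U K : set V).
Hypotheses (oU : open U) (cK : closed K) (KU : K `<=` U).

Lemma patch_in (h : V -> R) x : U x -> (h \_ U) x = h x.
Proof. by move=> Ux; rewrite patchE mem_set. Qed.

Lemma patch_out (h : V -> R) x : ~ U x -> (h \_ U) x = 0.
Proof. by move=> nU; rewrite patchE memNset. Qed.

Let near_patch (h : V -> R) x : U x -> \forall y \near x, h y = (h \_ U) y.
Proof.
move=> Ux; have : nbhs x U by exact: open_nbhs_nbhs.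
by apply: filterS => y Uy; rewrite patch_in.
Qed.

Let near_patch0 (h : V -> R) x : (forall y, U y -> ~ K y -> h y = 0) -> ~ U x ->
  \forall y \near x, 0 = (h \_ U) y.
Proof.
move=> h0 nU; have : nbhs x (~` K).
  by apply: open_nbhs_nbhs; split; [exact: closed_openC|move/KU].
apply: filterS => y nK; case: (pselect (U y)) => Uy.
  by rewrite patch_in // h0.
by rewrite patch_out.
Qed.

Lemma near_eq_continuous (f g : V -> R) x :
  (\forall y \near x, f y = g y) -> {for x, continuous f} -> {for x, continuous g}.
Proof.
move=> fg cf; rewrite /prop_for /continuous_at -(nbhs_singleton fg).
by apply: cvg_trans cf; apply: near_eq_cvg; apply: filterS fg => y ->.
Qed.

(** A point outside [U] has a neighbourhood missing the closed set [K], and there the extension is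
    identically 0. The same argument gives [patch_derive]. *)
Lemma patch_continuous (h : V -> R) x : (forall y, U y -> ~ K y -> h y = 0) ->
  (U x -> {for x, continuous h}) -> {for x, continuous (h \_ U)}.
Proof.
move=> h0 ch; case: (pselect (U x)) => Ux.
  exact: near_eq_continuous (near_patch h Ux) (ch Ux).
apply: near_eq_continuous (near_patch0 h0 Ux) _; exact: cst_continuous.
Qed.

Lemma patch_derive (h h' : V -> R) x v : (forall y, U y -> ~ K y -> h y = 0) ->
  (U x -> is_derive x v h (h' x)) -> is_derive x v (h \_ U) ((h' \_ U) x).
Proof.
move=> h0 dh; case: (pselect (U x)) => Ux.
  by rewrite patch_in //; apply: near_eq_is_derive (near_patch h Ux) (dh Ux).
rewrite patch_out //.
exact: near_eq_is_derive (near_patch0 h0 Ux) (is_derive_cst _ _ _).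
Qed.

Lemma derive_out (h : V -> R) x v : (forall y, ~ K y -> h y = 0) -> ~ K x -> 'D_v h x = 0.
Proof.
move=> h0 nK; rewrite -[RHS](derive_cst (0 : R) x v); apply: near_eq_derive.
have : nbhs x (~` K) by apply: open_nbhs_nbhs; split => //; exact: closed_openC.
by apply: filterS => y /h0 ->.
Qed.

End patching.

Section cutoff.
Context {R : realType} {n : nat}.

Lemma conv_smooth g r (k : 'rV[R]_n -> R) : rinteg g -> bump r k ->
  smooth_on setT (conv g k).
Proof.
move=> Ig + j; elim: j k => [|j IH] k Bk.
  by split => // x _; exact: (conv_continuous Ig Bk).
refine (@Ck_onI _ _ j (conv g k) (fun v => conv g ('D_v k)) _ _ _).
- exact: conv_continuous Ig Bk.
- by move=> v x; exact: conv_is_derive Ig Bk.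
- by move=> v; apply: IH; exact: bump_derive.
Qed.

Lemma compact_thickening (K U : set 'rV[R]_n) : compact K -> open U -> K `<=` U ->
  exists2 e : R, 0 < e & forall x y, K x -> `|x - y| <= e -> U y.
Proof.
move=> /compact_near_coveringP cK oU KU.
have H : \forall e \near (0 : R)^'+, K `<=` (fun x => forall y, `|x - y| <= e -> U y).
  apply: cK => x Kx.
  have /nbhs_ballP[r /= r0 rU] : nbhs x U by apply: open_nbhs_nbhs; split => //; exact: KU.
  exists (ball x (r / 2), [set e : R | e < r / 2]).
    split => /=; first by apply: nbhsx_ballx; rewrite divr_gt0.
    by apply: nbhs_right_lt; rewrite divr_gt0.
  move=> [z e] /= [xz er] y zy; apply: rU; rewrite -ball_normE /=.
  move: xz; rewrite -ball_normE /= => xz.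
  have := ler_distD z x y; lra.
near (0 : R)^'+ => e.
exists e; first by near: e; exact: nbhs_right_gt.
have : K `<=` (fun x => forall y, `|x - y| <= e -> U y) by near: e.
by move=> KH x y Kx; exact: KH.
Unshelve. all: by end_near. Qed.

Lemma cutoff (gamma : R -> R) (K U : set 'rV[R]_n) : penalty gamma ->
  compact K -> open U -> K `<=` U ->
  exists (zeta : 'rV[R]_n -> R) (e : R) (K' : set 'rV[R]_n),
  [/\ smooth_on setT zeta, 0 < e & compact K' /\ K' `<=` U] /\
  [/\ forall x, 0 <= zeta x <= 1,
      forall x y, K x -> `|x - y| <= e -> zeta y = 1 &
      forall x, ~ K' x -> zeta x = 0].
Proof.
move=> pen cK oU KU.
have [d d0 dU] := compact_thickening cK oU KU.
(* The indicator of the [3 * e]-neighbourhood, mollified at scale [e], is 1 within [e] of [K] and 0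
   beyond [4 * e]. Taking the closure costs at most another [e], and [5 * e < d]. *)
pose e := d / 8.
have e0 : 0 < e by rewrite divr_gt0.
pose A := \bigcup_(x in K) (ball x (3 * e) : set 'rV[R]_n).
have oA : open A by apply: bigcup_open => x _; exact: ball_open.
have [M [_ KM]] := compact_bounded cK.
pose r := `|M| + 1 + d.
have r0 : 0 <= r by rewrite /r !addr_ge0 // ltW.
have Kr x : K x -> `|x| <= `|M| + 1.
  by apply: KM; rewrite (le_lt_trans (ler_norm _)) // ltrDl.
have Ar x y : A x -> `|x - y| <= e -> exists2 z, K z & `|z - y| <= 4 * e.
  move=> [z Kz]; rewrite -ball_normE /= => zx xy; exists z => //.
  by have := ler_distD x z y; lra.
have IA : rinteg (\1_A : 'rV[R]_n -> R).
  apply: (@rinteg_bounded_supp _ _ _ r 1) => //.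
  - by apply: rV_measurable_indic.
  - by move=> x; rewrite indicE; case: (_ \in _); rewrite ?normr1 ?normr0.
  - move=> x rx; rewrite indicE memNset // => Ax.
    have [z Kz zx] : exists2 z, K z & `|z - x| <= 4 * e.
      by apply: Ar Ax _; rewrite subrr normr0 ltW.
    have := Kr _ Kz; have := ler_normD (x - z) z.
    by rewrite subrK (distrC x); move: rx zx; rewrite /r /e; lra.
pose rho := @mollifier R n gamma e.
have Brho : bump e rho by exact: mollifier_bump.
have rho0 z : 0 <= rho z by exact: mollifier_ge0.
have IC y := rinteg_conv y IA Brho.
have Irho y : rinteg (fun x => rho (y - x)).
  by have [ck k0] := bump_reflect y Brho; exact: rinteg_continuous_supp ck k0.
pose S := [set y | exists2 z, K z & `|z - y| <= 4 * e].
have clS y : closure S y -> exists2 z, K z & `|z - y| <= d.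
  move=> /(_ (ball y e)) []; first by apply: nbhsx_ballx.
  move=> w [[z Kz zw]]; rewrite -ball_normE /= => yw; exists z => //.
  have := ler_distD w z y; rewrite (distrC w); move: zw yw; rewrite /e; lra.
exists (conv \1_A rho), e, (closure S).
split; first split => //.
- exact: conv_smooth IA Brho.
- split; last by move=> y /clS[z Kz zy]; exact: (dU z).
  apply: bounded_closed_compact; last exact: closed_closure.
  exists r; split; first exact: num_real.
  move=> r' rr' y /clS[z Kz zy]; apply: le_trans (ltW rr').
  have := Kr _ Kz; have := ler_normD (y - z) z.
  by rewrite subrK (distrC y); move: zy; rewrite /r; lra.
split.
- move=> y; rewrite -(rint_mollifier pen y e0) /conv; apply/andP; split.
    by apply: rint_ge0 => x; rewrite mulr_ge0.
  apply: le_rint => // x; apply: ler_piMl; first exact: rho0.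
  by rewrite indicE; case: (_ \in _).
- move=> x y Kx xy; rewrite -(rint_mollifier pen y e0) /conv; apply: eq_rint => z.
  case: (ltP e `|y - z|) => yz.
    by have [_ k0] := Brho; rewrite -/rho k0 // mulr0.
  rewrite indicE mem_set ?mul1r //; exists x => //; rewrite -ball_normE /=.
  by have := ler_distD y x z; lra.
- move=> y nK; rewrite /conv -[RHS](@rint0 R n); apply: eq_rint => z.
  case: (ltP e `|y - z|) => yz; first by have [_ k0] := Brho; rewrite k0 // mulr0.
  rewrite indicE memNset ?mul0r // => Az; apply: nK; apply: subset_closure.
  by apply: Ar Az _; rewrite distrC.
Qed.

End cutoff.

Section patch_integrable.
Context {R : realType} {n : nat}.
Variables (U : set 'rV[R]_n).
Hypothesis oU : open U.

Lemma rV_measurable_patch (h : 'rV[R]_n -> R) :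
  (forall x, U x -> {for x, continuous h}) -> rV_measurable (h \_ U).
Proof.
move=> ch; rewrite /rV_measurable -patch_row.
apply/(measurable_restrictT _ _).1; first exact: measurable_row_open.
exact: measurable_row_continuous.
Qed.

Lemma rinteg_patchM_bounded (f g : 'rV[R]_n -> R) (M : R) :
  (forall x, U x -> {for x, continuous f}) -> (forall x, U x -> `|f x| <= M) ->
  dx_integrable U g -> rinteg ((fun x => f x * g x) \_ U).
Proof.
move=> cf fM /(dx_integrable_patch _ oU) Ig.
have := rintegM_bounded (M := `|M|) Ig (rV_measurable_patch cf) _.
have -> : (fun x => (g \_ U) x * (f \_ U) x) = (fun x => f x * g x) \_ U.
  apply/funext => x; case: (pselect (U x)) => Ux; first by rewrite !patch_in // mulrC.
  by rewrite !patch_out // mulr0.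
apply=> x; case: (pselect (U x)) => Ux; last by rewrite patch_out // normr0.
by rewrite patch_in // (le_trans (fM x Ux)) // ler_norm.
Qed.

End patch_integrable.

Section kato_domain.
Context {R : realType} {n : nat} (n_gt0 : (0 < n)%N).
Variables (gamma : R -> R) (pen : penalty gamma).
Variables (U : set 'rV[R]_n) (rU : R) (x0 : 'rV[R]_n).
Hypotheses (oU : open U) (bU : forall x, U x -> `|x| <= rU) (Ux0 : U x0).
Variables (s t : 'rV[R]_n -> R).
Hypotheses (Is : dx_integrable U s) (It : dx_integrable U t).
Hypothesis cs : forall x, U x -> x <> x0 -> {for x, continuous s}.
Hypothesis ct : forall x, U x -> x <> x0 -> {for x, continuous t}.
Hypothesis cls : {within closure U `\ x0, continuous s}.
Hypothesis s_bdry : forall x, bdry U x -> s x = 0.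
Variables (a c : 'rV[R]_n -> R) (bv : 'rV[R]_n -> 'rV[R]_n)
  (db : 'I_n -> 'I_n -> 'rV[R]_n -> R) (Mb : R).
Hypothesis ca : forall x, U x -> {for x, continuous a}.
Hypothesis cc : forall x, U x -> {for x, continuous c}.
Hypothesis cb : forall j x, U x -> {for x, continuous (fun y => bv y 0 j)}.
Hypothesis cdb : forall i j x, U x -> {for x, continuous (db i j)}.
Hypothesis dbP : forall i j x, U x ->
  is_derive x (delta_mx 0 i) (fun y => bv y 0 j) (db i j x).
Hypothesis Mb_ge0 : 0 <= Mb.
Hypothesis divb_le : forall x, U x -> `|\sum_i db i i x| <= Mb.
Variables (phi : 'rV[R]_n -> R) (phi1 phi2 : 'I_n -> 'rV[R]_n -> R) (Mphi : R).
Hypothesis phi_ge0 : forall x, U x -> 0 <= phi x <= Mphi.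
Hypothesis cphi : forall x, U x -> {for x, continuous phi}.
Hypothesis cphi1 : forall i x, U x -> {for x, continuous (phi1 i)}.
Hypothesis cphi2 : forall i x, U x -> {for x, continuous (phi2 i)}.
Hypothesis phiP : forall i x, U x -> is_derive x (delta_mx 0 i) phi (phi1 i x).
Hypothesis phi1P : forall i x, U x -> is_derive x (delta_mx 0 i) (phi1 i) (phi2 i x).
Variables (eps k delta : R).
Hypotheses (eps_ge0 : 0 <= eps) (k_ge0 : 0 <= k) (delta_gt0 : 0 < delta).
Hypothesis eqs : adjoint_equation U eps a bv c k x0 s t.

Local Notation e i := (delta_mx 0 i : 'rV[R]_n).

(* Compact because [s] vanishes on the boundary; off [Kd] the integrand [W] is 0, so
   that cutting off outside a neighbourhood of [Kd] does not change it. *)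
Let Kd : set 'rV[R]_n := [set x | x = x0 \/ (U x /\ delta <= s x)].

Let KdU : Kd `<=` U. Proof. by move=> x [->|[]]. Qed.

(** Since the pole belongs to [Kd], closedness concerns [s] only on [closure U] minus [x0], where it
    is continuous; at a boundary point [s = 0 < delta] keeps nearby points out. *)
Let compact_Kd : compact Kd.
Proof.
apply: bounded_closed_compact.
  exists rU; split; first exact: num_real.
  by move=> r rr x /KdU/bU /le_trans; apply; exact: ltW.
rewrite -[Kd]setCK; apply: open_closedC; rewrite openE => x nK.
have xx0 : x <> x0 by move=> E; apply: nK; left.
have near_x0 : \forall y \near x, y <> x0.
  have : nbhs x (~` [set x0]).
    apply: open_nbhs_nbhs; split => //; apply: closed_openC.
    by apply: accessible_closed_set1; apply: hausdorff_accessible; exact: norm_hausdorff.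
  by apply: filterS.
case: (pselect (closure U x)) => clUx; last first.
  have : nbhs x (~` closure U).
    by apply: open_nbhs_nbhs; split => //; apply: closed_openC; exact: closed_closure.
  apply: filterS2 near_x0 => y yx0 nUy [//|[Uy _]].
  by apply: nUy; exact: subset_closure.
have sx : s x < delta.
  case: (pselect (U x)) => Ux; last by rewrite s_bdry.
  by rewrite ltNge; apply/negP => H; apply: nK; right.
have H : \forall y \near within (closure U `\ x0) (nbhs x), s y < delta.
  have /subspace_continuousP/(_ x) := cls; move=> /(_ (conj clUx xx0)) csx.
  have N : nbhs (s x) [set r | r < delta] by exact: lt_nbhsl.
  exact: (csx _ N).
have H' : \forall y \near x, (closure U `\ x0) y -> s y < delta by exact: H.
apply: filterS2 near_x0 H' => y yx0 Hy [//|[Uy]].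
by rewrite leNgt Hy //; split => //; exact: subset_closure.
Qed.

Let closedT (K : set 'rV[R]_n) : compact K -> closed K.
Proof. by apply: compact_closed; exact: norm_hausdorff. Qed.

Let patch_supp (h : 'rV[R]_n -> R) x : rU < `|x| -> (h \_ U) x = 0.
Proof.
by move=> xr; rewrite patch_out // => /bU; rewrite leNgt xr.
Qed.

Let rinteg_patchM (K : set 'rV[R]_n) (g h : 'rV[R]_n -> R) :
  compact K -> K `<=` U -> dx_integrable U g ->
  (forall x, U x -> {for x, continuous h}) -> (forall x, U x -> ~ K x -> h x = 0) ->
  rinteg ((fun x => h x * g x) \_ U).
Proof.
move=> cK KU /dx_integrable_patch Ig ch h0.
have chU : continuous (h \_ U).
  by move=> x; apply: (patch_continuous oU (closedT cK) KU h0); exact: ch.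
have [M M0 hM] := continuous_bounded_supp chU (@patch_supp h).
have := rintegM_bounded (Ig oU) (rV_measurable_continuous chU) hM.
congr (dx_integrable setT _); apply/funext => x.
case: (pselect (U x)) => Ux; first by rewrite !patch_in // mulrC.
by rewrite !patch_out // mulr0.
Qed.

(** The integrand freed of [div b]. In [local_kato] the drift enters as
    [B(s) div (b psi) - psi B'(s) s div b]; where [psi = phi], this differs from what is kept here
    by [phi * (B(s) - B'(s) s) * div b], of order [delta]. *)
Let W x := softpos delta (s x) * (\sum_i bv x 0 i * phi1 i x - eps * \sum_i phi2 i x)
  - phi x * (softpos1 delta (s x) * (c x * t x - a x * s x)).

Let cont_measurable (h : 'rV[R]_n -> R) : (forall x, U x -> {for x, continuous h}) ->
  rV_measurable (h \_ U).
Proof. exact: rV_measurable_patch. Qed.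

Let measurable_W : rV_measurable (W \_ U).
Proof.
have ms := rinteg_measurable ((dx_integrable_patch s oU).1 Is).
have mt := rinteg_measurable ((dx_integrable_patch t oU).1 It).
have E : W \_ U = fun x =>
    softpos delta ((s \_ U) x) * (\sum_i ((fun x => bv x 0 i * phi1 i x) \_ U) x
      - eps * \sum_i (phi2 i \_ U) x)
    - (phi \_ U) x * (softpos1 delta ((s \_ U) x) *
       ((c \_ U) x * (t \_ U) x - (a \_ U) x * (s \_ U) x)).
  apply/funext => x; case: (pselect (U x)) => Ux.
    rewrite !patch_in // /W; congr (_ * (_ - eps * _) - _); apply: eq_bigr => i _;
    by rewrite patch_in.
  by rewrite !patch_out // softpos_eq0 ?mul0r ?subr0 // ltW.
have msum (F : 'I_n -> 'rV[R]_n -> R) : (forall i, rV_measurable (F i)) ->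
    rV_measurable (fun x => \sum_i F i x).
  by move=> mF; exact: measurable_sum.
rewrite E; apply: rV_measurableB; apply: rV_measurableM.
- by apply: rV_measurable_comp => //; exact: softpos_continuous.
- apply: rV_measurableB.
    by apply: msum => i; apply: cont_measurable => x Ux; exact: (continuousM (cb Ux) (cphi1 Ux)).
  apply: rV_measurableM; first exact: measurable_cst.
  by apply: msum => i; apply: cont_measurable => x Ux; exact: cphi2.
- exact: cont_measurable.
- apply: rV_measurableM.
    by apply: rV_measurable_comp => //; exact: softpos1_continuous.
  by apply: rV_measurableB; apply: rV_measurableM => //; exact: cont_measurable.
Qed.

Let patchZ_cont (K : set 'rV[R]_n) (z h : 'rV[R]_n -> R) :
  compact K -> K `<=` U -> smooth_on setT z -> (forall x, ~ K x -> z x = 0) ->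
  (forall x, U x -> {for x, continuous h}) -> continuous ((fun x => z x * h x) \_ U).
Proof.
move=> cK KU Sz z0 ch x; apply: (patch_continuous oU (closedT cK) KU).
  by move=> y _ nK; rewrite z0 // mul0r.
by move=> Ux; exact: (continuousM (smooth_continuous Sz (x := x)) (ch x Ux)).
Qed.

Let patchZ_derive (K : set 'rV[R]_n) (z h h' : 'rV[R]_n -> R) i :
  compact K -> K `<=` U -> smooth_on setT z -> (forall x, ~ K x -> z x = 0) ->
  (forall x, U x -> is_derive x (e i) h (h' x)) ->
  forall x, is_derive x (e i) ((fun x => z x * h x) \_ U)
    (((fun x => 'D_(e i) z x * h x + z x * h' x) \_ U) x).
Proof.
move=> cK KU Sz z0 dh x; apply: (patch_derive oU (closedT cK) KU).
  by move=> y _ nK; rewrite z0 // mul0r.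
by move=> Ux; apply: is_deriveM_fun; [exact: smooth_is_derive|exact: dh].
Qed.

Let patchD (f g : 'rV[R]_n -> R) x : ((fun x => f x + g x) \_ U) x = (f \_ U) x + (g \_ U) x.
Proof.
by case: (pselect (U x)) => Ux; [rewrite !patch_in|rewrite !patch_out // addr0].
Qed.

(** Two nested cutoffs carry the problem to the whole space. [zeta] is 1 near [Kd] and makes
    [zeta * phi] a compactly supported weight; [zeta2] is 1 near [K1], off which [zeta] vanishes,
    and extends [s], [p] and the drift by zero. The margin between them leaves room for
    mollifying. *)
Lemma kato_domain : dx_integrable U W /\
  dx_integral U W <= k * phi x0 + 3 * delta * (Mb * Mphi) * (2 * `|rU|) ^+ n.
Proof.
have [zeta [e1 [K1 [[Sz e10 [cK1 K1U]] [z01 z1 z0]]]]] := cutoff pen compact_Kd oU KdU.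
have [zeta2 [e2 [K2 [[Sz2 e20 [cK2 K2U]] [z201 z21 z20]]]]] := cutoff pen cK1 oU K1U.
have Mphi0 : 0 <= Mphi by have /andP[p0 pM] := phi_ge0 Ux0; exact: le_trans pM.
have clK1 := closedT cK1; have clK2 := closedT cK2.
have dz0 i x : ~ K1 x -> 'D_(e i) zeta x = 0.
  by move=> nK; exact: (derive_out clK1 (e i) z0 nK).
have dz20 i x : ~ K2 x -> 'D_(e i) zeta2 x = 0.
  by move=> nK; exact: (derive_out clK2 (e i) z20 nK).
have ddz0 i x : ~ K1 x -> 'D_(e i) ('D_(e i) zeta) x = 0.
  by move=> nK; exact: (derive_out clK1 (e i) (dz0 i) nK).
pose sg := (fun x => zeta2 x * s x) \_ U.
pose p x := c x * t x - a x * s x.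
pose pg := (fun x => zeta2 x * p x) \_ U.
pose bg j := (fun x => zeta2 x * bv x 0 j) \_ U.
pose dbg i j := (fun x => 'D_(e i) zeta2 x * bv x 0 j + zeta2 x * db i j x) \_ U.
pose psi := (fun x => zeta x * phi x) \_ U.
pose psi1 i := (fun x => 'D_(e i) zeta x * phi x + zeta x * phi1 i x) \_ U.
pose psi2 i := (fun x => ('D_(e i) ('D_(e i) zeta) x * phi x + 'D_(e i) zeta x * phi1 i x)
   + ('D_(e i) zeta x * phi1 i x + zeta x * phi2 i x)) \_ U.
have Sdz i : smooth_on setT ('D_(e i) zeta) by exact: smooth_derive.
have Sddz i : smooth_on setT ('D_(e i) ('D_(e i) zeta)) by exact: smooth_derive.
have Sdz2 i : smooth_on setT ('D_(e i) zeta2) by exact: smooth_derive.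
have Isg : rinteg sg.
  by apply: (rinteg_patchM cK2 K2U Is) => x Ux; [exact: (smooth_continuous Sz2)|exact: z20].
have zc h : (forall x, U x -> {for x, continuous h}) ->
    forall x, U x -> {for x, continuous (fun y => zeta2 y * h y)}.
  by move=> ch x Ux; exact: (continuousM (smooth_continuous Sz2 (x := x)) (ch x Ux)).
have Ipg : rinteg pg.
  have I1 := rinteg_patchM cK2 K2U It (zc _ cc) (fun y _ nK => etrans (congr1 (fun z => z * c y) (z20 y nK)) (mul0r _)).
  have I2 := rinteg_patchM cK2 K2U Is (zc _ ca) (fun y _ nK => etrans (congr1 (fun z => z * a y) (z20 y nK)) (mul0r _)).
  have := rintegB I1 I2; congr (dx_integrable setT _); apply/funext => x; rewrite /pg /p.
  case: (pselect (U x)) => Ux; first by rewrite !patch_in //; ring.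
  by rewrite !patch_out // subr0.
have csg x : x <> x0 -> {for x, continuous sg}.
  move=> xx0; apply: (patch_continuous oU clK2 K2U).
    by move=> y _ nK; rewrite z20 // mul0r.
  by move=> Ux; exact: (continuousM (smooth_continuous Sz2 (x := x)) (cs Ux xx0)).
have cpg x : x <> x0 -> {for x, continuous pg}.
  move=> xx0; apply: (patch_continuous oU clK2 K2U).
    by move=> y _ nK; rewrite z20 // mul0r.
  move=> Ux; apply: (continuousM (smooth_continuous Sz2 (x := x))).
  exact: (continuousB (continuousM (cc Ux) (ct Ux xx0)) (continuousM (ca Ux) (cs Ux xx0))).
have cbg j : continuous (bg j) by apply: (patchZ_cont cK2 K2U) => // x; exact: cb.
have cdbg i j : continuous (dbg i j).
  rewrite (_ : dbg i j = fun x => ((fun x => 'D_(e i) zeta2 x * bv x 0 j) \_ U) x +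
     ((fun x => zeta2 x * db i j x) \_ U) x); last by apply/funext => x; rewrite -patchD.
  apply: contD; apply: (patchZ_cont cK2 K2U) => //; first by move=> x; exact: dz20.
    by move=> x; exact: cb.
  by move=> x; exact: cdb.
have bgP i j x : is_derive x (e i) (bg j) (dbg i j x).
  by apply: (patchZ_derive cK2 K2U) => // y Uy; exact: dbP.
have psi_ge0' x : 0 <= psi x.
  rewrite /psi; case: (pselect (U x)) => Ux; last by rewrite patch_out.
  rewrite patch_in // mulr_ge0 //; first by have /andP[] := z01 x.
  by have /andP[] := phi_ge0 Ux.
have cpsi : continuous psi by exact: (patchZ_cont cK1 K1U).
have cpsi1 i : continuous (psi1 i).
  rewrite (_ : psi1 i = fun x => ((fun x => 'D_(e i) zeta x * phi x) \_ U) x +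
     ((fun x => zeta x * phi1 i x) \_ U) x); last by apply/funext => x; rewrite -patchD.
  apply: contD; apply: (patchZ_cont cK1 K1U) => //; first by move=> x; exact: dz0.
  by move=> x; exact: cphi1.
have cpsi2 i : continuous (psi2 i).
  rewrite (_ : psi2 i = fun x =>
    (((fun x => 'D_(e i) ('D_(e i) zeta) x * phi x) \_ U) x +
     ((fun x => 'D_(e i) zeta x * phi1 i x) \_ U) x) +
    (((fun x => 'D_(e i) zeta x * phi1 i x) \_ U) x +
     ((fun x => zeta x * phi2 i x) \_ U) x)); last by apply/funext => x; rewrite -!patchD.
  have c1 : continuous ((fun x => 'D_(e i) zeta x * phi1 i x) \_ U).
    by apply: (patchZ_cont cK1 K1U) => //; [move=> x; exact: dz0|move=> x; exact: cphi1].
  apply: contD; apply: contD => //; apply: (patchZ_cont cK1 K1U) => //.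
    by move=> x; exact: ddz0.
  by move=> x; exact: cphi2.
have psiP i x : is_derive x (e i) psi (psi1 i x).
  by apply: (patchZ_derive cK1 K1U) => // y Uy; exact: phiP.
have psi1P i x : is_derive x (e i) (psi1 i) (psi2 i x).
  apply: (patch_derive oU clK1 K1U).
    by move=> y _ nK; rewrite z0 // dz0 // !mul0r addr0.
  move=> Ux; apply: is_deriveD_fun; apply: is_deriveM_fun.
  - exact: smooth_is_derive.
  - exact: phiP.
  - exact: smooth_is_derive.
  - exact: phi1P.
(* At most [e2], the distance from [K1] up to which [zeta2] is 1. *)
pose eta m : R := e2 / m.+1%:R.
have eta_gt0 m : 0 < eta m by rewrite divr_gt0.
have eta_le m : eta m <= e2.
  by rewrite ler_pdivrMr // ler_peMr ?(ltW e20) // ler1n.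
have eta_cvg : eta m @[m --> \oo] --> 0.
  by rewrite -[X in _ --> X](mulr0 e2); apply: cvgM; [exact: cvg_cst|exact: cvg_harmonic].
have Isb j : rinteg (fun x => sg x * bg j x).
  have [M M0 bM] := continuous_bounded_supp (cbg j) (@patch_supp _).
  exact: (rintegM_bounded Isg (rV_measurable_continuous (cbg j)) bM).
have meq m y : psi y <> 0 ->
    conv pg (@mollifier R n gamma (eta m)) y
    + \sum_j conv (fun x => sg x * bg j x) ('D_(e j) (@mollifier R n gamma (eta m))) y
    + eps * (\sum_j conv sg ('D_(e j) ('D_(e j) (@mollifier R n gamma (eta m)))) y)
    + k * @mollifier R n gamma (eta m) (y - x0) = 0.
  move=> py.
  have Uy : U y by apply: contrapT => nU; apply: py; rewrite /psi patch_out.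
  have K1y : K1 y.
    by apply: contrapT => nK; apply: py; rewrite /psi patch_in // z0 // mul0r.
  set rho := @mollifier R n gamma (eta m).
  have Brho : bump (eta m) rho by exact: mollifier_bump.
  have Brho1 j : bump (eta m) ('D_(e j) rho) by exact: bump_derive.
  have Brho2 j : bump (eta m) ('D_(e j) ('D_(e j) rho)) by exact: bump_derive.
  (* For [y] in [K1] the factor [zeta2] is invisible to kernels centred at [y]; the equation
     satisfied by the truncated data is the original one. *)
  have zk r : bump (eta m) r -> forall x, zeta2 x * r (y - x) = r (y - x).
    move=> [_ r0] x; case: (ltP (eta m) `|y - x|) => yx; first by rewrite r0 // mulr0.
    by rewrite (z21 y x) ?mul1r // (le_trans yx).
  pose tf x := rho (y - x).
  have dtf j x : 'D_(e j) tf x = - 'D_(e j) rho (y - x).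
    by have [_ ->] := is_derive_reflect y x (e j) Brho.1.
  have ddtf j x : 'D_(e j) ('D_(e j) tf) x = 'D_(e j) ('D_(e j) rho) (y - x).
    have -> : 'D_(e j) tf = fun x => -1 * 'D_(e j) rho (y - x).
      by apply/funext => z; rewrite mulN1r; exact: dtf.
    have [_ ->] := is_deriveZ_fun (-1) (is_derive_reflect y x (e j) (Brho1 j).1).
    by rewrite mulN1r opprK.
  have Ttf : test_function U tf.
    split.
      have -> : tf = fun x => rho (y + -1 *: x) by apply/funext => x; rewrite scaleN1r.
      exact: smooth_affine Brho.1.
    by exists K2; split => // x nK; rewrite /tf -(zk _ Brho) z20 // mul0r.
  have := eqs Ttf; rewrite !(dx_integral_patch U).
  have -> : rint ((fun x => a x * s x * tf x + s x * dot (bv x) (grad tf x)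
      - c x * t x * tf x) \_ U) =
    - (conv pg rho y + \sum_j conv (fun x => sg x * bg j x) ('D_(e j) rho) y).
    rewrite /conv -rint_sum => [|j]; last exact: rinteg_conv (Isb j) (Brho1 j).
    rewrite -rintD; last 2 first.
    - exact: rinteg_conv Ipg Brho.
    - by apply: rinteg_sum => j; exact: rinteg_conv (Isb j) (Brho1 j).
    rewrite -mulN1r -rintZ; last first.
      apply: rintegD; first exact: rinteg_conv Ipg Brho.
      by apply: rinteg_sum => j; exact: rinteg_conv (Isb j) (Brho1 j).
    apply: eq_rint => x; rewrite mulN1r; case: (pselect (U x)) => Ux; last first.
      rewrite patch_out // /pg /sg patch_out // mul0r add0r big1 ?oppr0 // => j _.
      by rewrite patch_out // !mul0r.
    rewrite patch_in // /pg /sg /bg patch_in //.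
    have -> : zeta2 x * p x * rho (y - x) = p x * tf x.
      by rewrite mulrAC (zk _ Brho) mulrC.
    have -> : \sum_j ((fun x => zeta2 x * s x) \_ U) x *
        ((fun x => zeta2 x * bv x 0 j) \_ U) x * 'D_(e j) rho (y - x) =
        - (s x * dot (bv x) (grad tf x)).
      rewrite /dot mulr_sumr -sumrN; apply: eq_bigr => j _.
      rewrite !patch_in // /grad mxE dtf.
      have -> : zeta2 x * s x * (zeta2 x * bv x 0 j) * 'D_(e j) rho (y - x) =
         s x * bv x 0 j * (zeta2 x * (zeta2 x * 'D_(e j) rho (y - x))).
        by move: ('D_(e j) rho (y - x)) => d; ring.
      by rewrite !(zk _ (Brho1 j)) mulrN mulrN opprK mulrA.
    by rewrite /p; ring.
  have -> : rint ((fun x => eps * (s x * laplacian tf x)) \_ U) =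
      eps * \sum_j conv sg ('D_(e j) ('D_(e j) rho)) y.
    rewrite /conv -rint_sum => [|j]; last exact: rinteg_conv Isg (Brho2 j).
    rewrite -rintZ; last by apply: rinteg_sum => j; exact: rinteg_conv Isg (Brho2 j).
    apply: eq_rint => x; case: (pselect (U x)) => Ux; last first.
      rewrite patch_out // /sg big1 ?mulr0 // => j _.
      by rewrite patch_out // mul0r.
    rewrite patch_in // /sg patch_in //; congr (eps * _).
    rewrite /laplacian mulr_sumr; apply: eq_bigr => j _.
    by rewrite ddtf mulrAC (zk _ (Brho2 j)) mulrC.
  change (tf x0) with (rho (y - x0)).
  move: (rho (y - x0)) => A4.
  have lin (A1 A2 A3 : R) : - (A1 + A2) = eps * A3 + k * A4 ->
      A1 + A2 + eps * A3 + k * A4 = 0.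
    by move=> H; rewrite -addrA -H subrr.
  exact: lin.
have Hk := local_kato n_gt0 pen Isg Ipg csg cpg cbg cdbg bgP
  (fun j => @patch_supp _) (fun i j => @patch_supp _) psi_ge0' cpsi cpsi1 cpsi2
  psiP psi1P (@patch_supp _) (fun i => @patch_supp _) (fun i => @patch_supp _)
  eps_ge0 k_ge0 delta_gt0 eta_gt0 eta_cvg meq.
move: Hk; set F := (fun y => _) => -[IF HF].
have psix0 : psi x0 = phi x0.
  rewrite /psi patch_in // (z1 x0 x0) ?mul1r //; first by left.
  by rewrite subrr normr0 ltW.
have flat (z : 'rV[R]_n -> R) e0 x v : 0 < e0 ->
    (forall y, `|x - y| <= e0 -> z y = 1) ->
    forall y, `|x - y| < e0 -> 'D_v z y = 0.
  move=> e00 zz y xy; rewrite -[RHS](derive_cst (1 : R) y v); apply: near_eq_derive.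
  have : nbhs y (ball x e0) by apply: open_nbhs_nbhs; split; [exact: ball_open|rewrite -ball_normE].
  by apply: filterS => w; rewrite -ball_normE /= => /ltW/zz ->.
have CM : 0 <= 3 * delta * (Mb * Mphi).
  by apply: mulr_ge0; apply: mulr_ge0 => //; exact: ltW.
(* Where [s x <= delta] both integrands vanish, since [zeta2 x * s x <= delta] as well. Elsewhere in
   [U], [x] lies in [Kd], around which both cutoffs are identically 1, and only
   [phi * div b * (B'(s) s - B(s))] remains. *)
have D0 x : `|(W \_ U) x - F x| <= 3 * delta * (Mb * Mphi) * \1_(cube (0 : 'rV[R]_n) `|rU|) x.
  case: (pselect (U x)) => Ux; last first.
    rewrite patch_out // /F /sg /psi !patch_out // softpos_eq0 ?(ltW delta_gt0) // !mul0r subrr subrr normr0.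
    by apply: mulr_ge0 => //; rewrite indicE ler0n.
  have -> : \1_(cube (0 : 'rV[R]_n) `|rU|) x = 1 :> R.
    rewrite indicE mem_set // /cube /= ?subr0 ?sub0r ?normrN.
    by apply: le_trans (bU Ux) _; exact: ler_norm.
  rewrite mulr1.
  case: (lerP (s x) delta) => sx.
    have sgx : sg x <= delta.
      rewrite /sg patch_in //; have /andP[l0 l1] := z201 x.
      case: (lerP (s x) 0) => s0.
        by apply: le_trans (ltW delta_gt0); rewrite mulr_ge0_le0.
      by apply: le_trans sx; rewrite ler_piMl // ltW.
    rewrite patch_in // /W /F !softpos_eq0 // !softpos1_eq0 // !mul0r !mulr0 !subrr normr0.
    by rewrite !mulr_ge0 // ltW.
  have Kx : Kd x by right; split => //; exact: ltW.
  have zx : zeta x = 1 by apply: (z1 x x) => //; rewrite subrr normr0 ltW.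
  have K1x : K1 x by apply: contrapT => /z0; rewrite zx => /eqP; rewrite oner_eq0.
  have z2x : zeta2 x = 1 by apply: (z21 x x) => //; rewrite subrr normr0 ltW.
  have xx (e0 : R) : 0 < e0 -> `|x - x| < e0 by rewrite subrr normr0.
  have dzx i : 'D_(e i) zeta x = 0.
    by apply: (flat zeta e1 x) => //; [move=> y; exact: z1|exact: xx].
  have ddzx i : 'D_(e i) ('D_(e i) zeta) x = 0.
    rewrite -[RHS](derive_cst (0 : R) x (e i)); apply: near_eq_derive.
    have : nbhs x (ball x e1) by apply: nbhsx_ballx.
    apply: filterS => y; rewrite -ball_normE /= => xy.
    by rewrite (flat zeta e1 x) // => w; exact: z1.
  have dz2x i : 'D_(e i) zeta2 x = 0.
    by apply: (flat zeta2 e2 x) => //; [move=> y; exact: z21|exact: xx].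
  rewrite patch_in // /W /F /sg /pg /p /psi !patch_in // z2x zx !mul1r.
  have -> : \sum_i (dbg i i x * phi x + bg i x * psi1 i x) =
      (\sum_i db i i x) * phi x + \sum_i bv x 0 i * phi1 i x.
    rewrite mulr_suml -big_split; apply: eq_bigr => i _ /=.
    by rewrite /dbg /bg /psi1 !patch_in // dz2x dzx z2x zx !mul1r !mul0r !add0r.
  have -> : \sum_i dbg i i x = \sum_i db i i x.
    by apply: eq_bigr => i _; rewrite /dbg patch_in // dz2x z2x mul1r mul0r add0r.
  have -> : \sum_i psi2 i x = \sum_i phi2 i x.
    by apply: eq_bigr => i _; rewrite /psi2 patch_in // dzx ddzx zx !mul1r !mul0r !add0r.
  have H1 := divb_le Ux; have /andP[p0 p1] := phi_ge0 Ux.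
  have S1 := softpos1M_ge delta_gt0 (s x).
  have S2 := softpos1M_le delta_gt0 (s x).
  move: (\sum_i db i i x) (\sum_i bv x 0 i * _) (\sum_i phi2 i x) H1 => D X Y H1.
  move: S1 S2; move: (softpos delta (s x)) (softpos1 delta (s x)) => B B1 S1 S2.
  have -> : B * (X - eps * Y) - phi x * (B1 * (c x * t x - a x * s x)) -
     (B * (D * phi x + X - eps * Y) - phi x * (B1 * (c x * t x - a x * s x + s x * D))) =
     D * phi x * (B1 * s x - B) by ring.
  have S : `|B1 * s x - B| <= 3 * delta by rewrite ger0_norm; lra.
  rewrite normrM [leLHS]mulrC; apply: ler_pM => //.
  by rewrite normrM (ger0_norm p0); exact: ler_pM.
(* Integrability of [W] is inherited from [F], the difference being bounded with bounded support. *)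
have ID : rinteg (fun x => (W \_ U) x - F x).
  apply: (@rinteg_le _ _ _ (fun x => 3 * delta * (Mb * Mphi) * \1_(cube (0 : 'rV[R]_n) `|rU|) x)).
  - apply: rV_measurableB; first exact: measurable_W.
    exact: rinteg_measurable IF.
  - by apply: rintegZ; exact: rinteg_cube.
  - by move=> x; apply: le_trans (D0 x) (ler_norm _).
have IW : rinteg (W \_ U).
  have := rintegD ID IF; congr (dx_integrable setT _); apply/funext => x; ring.
split; first by apply/(dx_integrable_patch W oU).
rewrite (dx_integral_patch U).
have := norm_rint_cube (normr_ge0 rU) ID D0; rewrite rintB // ler_norml; rewrite psix0 in HF.
by move=> /andP[_]; move: HF; move: (rint _) (rint _) (_ ^+ n) => r1 r2 z; lra.
Qed.

End kato_domain.

(** * The adjoint system *)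

(** Each supersolution inequality is multiplied by [B_j >= 0]; then [B_j] is traded for [S_j] or for
    [D * S_j] at a cost of [3 * delta]. Twice, once per component, this costs [alpha * Mg] on the
    left and [Mphi * Mg] in the coupling, whence the factor 6. *)
Lemma softpos_balance {R : realFieldType} (alpha delta Mg Mphi S1 S2 B1 B2 D1 D2 g1 g2 p1 p2 X1 X2 : R) :
  0 < alpha -> 0 < delta ->
  0 <= g1 <= Mg -> 0 <= g2 <= Mg -> 0 <= p1 <= Mphi -> 0 <= p2 <= Mphi ->
  0 <= B1 -> 0 <= B2 -> 0 <= D1 <= 1 -> 0 <= D2 <= 1 ->
  B1 <= D1 * S1 -> B2 <= D2 * S2 -> S1 <= B1 + 3 * delta -> S2 <= B2 + 3 * delta ->
  alpha * g1 <= p1 + g1 * (p1 - p2) + X1 -> alpha * g2 <= p2 + g2 * (p2 - p1) + X2 ->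
  alpha * (g1 * S1 + g2 * S2) <= (B1 * X1 - p1 * (D1 * (g2 * S2 - (1 + g1) * S1))) +
    (B2 * X2 - p2 * (D2 * (g1 * S1 - (1 + g2) * S2))) + delta * (6 * (Mg * (alpha + Mphi))).
Proof.
move=> alpha_gt0 d0 /andP[g10 g1M] /andP[g20 g2M] /andP[p10 p1M] /andP[p20 p2M] B10 B20.
move=> /andP[D10 D11] /andP[D20 D21] BD1 BD2 SB1 SB2 L1 L2.
have A1 : alpha * g1 * S1 <= alpha * g1 * (B1 + 3 * delta).
  by apply: ler_wpM2l => //; rewrite mulr_ge0 // ltW.
have A2 : alpha * g2 * S2 <= alpha * g2 * (B2 + 3 * delta).
  by apply: ler_wpM2l => //; rewrite mulr_ge0 // ltW.
have E1 := ler_wpM2l B10 L1. have E2 := ler_wpM2l B20 L2.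
(* The coupling pairs the slope of one component with the value of the other. As [0 <= D <= 1] the
   bound holds whatever the sign of [S]. *)
have DS (D S B : R) : 0 <= D -> D <= 1 -> 0 <= B -> S <= B + 3 * delta ->
    D * S <= B + 3 * delta.
  move=> D0 D1' B0 SB; apply: (@le_trans _ _ (D * (B + 3 * delta))).
    exact: ler_wpM2l.
  by apply: ler_piMl => //; lra.
have F1 : p1 * g2 * (D1 * S2) <= p1 * g2 * (B2 + 3 * delta).
  by apply: ler_wpM2l; [exact: mulr_ge0|exact: DS].
have F2 : p2 * g1 * (D2 * S1) <= p2 * g1 * (B1 + 3 * delta).
  by apply: ler_wpM2l; [exact: mulr_ge0|exact: DS].
have G1 : p1 * (1 + g1) * B1 <= p1 * (1 + g1) * (D1 * S1).
  by apply: ler_wpM2l => //; apply: mulr_ge0 => //; lra.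
have G2 : p2 * (1 + g2) * B2 <= p2 * (1 + g2) * (D2 * S2).
  by apply: ler_wpM2l => //; apply: mulr_ge0 => //; lra.
have a0 := ltW alpha_gt0; have dd := ltW d0.
have M1 : alpha * g1 * delta <= alpha * Mg * delta by do 2?apply: ler_pM => //; exact: mulr_ge0.
have M2 : alpha * g2 * delta <= alpha * Mg * delta by do 2?apply: ler_pM => //; exact: mulr_ge0.
have N1 : p1 * g2 * delta <= Mphi * Mg * delta by do 2?apply: ler_pM => //; exact: mulr_ge0.
have N2 : p2 * g1 * delta <= Mphi * Mg * delta by do 2?apply: ler_pM => //; exact: mulr_ge0.
move: A1 A2 E1 E2 F1 F2 G1 G2 M1 M2 N1 N2; clear => *.
lra.
Qed.

Section adjoint_bound.
Context {R : realType} {n : nat} (n_gt0 : (0 < n)%N).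
Variables (gamma : R -> R) (pen : penalty gamma).
Variables (U : set 'rV[R]_n) (rU : R) (x0 : 'rV[R]_n).
Hypotheses (oU : open U) (bU : forall x, U x -> `|x| <= rU) (Ux0 : U x0).
(* The two components are indexed by [bool], so that the other one is [~~ j]. *)
Variables (s g : bool -> 'rV[R]_n -> R) (Mg Mb Mphi eps alpha : R).
Hypothesis adj_s : forall j, adjoint_function U x0 (s j).
Hypothesis cg : forall j x, U x -> {for x, continuous (g j)}.
Hypothesis gP : forall j x, U x -> 0 <= g j x <= Mg.
Variables (bv : bool -> 'rV[R]_n -> 'rV[R]_n)
  (db : bool -> 'I_n -> 'I_n -> 'rV[R]_n -> R).
Hypothesis cb : forall j i x, U x -> {for x, continuous (fun y => bv j y 0 i)}.
Hypothesis cdb : forall j i l x, U x -> {for x, continuous (db j i l)}.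
Hypothesis dbP : forall j i l x, U x ->
  is_derive x (delta_mx 0 i) (fun y => bv j y 0 l) (db j i l x).
Hypothesis divb_le : forall j x, U x -> `|\sum_i db j i i x| <= Mb.
Variables (phi : bool -> 'rV[R]_n -> R) (phi1 phi2 : bool -> 'I_n -> 'rV[R]_n -> R).
Hypothesis phi_ge0 : forall j x, U x -> 0 <= phi j x <= Mphi.
Hypothesis cphi : forall j x, U x -> {for x, continuous (phi j)}.
Hypothesis cphi1 : forall j i x, U x -> {for x, continuous (phi1 j i)}.
Hypothesis cphi2 : forall j i x, U x -> {for x, continuous (phi2 j i)}.
Hypothesis phiP : forall j i x, U x -> is_derive x (delta_mx 0 i) (phi j) (phi1 j i x).
Hypothesis phi1P : forall j i x, U x ->
  is_derive x (delta_mx 0 i) (phi1 j i) (phi2 j i x).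
Hypotheses (eps_ge0 : 0 <= eps) (alpha_gt0 : 0 < alpha).
Hypothesis phi_super : forall j x, U x ->
  alpha * g j x <= phi j x + g j x * (phi j x - phi (~~ j) x)
    + (\sum_i bv j x 0 i * phi1 j i x - eps * \sum_i phi2 j i x).
Variable k : bool -> R.
Hypotheses (k_ge0 : forall j, 0 <= k j) (k1 : k true + k false = 1).
Hypothesis eqs : forall j, adjoint_equation U eps (fun x => 1 + g j x) (bv j)
  (g (~~ j)) (k j) x0 (s j) (s (~~ j)).

Let W delta j x :=
  softpos delta (s j x) * (\sum_i bv j x 0 i * phi1 j i x - eps * \sum_i phi2 j i x)
  - phi j x * (softpos1 delta (s j x) * (g (~~ j) x * s (~~ j) x - (1 + g j x) * s j x)).

Let cs j x : U x -> x <> x0 -> {for x, continuous (s j)}.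
Proof. by move=> Ux xx0; exact: ((adj_smooth (adj_s j) 0).1 x (conj Ux xx0)). Qed.

Let Mb_ge0 : 0 <= Mb.
Proof. exact: le_trans (normr_ge0 _) (divb_le true Ux0). Qed.

Let W_int delta j : 0 < delta -> dx_integrable U (W delta j) /\
  dx_integral U (W delta j) <=
    k j * phi j x0 + 3 * delta * (Mb * Mphi) * (2 * `|rU|) ^+ n.
Proof.
move=> delta0.
refine (@kato_domain R n n_gt0 gamma pen U rU x0 oU bU Ux0 (s j) (s (~~ j))
  (adj_integrable (adj_s _)) (adj_integrable (adj_s _)) (@cs j) (@cs (~~ j))
  (adj_continuous (adj_s _)) (adj_bdry (adj_s _)) _ _ _ (db j) Mb _ (@cg (~~ j))
  (@cb j) (@cdb j) (@dbP j) Mb_ge0 (@divb_le j) _ _ _ Mphi (@phi_ge0 j) (@cphi j)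
  (@cphi1 j) (@cphi2 j) (@phiP j) (@phi1P j) _ _ _ eps_ge0 (k_ge0 j) delta0 (eqs j)).
move=> x Ux; apply: (@continuousD _ _ _ (cst (1 : R)) (g j)); last exact: cg.
exact: cst_continuous.
Qed.

Let W_ge delta x : 0 < delta -> U x ->
  alpha * (g true x * s true x + g false x * s false x)
  <= W delta true x + W delta false x + delta * (6 * (Mg * (alpha + Mphi))).
Proof.
move=> d0 Ux.
apply: softpos_balance; rewrite ?softpos_ge0 ?softpos1_ge0 ?softpos1_le1 ?gP ?phi_ge0 //.
- exact: softpos1M_ge.
- exact: softpos1M_ge.
- exact: le_softpos.
- exact: le_softpos.
- exact: (phi_super true Ux).
- exact: (phi_super false Ux).
Qed.

(** The weights [k] are nonnegative with sum 1, so the values at [x0] contribute at most [Mphi].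
    [Mg], [Mb] and the volume of the cube all carry a factor [delta], on which the left-hand side
    does not depend. *)
Lemma adjoint_bound :
  dx_integral U (fun x => g true x * s true x)
  + dx_integral U (fun x => g false x * s false x) <= Mphi / alpha.
Proof.
have Igs j : rinteg ((fun x => g j x * s j x) \_ U).
  apply: (rinteg_patchM_bounded oU (cg (j := j)) (M := Mg)) => [x Ux|].
    by have /andP[g0 gM] := gP j Ux; rewrite ger0_norm.
  exact: adj_integrable (adj_s j).
rewrite ler_pdivlMr // mulrC !(dx_integral_patch U).
pose C0 := 6 * (Mg * (alpha + Mphi)).
pose V : R := (2 * `|rU|) ^+ n.
pose C := C0 * V + 6 * (Mb * Mphi) * V.
have Mg0 : 0 <= Mg by have /andP[h0 hM] := gP true Ux0; exact: le_trans hM.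
have Mphi0 : 0 <= Mphi by have /andP[h0 hM] := phi_ge0 true Ux0; exact: le_trans hM.
have C00 : 0 <= C0 by apply: mulr_ge0 => //; apply: mulr_ge0 => //; apply: addr_ge0 => //; exact: ltW.
have V0 : 0 <= V by rewrite exprn_ge0 // mulr_ge0.
have CC : 0 <= C by apply: addr_ge0; apply: mulr_ge0 => //; apply: mulr_ge0 => //; exact: mulr_ge0.
have kphi : k true * phi true x0 + k false * phi false x0 <= Mphi.
  have /andP[_ p1] := phi_ge0 true Ux0; have /andP[_ p2] := phi_ge0 false Ux0.
  have := lerD (ler_wpM2l (k_ge0 true) p1) (ler_wpM2l (k_ge0 false) p2).
  by rewrite -mulrDl k1 mul1r.
have step delta : 0 < delta ->
    alpha * (rint ((fun x => g true x * s true x) \_ U)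
      + rint ((fun x => g false x * s false x) \_ U)) <= Mphi + delta * C.
  move=> d0.
  have [It Ht] := W_int true d0; have [If Hf] := W_int false d0.
  have It' := (dx_integrable_patch _ oU).1 It; have If' := (dx_integrable_patch _ oU).1 If.
  have Ic := @rinteg_cube R n 0 `|rU| (normr_ge0 _).
  have L : rint (fun x => alpha * (((fun x => g true x * s true x) \_ U) x +
        ((fun x => g false x * s false x) \_ U) x)) <=
      rint (fun x => ((W delta true \_ U) x + (W delta false \_ U) x) +
        delta * C0 * \1_(cube (0 : 'rV[R]_n) `|rU|) x).
    apply: le_rint.
    - by apply: rintegZ; exact: rintegD.
    - by apply: rintegD; [exact: rintegD|exact: rintegZ].
    - move=> x; case: (pselect (U x)) => Ux; last first.
        rewrite !patch_out // !addr0 mulr0 add0r; apply: mulr_ge0; last by rewrite indicE.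
        by apply: mulr_ge0 => //; exact: ltW.
      rewrite !patch_in // indicE mem_set ?mulr1; last first.
        by rewrite /cube /= sub0r normrN (le_trans (bU Ux)) // ler_norm.
      exact: W_ge.
  move: L; rewrite (rintZ _ (rintegD (Igs true) (Igs false))).
  rewrite (rintD (rintegD It' If') (rintegZ _ Ic)) !rintD // rintZ // rint_cube // -/V => L.
  move: Ht Hf; rewrite !(dx_integral_patch U) -/V => Ht Hf.
  have arith (r1 r2 q1 q2 z1 z2 z3 : R) : r1 <= q1 + 3 * delta * z1 * z2 ->
      r2 <= q2 + 3 * delta * z1 * z2 -> q1 + q2 <= Mphi ->
      r1 + r2 + delta * z3 * z2 <= Mphi + delta * (z3 * z2 + 6 * z1 * z2).
    by move=> h1 h2 h3; lra.
  by apply: (le_trans L); exact: arith Ht Hf kphi.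
apply/ler_addgt0Pr => e e0.
have d0 : 0 < e / (C + 1) by rewrite divr_gt0 // ltr_wpDl.
apply: le_trans (step _ d0) _; rewrite lerD2l mulrAC ler_pdivrMr ?ltr_wpDl //.
by rewrite ler_pM2l // lerDl.
Qed.

End adjoint_bound.

(** * Regularity of the data *)

Section closure_regularity.
Context {R : realType} {V : normedModType R}.
Variables (O : set V) (oO : open O).

(* [Ck_closure] constrains the values on the boundary, where ['D_v f] is junk;
   agreeing on [O] with such a function is a property stable under ['D_v]. *)
Definition Ck_extends k (f : V -> R) :=
  exists2 g, Ck_closure k O g & forall x, O x -> f x = g x.

Let near_O x (f g : V -> R) : O x -> (forall x, O x -> f x = g x) ->
  \forall y \near x, f y = g y.
Proof.
move=> Ox fg; have : nbhs x O by exact: open_nbhs_nbhs.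
by apply: filterS => y /fg.
Qed.

(** In the open set [O] both functions have the same derivatives; the boundary values of ['D_v f]
    are immaterial. *)
Lemma Ck_extends_derive k f v : Ck_extends k.+1 f -> Ck_extends k ('D_v f).
Proof.
move=> [g [_ /(_ v)[gv [dg Cgv]]] fg]; exists gv => // x Ox.
by rewrite (near_eq_derive _ (near_O Ox fg)); have [_ ->] := dg x Ox.
Qed.

Lemma Ck_extends_continuous k f x : Ck_extends k f -> O x -> {for x, continuous f}.
Proof.
move=> [g Cg fg] Ox.
have {Cg} cg : {within closure O, continuous g} by case: k Cg => [|k] [].
apply: (@near_eq_continuous _ _ g f).
  by apply: filterS (near_O Ox fg) => y ->.
have := continuous_subspaceW (@subset_closure _ O) cg.
by rewrite continuous_open_subspace // => /(_ x); apply; rewrite inE.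
Qed.

Lemma Ck_extends_is_derive k f x v : Ck_extends k.+1 f -> O x -> is_derive x v f ('D_v f x).
Proof.
move=> [g [_ /(_ v)[gv [dg _]]] fg] Ox.
have H : is_derive x v f (gv x).
  apply: near_eq_is_derive (dg x Ox).
  by apply: filterS (near_O Ox fg) => y ->.
by have [_ ->] := H.
Qed.

Lemma Ck_extends_bounded k f (K : set V) : Ck_extends k f ->
  compact K -> K `<=` closure O -> exists2 M : R, 0 <= M & forall x, O x -> K x -> `|f x| <= M.
Proof.
move=> [g Cg fg] cK KO.
have {Cg} cg : {within closure O, continuous g} by case: k Cg => [|k] [].
have /compact_bounded[M [_ gM]] := continuous_compact (continuous_subspaceW KO cg) cK.
exists (`|M| + 1); first by rewrite addr_ge0.
move=> x Ox Kx; rewrite fg //; apply: gM; last by exists x.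
by rewrite (le_lt_trans (ler_norm M)) // ltrDl.
Qed.

Lemma smooth_closure_extends k f : smooth_closure O f -> Ck_extends k f.
Proof. by move=> /(_ k) Cf; exists f. Qed.

End closure_regularity.

Lemma closure_setX_subset (T1 T2 : topologicalType) (A : set T1) (B : set T2) :
  closure A `*` B `<=` closure (A `*` B).
Proof.
move=> [x p] [/= Ax Bp] N [[N1 N2] [/= n1 n2] N12].
have [y [Ay N1y]] := Ax _ n1.
exists (y, p); split => //; apply: N12; split => //=; exact: nbhs_singleton.
Qed.

Section penalty_derivative.
Context {R : realType}.
Variables (gamma : R -> R) (pen : penalty gamma).

Lemma penalty_is_derive (r : R) : is_derive r 1 gamma (derive1 gamma r).
Proof.
rewrite derive1E; exact: (@Ck_on_is_derive R R^o 0 setT gamma r 1 (pen_smooth pen 1) I).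
Qed.

Lemma penalty_derive_continuous : continuous (derive1 gamma).
Proof.
move=> r; rewrite (_ : derive1 gamma = 'D_1 gamma); last by apply/funext => s; rewrite derive1E.
exact: (((pen_smooth pen 1).2 1).2.1 r I).
Qed.

(** [pen_derive] speaks of positive arguments; at the others [gamma] attains its minimum 0, so its
    derivative vanishes. *)
Lemma penalty_derive_bound (r : R) : 0 <= derive1 gamma r <= 1.
Proof.
have [r0|r0] := leP r 0; last by have /andP[/ltW -> ->] := pen_derive pen r0.
suff -> : derive1 gamma r = 0 by rewrite lexx ler01.
have H : is_derive r 1 gamma 0.
  apply: (@derive1_at_min R gamma (r - 1) (r + 1) r).
  - by lra.
  - by move=> t _; have [] := penalty_is_derive t.
  - by rewrite in_itv /=; apply/andP; split; lra.
  - by move=> t _; rewrite (pen_eq0 pen r0); exact: pen_ge0.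
by rewrite derive1E; have [_ ->] := H.
Qed.

(** The tangent at [r] lies below [gamma], in particular at 0, where [gamma] vanishes. *)
Lemma penalty_derive_ge (r : R) : gamma r <= derive1 gamma r * r.
Proof.
have d := is_derive_scale (- r) (penalty_is_derive r).
have E : - r *: (1 : R^o) = 0 - r by rewrite sub0r /GRing.scale /= mulr1.
rewrite E in d.
have := convex_above_tangent (pen_convex pen) d.
rewrite (pen_eq0 pen (lexx 0)); lra.
Qed.

Variables (eps : R) (eps_gt0 : 0 < eps).
Local Notation g := (derive1 (gamma_eps gamma eps)).

Lemma gamma_eps_derive (r : R) : g r = derive1 gamma (r / eps) / eps.
Proof.
have d : is_derive r 1 (fun r : R => r / eps) eps^-1.
  have := @is_deriveZ R R R id eps^-1 r 1 1 (is_derive_id _ _).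
  rewrite /GRing.scale /= mulr1; congr (is_derive _ _ _ _).
  by apply/funext => s /=; rewrite mulrC.
have [_ <-] := is_derive_comp1 d (penalty_is_derive _).
exact: derive1E.
Qed.

Lemma gamma_eps_derive_continuous : continuous g.
Proof.
rewrite (_ : g = fun r => derive1 gamma (r / eps) / eps); last first.
  by apply/funext => r; exact: gamma_eps_derive.
have cM : continuous (fun r : R => r / eps) by exact: mulrr_continuous.
have cg : continuous (derive1 gamma \o (fun r : R => r / eps)).
  by apply: cont_comp cM; exact: penalty_derive_continuous.
exact: cont_comp cM cg.
Qed.

Lemma gamma_eps_derive_bound (r : R) : 0 <= g r <= eps^-1.
Proof.
have /andP[g0 g1] := penalty_derive_bound (r / eps).
rewrite gamma_eps_derive divr_ge0 ?(ltW eps_gt0) //=.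
by rewrite ler_piMl // invr_ge0 ltW.
Qed.

Lemma gamma_eps_derive_ge (r : R) : gamma_eps gamma eps r <= g r * r.
Proof.
rewrite gamma_eps_derive /gamma_eps mulrAC -mulrA; exact: penalty_derive_ge.
Qed.

End penalty_derivative.

Lemma rV_continuous {R : realType} {V : normedModType R} {m : nat}
    (q : V -> 'rV[R]_m) x :
  (forall l, {for x, continuous (fun y => q y 0 l)}) -> {for x, continuous q}.
Proof.
move=> cq; apply/cvgrPdist_le => e e0.
have H l : \forall y \near x, `|q x 0 l - q y 0 l| <= e.
  by move/cvgrPdist_le : (cq l) => /(_ e e0).
have := filter_forall (nbhs_filter x) H; apply: filterS => y Hy.
by apply: norm_le_coord => [|l]; [exact: ltW|rewrite !mxE; exact: Hy].
Qed.

Section second_variable.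
Context {R : realType} {V1 V2 : normedModType R}.
Variables (h : V1 * V2 -> R) (x : V1) (p v : V2).

Let quotient_snd :
  (fun t : R => t^-1 *: (((h \o shift (x, p)) (t *: (0, v))) - h (x, p))) =
  (fun t : R => t^-1 *: ((((fun q => h (x, q)) \o shift p) (t *: v)) - h (x, p))).
Proof.
by apply/funext => t /=; congr (_ *: (h (_, _) - _)); rewrite /= scaler0 add0r.
Qed.

Lemma derive_snd : 'D_(0, v) h (x, p) = 'D_v (fun q => h (x, q)) p.
Proof. by rewrite /derive quotient_snd. Qed.

Lemma derivable_snd : derivable h (x, p) (0, v) -> derivable (fun q => h (x, q)) p v.
Proof. by rewrite /derivable quotient_snd. Qed.

End second_variable.

Lemma pair_continuous {R : realType} {V1 V2 : normedModType R} (x : V1) (p : V2) :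
  {for p, continuous (fun q => (x, q))}.
Proof.
by rewrite /prop_for /continuous_at; apply: cvg_pair; [exact: cvg_cst|exact: cvg_id].
Qed.

Lemma graph_continuous {R : realType} {V1 V2 : normedModType R} (f : V1 -> V2) x :
  {for x, continuous f} -> {for x, continuous (fun y => (y, f y))}.
Proof.
by move=> cf; rewrite /prop_for /continuous_at; apply: cvg_pair => //; exact: cvg_id.
Qed.

Lemma continuous_at_sum {R : realType} {V : normedModType R} (I : finType)
    (F : I -> V -> R) x :
  (forall i, {for x, continuous (F i)}) -> {for x, continuous (fun y => \sum_i F i y)}.
Proof.
move=> cF; rewrite (_ : (fun y => _) = \sum_i F i); last first.
  by apply/funext => y; rewrite fct_sumE.
apply: (big_ind (fun f : V -> R => {for x, continuous f})) => //.
  exact: cst_continuous.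
by move=> f g cf cg; exact: continuousD cf cg.
Qed.

Section drift.
Context {R : realType} {n : nat}.
Variables (U : set 'rV[R]_n) (rU : R).
Hypotheses (oU : open U) (bU : forall x, U x -> `|x| <= rU).
Variables (H : 'rV[R]_n -> 'rV[R]_n -> R) (u : 'rV[R]_n -> R).
Hypothesis hamH : hamiltonian U H.
Hypothesis Su : smooth_closure U u.
Local Notation e i := (delta_mx 0 i : 'rV[R]_n).
Local Notation O := (U `*` [set: 'rV[R]_n]).
Local Notation h := (fun z : 'rV[R]_n * 'rV[R]_n => H z.1 z.2).

Let oO : open O. Proof.
rewrite openE => -[x p] [/= Ux _]; exists (U, setT) => //=.
by split; [exact: open_nbhs_nbhs|exact: filterT].
Qed.

Lemma closure_bounded x : closure U x -> `|x| <= rU.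
Proof.
have cl : closed [set x : 'rV[R]_n | `|x| <= rU].
  by apply: compact_closed; [exact: norm_hausdorff|exact: compact_cube].
by move=> Ux; apply: cl; move: x Ux; apply: closure_subset.
Qed.

Lemma compact_closure : compact (closure U).
Proof.
apply: (subclosed_compact _ (@compact_cube R n rU)); first exact: closed_closure.
by move=> x /closure_bounded.
Qed.

Let Eh k : Ck_extends O k h.
Proof. exact: smooth_closure_extends (ham_smooth hamH). Qed.

Let Eu k : Ck_extends U k u.
Proof. exact: smooth_closure_extends. Qed.

(** Differentiating in [p] with [x] frozen is a directional derivative of the joint function. In
    this form it stays in the class [Ck_extends] and can be composed with [x |-> (x, grad u x)]. *)
Let Hp l : 'rV[R]_n * 'rV[R]_n -> R := 'D_((0, e l) : 'rV[R]_n * 'rV[R]_n) h.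

Let EHp l k : Ck_extends O k (Hp l).
Proof. exact: Ck_extends_derive. Qed.

Lemma drift_coord x l : grad (H x) (grad u x) 0 l = Hp l (x, grad u x).
Proof. by rewrite /Hp derive_snd mxE. Qed.

Let Eu1 i k : Ck_extends U k ('D_(e i) u). Proof. exact: Ck_extends_derive. Qed.
Let Eu2 i j k : Ck_extends U k ('D_(e j) ('D_(e i) u)). Proof. exact: Ck_extends_derive. Qed.

Let c_grad x : U x -> {for x, continuous (fun y => (y, grad u y))}.
Proof.
move=> Ux; apply: graph_continuous.
apply: rV_continuous => l.
rewrite (_ : (fun y => _) = 'D_(e l) u); last by apply/funext => y; rewrite mxE.
exact: Ck_extends_continuous (Eu1 l 0) Ux.
Qed.

Let c_comp (F : 'rV[R]_n * 'rV[R]_n -> R) x : Ck_extends O 0 F -> U x ->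
  {for x, continuous (fun y => F (y, grad u y))}.
Proof.
move=> EF Ux; apply: (continuous_comp (c_grad Ux)).
exact: (Ck_extends_continuous oO EF).
Qed.

Let bnd (f : 'rV[R]_n -> R) := exists2 M : R, 0 <= M & forall x, U x -> `|f x| <= M.

Let bndD f g : bnd f -> bnd g -> bnd (fun x => f x + g x).
Proof.
move=> [M M0 fM] [N N0 gN]; exists (M + N); first exact: addr_ge0.
by move=> x Ux; apply: le_trans (ler_normD _ _) _; apply: lerD; [exact: fM|exact: gN].
Qed.

Let bndM f g : bnd f -> bnd g -> bnd (fun x => f x * g x).
Proof.
move=> [M M0 fM] [N N0 gN]; exists (M * N); first exact: mulr_ge0.
by move=> x Ux; rewrite normrM; apply: ler_pM => //; [exact: fM|exact: gN].
Qed.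

Let bnd_cst (c : R) : bnd (fun=> c).
Proof. by exists `|c|. Qed.

Let bnd_sum (F : 'I_n -> 'rV[R]_n -> R) : (forall i, bnd (F i)) ->
  bnd (fun x => \sum_i F i x).
Proof.
move=> bF; rewrite (_ : (fun x => _) = \sum_i F i); last by apply/funext => x; rewrite fct_sumE.
by apply: big_ind => //; exact: bnd_cst.
Qed.

Let bnd_u f : Ck_extends U 0 f -> bnd f.
Proof.
move=> Ef; have [M M0 fM] := Ck_extends_bounded Ef compact_closure (@subset_refl _ _).
by exists M => // x Ux; apply: fM => //; exact: subset_closure.
Qed.

(** The gradient of [u] is bounded on [U], so all pairs [(x, grad u x)] lie in one compact set, the
    product of [closure U] and a cube. *)
Let bnd_comp (F : 'rV[R]_n * 'rV[R]_n -> R) : Ck_extends O 0 F ->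
  bnd (fun x => F (x, grad u x)).
Proof.
move=> EF.
have /choice[M MP] : forall i, exists M : R, 0 <= M /\ forall x, U x -> `|'D_(e i) u x| <= M.
  by move=> i; have [M M0 uM] := bnd_u (Eu1 i 0); exists M.
pose r := \sum_i M i.
have r0 : 0 <= r by apply: sumr_ge0 => i _; have [] := MP i.
have gr x : U x -> `|grad u x| <= r.
  move=> Ux; apply: norm_le_coord => // i; rewrite mxE.
  have [_ /(_ x Ux)] := MP i; move=> /le_trans; apply.
  rewrite /r (bigD1 i) //= lerDl; apply: sumr_ge0 => k _; have [] // := MP k.
have cK := compact_setX compact_closure (@compact_cube R n r).
have KO : closure U `*` [set p : 'rV[R]_n | `|p| <= r] `<=` closure O.
  by move=> [x p] [cx _]; apply: closure_setX_subset.
have [N N0 FN] := Ck_extends_bounded EF cK KO.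
by exists N => // x Ux; apply: FN; split => //; [exact: subset_closure|exact: gr].
Qed.

Lemma drift_regularity :
  (forall l x, U x -> {for x, continuous (fun y => grad (H y) (grad u y) 0 l)}) /\
  exists db : 'I_n -> 'I_n -> 'rV[R]_n -> R, exists Mb : R,
  [/\ forall i l x, U x -> {for x, continuous (db i l)},
      forall i l x, U x ->
        is_derive x (e i) (fun y => grad (H y) (grad u y) 0 l) (db i l x) &
      forall x, U x -> `|\sum_i db i i x| <= Mb].
Proof.
have E l : (fun y => grad (H y) (grad u y) 0 l) = fun y => Hp l (y, grad u y).
  by apply/funext => y; exact: drift_coord.
split => [l x Ux|]; first by rewrite E; exact: (c_comp (EHp l 0) Ux).
pose F1 l k := 'D_((e k, 0) : 'rV[R]_n * 'rV[R]_n) (Hp l).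
pose F2 l k := 'D_((0, e k) : 'rV[R]_n * 'rV[R]_n) (Hp l).
have EF1 l k : Ck_extends O 0 (F1 l k) by exact: Ck_extends_derive.
have EF2 l k : Ck_extends O 0 (F2 l k) by exact: Ck_extends_derive.
(* Dependence of the drift on [x] directly, then through [grad u]; the factors [(e i) 0 k] are those
   produced by [is_derive_chain]. *)
pose db i l x := \sum_k (e i) 0 k * F1 l k (x, grad u x)
  + \sum_k 'D_(e i) ('D_(e k) u) x * F2 l k (x, grad u x).
have Bdb : bnd (fun x => \sum_i db i i x).
  apply: bnd_sum => i; apply: bndD; apply: bnd_sum => k; apply: bndM.
  - exact: bnd_cst.
  - exact: (bnd_comp (EF1 i k)).
  - exact: (bnd_u (Eu2 k i 0)).
  - exact: (bnd_comp (EF2 i k)).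
have [Mb Mb0 dbM] := Bdb.
exists db, Mb; split => // i l x Ux.
- apply: (@continuousD _ _ _ (fun y => \sum_k (e i) 0 k * F1 l k (y, grad u y))
    (fun y => \sum_k 'D_(e i) ('D_(e k) u) y * F2 l k (y, grad u y))).
    apply: continuous_at_sum => k.
    apply: (@continuousM _ _ (cst ((e i) 0 k)) (fun y => F1 l k (y, grad u y))).
      exact: cst_continuous.
    exact: (c_comp (EF1 l k) Ux).
  apply: continuous_at_sum => k.
  apply: (@continuousM _ _ ('D_(e i) ('D_(e k) u)) (fun y => F2 l k (y, grad u y))).
    exact: (Ck_extends_continuous oU (Eu2 k i 0)).
  exact: (c_comp (EF2 l k) Ux).
- rewrite E; apply: is_derive_chain.
  + have : nbhs (x, grad u x) O by apply: open_nbhs_nbhs; split.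
    by apply: filterS => y Oy; split => k;
      [exact: (Ck_extends_is_derive oO (e k, 0) (EHp l 1) Oy)|
       exact: (Ck_extends_is_derive oO (0, e k) (EHp l 1) Oy)].
  + by move=> k; apply: (Ck_extends_continuous oO (EF1 l k)).
  + by move=> k; apply: (Ck_extends_continuous oO (EF2 l k)).
  + move=> k; rewrite (_ : (fun y => _) = 'D_(e k) u); last by apply/funext => y; rewrite mxE.
    exact: (Ck_extends_is_derive oU (e i) (Eu1 k 1) Ux).
Qed.

(** The tangent inequality at [p] evaluated at 0. It converts [b . Du - H(x, Du)] into a quantity
    bounded below by [- H(x, 0)]. *)
Lemma drift_convex x p : U x -> H x p - \sum_i grad (H x) p 0 i * p 0 i <= H x 0.
Proof.
move=> Ux.
have dH q i : is_derive q (e i) (H x) ('D_(e i) (H x) q).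
  apply: derivableP.
  have [D _] := Ck_extends_is_derive oO (0, e i) (Eh 1) (conj Ux I : O (x, q)).
  exact: derivable_snd D.
have d : is_derive p (0 - p) (H x) (\sum_i (0 - p) 0 i * 'D_(e i) (H x) p).
  refine (@is_derive_rV R n (H x) p (0 - p) (fun i => 'D_(e i) (H x)) _ _) => [|i].
    exact: (@filterS _ (nbhs p) (nbhs_filter p) setT _ (fun q _ i => dH q i)
      (@filterT _ _ (nbhs_filter p))).
  rewrite (_ : 'D_(e i) (H x) = fun q => Hp i (x, q)).
    apply: (continuous_comp (@pair_continuous _ _ _ x p)).
    exact: (Ck_extends_continuous oO (EHp i 0)).
  by apply/funext => q; rewrite /Hp derive_snd.
have := convex_above_tangent (ham_convex hamH (subset_closure Ux)) d.
congr (_ + _ <= _); rewrite -sumrN; apply: eq_bigr => i _.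
by rewrite sub0r !mxE mulNr mulrC.
Qed.

End drift.

(** * The maximum principle and the theorem *)

Section interior_extremum.
Context {R : realType} {n : nat}.
Variables (U : set 'rV[R]_n) (oU : open U) (u : 'rV[R]_n -> R).
Hypothesis Eu : Ck_extends U 2 u.
Local Notation e i := (delta_mx 0 i : 'rV[R]_n).

Let du i x : U x -> is_derive x (e i) u ('D_(e i) u x).
Proof. by move=> Ux; exact: (Ck_extends_is_derive oU (e i) Eu Ux). Qed.

Let ddu i x : U x -> is_derive x (e i) ('D_(e i) u) ('D_(e i) ('D_(e i) u) x).
Proof.
move=> Ux; exact: (Ck_extends_is_derive oU (e i) (Ck_extends_derive oU (e i) Eu) Ux).
Qed.

Let nearU x (P : 'rV[R]_n -> Prop) : U x -> (forall y, U y -> P y) -> \forall y \near x, P y.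
Proof.
move=> Ux UP; have : nbhs x U by exact: open_nbhs_nbhs.
by apply: filterS => y /UP.
Qed.

Lemma interior_max x : U x -> (forall y, U y -> u y <= u x) ->
  grad u x = 0 /\ laplacian u x <= 0.
Proof.
move=> Ux umax.
have D i := is_derive_local_max (nearU Ux (@du i)) (ddu i Ux) (nearU Ux umax).
split; first by apply/rowP => i; rewrite !mxE; have [-> _] := D i.
by rewrite /laplacian sumr_le0 // => i _; have [_ ->] := D i.
Qed.

Lemma interior_min x : U x -> (forall y, U y -> u x <= u y) ->
  grad u x = 0 /\ 0 <= laplacian u x.
Proof.
move=> Ux umin.
have D i : 'D_(e i) u x = 0 /\ 0 <= 'D_(e i) ('D_(e i) u) x.
  have d1 y : U y -> is_derive y (e i) (fun z => -1 * u z) (-1 * 'D_(e i) u y).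
    by move=> Uy; exact: is_deriveZ_fun (du i Uy).
  have d2 : is_derive x (e i) (fun z => -1 * 'D_(e i) u z)
    (-1 * 'D_(e i) ('D_(e i) u) x) by exact: is_deriveZ_fun (ddu i Ux).
  have m : forall y, U y -> -1 * u y <= -1 * u x.
    by move=> y Uy; rewrite !mulN1r lerN2; exact: umin.
  have [/eqP H1 H2] := is_derive_local_max (nearU Ux d1) d2 (nearU Ux m).
  by move: H1 H2; rewrite !mulN1r oppr_eq0 oppr_le0 => /eqP -> ->.
split; first by apply/rowP => i; rewrite !mxE; have [-> _] := D i.
by rewrite /laplacian sumr_ge0 // => i _; have [_ ->] := D i.
Qed.

End interior_extremum.

Section maximum_principle.
Context {R : realType} {n : nat}.
Variables (gamma : R -> R) (pen : penalty gamma).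
Variables (U : set 'rV[R]_n) (rU : R) (alpha eps C0 : R).
Hypotheses (oU : open U) (bU : forall x, U x -> `|x| <= rU).
Hypotheses (alpha_gt0 : 0 < alpha) (eps_gt0 : 0 < eps) (C0_ge0 : 0 <= C0).
Variables (H : bool -> 'rV[R]_n -> 'rV[R]_n -> R) (psi u : bool -> 'rV[R]_n -> R).
Hypothesis obs : forall j, obstacle U alpha (psi j).
Hypothesis Su : forall j, smooth_closure U (u j).
Hypothesis u_eq : forall j x, U x ->
  u j x + H j x (grad (u j) x)
    + gamma_eps gamma eps (theta (u j) (u (~~ j)) (psi j) x)
  = eps * laplacian (u j) x.
Hypothesis u_bdry : forall j x, bdry U x -> u j x = 0.
Hypothesis H0_le : forall j x, U x -> `|H j x 0| <= C0.

Let Eu j k : Ck_extends U k (u j).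
Proof. exact: smooth_closure_extends. Qed.

Let closureP x : closure U x -> U x \/ bdry U x.
Proof. by move=> cx; case: (pselect (U x)) => Ux; [left|right]. Qed.

Lemma solution_le j x : U x -> u j x <= C0.
Proof.
move=> Ux; have cx := subset_closure Ux.
have [c] := compact_EVT_max (ex_intro _ x cx) (compact_closure bU) (Su j 0).1.
rewrite inE => cc umax.
have {}umax y : closure U y -> u j y <= u j c by move=> cy; apply: umax; rewrite inE.
apply: (le_trans (umax _ cx)); have [Uc|/(u_bdry j) -> //] := closureP cc.
have [g0 lap] := interior_max oU (Eu j 2) Uc (fun y Uy => umax y (subset_closure Uy)).
have := u_eq j Uc; rewrite g0.
have /ler_normlP[h1 _] := H0_le j Uc.
have := pen_ge0 pen (theta (u j) (u (~~ j)) (psi j) c / eps).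
have : eps * laplacian (u j) c <= 0 by rewrite mulr_ge0_le0 // ltW.
rewrite /gamma_eps; lra.
Qed.

(* At a point where the minimum over both components is attained the obstacle
   constraint is slack, so that the penalty vanishes there. *)
Let min_ge j c : closure U c -> (forall y, closure U y -> u j c <= u j y) ->
  u j c <= u (~~ j) c -> - C0 <= u j c.
Proof.
move=> cc umin uc; have [Uc|/(u_bdry j) ->] := closureP cc; last by rewrite oppr_le0.
have [g0 lap] := interior_min oU (Eu j 2) Uc (fun y Uy => umin y (subset_closure Uy)).
have := u_eq j Uc; rewrite g0.
have /ler_normlP[_ h1] := H0_le j Uc.
have lap' : 0 <= eps * laplacian (u j) c by rewrite mulr_ge0 // ltW.
have th : theta (u j) (u (~~ j)) (psi j) c <= 0.
  rewrite /theta subr_le0; apply: (@le_trans _ _ 0); first by rewrite subr_le0.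
  exact: le_trans (ltW alpha_gt0) (obs_ge (obs j) cc).
have -> : gamma_eps gamma eps (theta (u j) (u (~~ j)) (psi j) c) = 0.
  by rewrite /gamma_eps (pen_eq0 pen) // mulr_le0_ge0 // invr_ge0 ltW.
lra.
Qed.

Lemma solution_ge j x : U x -> - C0 <= u j x.
Proof.
move=> Ux; have cx := subset_closure Ux.
have M l : exists2 c, closure U c & forall y, closure U y -> u l c <= u l y.
  have [c] := compact_EVT_min (ex_intro _ x cx) (compact_closure bU) (Su l 0).1.
  rewrite inE => cc umin; exists c => // y cy; apply: umin; rewrite inE //.
have [c cc cmin] := M true; have [d cd dmin] := M false.
(* The smaller of the two minima is the minimum over both components, so at that point the component
   attaining it lies below the other, as [min_ge] requires. *)
have [cd_le|/ltW dc_le] := leP (u true c) (u false d).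
  have C := min_ge cc cmin (le_trans cd_le (dmin c cc)).
  case: j; first exact: le_trans (cmin x cx).
  by apply: le_trans (dmin x cx); exact: le_trans cd_le.
have C := min_ge (j := false) cd dmin (le_trans dc_le (cmin d cd)).
case: j; last exact: le_trans (dmin x cx).
by apply: le_trans (cmin x cx); exact: le_trans dc_le.
Qed.

End maximum_principle.

Section hamiltonian_bound.
Context {R : realType} {n : nat}.
Variables (U : set 'rV[R]_n) (rU : R) (H : 'rV[R]_n -> 'rV[R]_n -> R).
Hypotheses (oU : open U) (bU : forall x, U x -> `|x| <= rU) (hamH : hamiltonian U H).

Lemma hamiltonian0_bounded : exists2 M : R, 0 <= M & forall x, U x -> `|H x 0| <= M.
Proof.
have cK := compact_setX (compact_closure bU) (@compact_set1 _ (0 : 'rV[R]_n)).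
have KO : closure U `*` [set (0 : 'rV[R]_n)] `<=` closure (U `*` setT).
  by move=> [x p] [cx _]; apply: closure_setX_subset.
have [M M0 HM] := Ck_extends_bounded (smooth_closure_extends 0 (ham_smooth hamH)) cK KO.
exists M => // x Ux; apply: (HM (x, 0)); split => //=; exact: subset_closure.
Qed.

End hamiltonian_bound.

Theorem lemma5p5 (R : realType) (n : nat) (n_ge2 : (2 <= n)%N)
    (U : set 'rV[R]_n) (H1 H2 : 'rV[R]_n -> 'rV[R]_n -> R)
    (psi1 psi2 : 'rV[R]_n -> R) (alpha : R) (gamma : R -> R)
    (domU : smooth_bounded_domain U)
    (hamH1 : hamiltonian U H1) (hamH2 : hamiltonian U H2)
    (alpha_gt0 : 0 < alpha)
    (obs1 : obstacle U alpha psi1) (obs2 : obstacle U alpha psi2)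
    (compat : compatible U H1 H2 psi1 psi2)
    (pen : penalty gamma) :
  exists2 C : R, 0 < C &
    forall (eps : R) (u1 u2 : 'rV[R]_n -> R), 0 < eps ->
      penalized_solution U H1 H2 psi1 psi2 gamma eps u1 u2 ->
    forall (i : nat) (x0 : 'rV[R]_n) (s1 s2 : 'rV[R]_n -> R),
      (1 <= i <= 2)%N -> U x0 ->
      adjoint_solution U H1 H2 psi1 psi2 gamma eps u1 u2 i x0 s1 s2 ->
      dx_integral U
        (fun x => derive1 (gamma_eps gamma eps) (theta u1 u2 psi1 x) * s1 x)
      + dx_integral U
        (fun x => derive1 (gamma_eps gamma eps) (theta u2 u1 psi2 x) * s2 x)
      <= C.
Proof.
have [oU _ [r0 [_ bU0]] _] := domU.
have [rU bU] : exists rU : R, forall x, U x -> `|x| <= rU.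
  by exists (r0 + 1) => x; apply: bU0; rewrite ltrDl.
have [M1 M10 HM1] := hamiltonian0_bounded bU hamH1.
have [M2 M20 HM2] := hamiltonian0_bounded bU hamH2.
(* A bound for both [|H_j(x, 0)|], fixed before [eps]; the summand 1 makes the final constant
   positive. *)
pose C0 := M1 + M2 + 1.
have C0_gt0 : 0 < C0 by rewrite ltr_wpDl // addr_ge0.
exists (2 * C0 / alpha); first by rewrite divr_gt0 // mulr_gt0.
move=> eps u1 u2 eps_gt0 sol i x0 s1 s2 /andP[i1 i2] Ux0 adj.
pose H j := if j then H1 else H2.
pose psi j := if j then psi1 else psi2.
pose u j := if j then u1 else u2.
pose s j := if j then s1 else s2.
pose g j x := derive1 (gamma_eps gamma eps) (theta (u j) (u (~~ j)) (psi j) x).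
pose k j : R := if j then 2%:R - i%:R else i%:R - 1.
have hamH j : hamiltonian U (H j) by case: j.
have obs j : obstacle U alpha (psi j) by case: j.
have Su j : smooth_closure U (u j).
  by case: j; [exact: psol_smooth1 sol|exact: psol_smooth2 sol].
have Eu j m : Ck_extends U m (u j) by exact: smooth_closure_extends.
have u_eq j x : U x -> u j x + H j x (grad (u j) x)
    + gamma_eps gamma eps (theta (u j) (u (~~ j)) (psi j) x) = eps * laplacian (u j) x.
  by case: j; [exact: psol_eq1 sol x|exact: psol_eq2 sol x].
have u_bdry j x : bdry U x -> u j x = 0.
  by move=> /(psol_bdry sol)[]; case: j.
have H0_le j x : U x -> `|H j x 0| <= C0.
  by move=> Ux; rewrite /C0; case: j => /=;
    [have := HM1 x Ux|have := HM2 x Ux]; lra.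
have u_le := solution_le pen oU bU eps_gt0 (ltW C0_gt0) Su u_eq u_bdry H0_le.
have u_ge := solution_ge pen oU bU alpha_gt0 eps_gt0 (ltW C0_gt0) obs Su u_eq u_bdry H0_le.
have Epsi j : Ck_extends U 0 (psi j).
  by apply: smooth_closure_extends; exact: obs_smooth (obs j).
have cu j x Ux := Ck_extends_continuous oU (Eu j 0) (x := x) Ux.
have ctheta j x : U x -> {for x, continuous (theta (u j) (u (~~ j)) (psi j))}.
  move=> Ux; exact: (continuousB (continuousB (cu j x Ux) (cu (~~ j) x Ux))
    (Ck_extends_continuous oU (Epsi j) Ux)).
have cg j x : U x -> {for x, continuous (g j)}.
  move=> Ux; apply: (continuous_comp (ctheta j x Ux)).
  exact: gamma_eps_derive_continuous.
have gP j x : U x -> 0 <= g j x <= eps^-1.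
  by move=> _; exact: gamma_eps_derive_bound.
have [cb1 [db1 [Mb1 [cdb1 dbP1 div1]]]] := drift_regularity oU bU hamH1 (Su true).
have [cb2 [db2 [Mb2 [cdb2 dbP2 div2]]]] := drift_regularity oU bU hamH2 (Su false).
pose db j := if j then db1 else db2.
pose b j x := grad (H j x) (grad (u j) x).
pose phi j x := u j x + C0.
pose phi1 j l := 'D_(delta_mx 0 l) (u j).
pose phi2 j l := 'D_(delta_mx 0 l) ('D_(delta_mx 0 l) (u j)).
have Eu1 j l m : Ck_extends U m (phi1 j l) by exact: (Ck_extends_derive oU _ (Eu j m.+1)).
have Eu2 j l m : Ck_extends U m (phi2 j l) by exact: (Ck_extends_derive oU _ (Eu1 j l m.+1)).
(* [phi_j - phi_(3-j) = theta_j + psi_j]. Multiplied by [g j x], the part [theta_j] dominates the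
   penalty and [psi_j] gives the term with [alpha]. The constant [C0] in [phi_j] absorbs
   [H_j(x, 0)], and the equation for [u_j] cancels the rest. *)
have phi_super j x : U x -> alpha * g j x <= phi j x + g j x * (phi j x - phi (~~ j) x)
    + (\sum_l b j x 0 l * phi1 j l x - eps * \sum_l phi2 j l x).
  move=> Ux.
  have E1 : \sum_l b j x 0 l * phi1 j l x =
      \sum_l grad (H j x) (grad (u j) x) 0 l * grad (u j) x 0 l.
    by apply: eq_bigr => l _; rewrite [grad (u j) x 0 l]mxE.
  rewrite E1 -/(laplacian (u j) x).
  have A1 := drift_convex oU (hamH j) (grad (u j) x) Ux.
  have A2 := gamma_eps_derive_ge pen eps (theta (u j) (u (~~ j)) (psi j) x).
  have A3 := u_eq j x Ux.
  have /ler_normlP[_ A4] := H0_le j x Ux.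
  have /andP[g0 _] := gP j x Ux.
  have A5 := ler_wpM2l g0 (obs_ge (obs j) (subset_closure Ux)).
  move: A1 A2 A3 A4 A5; rewrite -/(g j x) /phi {2}/theta.
  move: (\sum_l _) (H j x (grad (u j) x)) (H j x 0) (eps * _) (gamma_eps _ _ _)
    (g j x) (u j x) (u (~~ j) x) (psi j x).
  have arith (B P Q L G d v w z : R) : P - B <= Q -> G <= d * (v - w - z) ->
      v + P + G = L -> Q <= C0 -> d * alpha <= d * z ->
      alpha * d <= v + C0 + d * (v + C0 - (w + C0)) + (B - L).
    by lra.
  exact: arith.
have k0 j : 0 <= k j.
  by rewrite /k; case: j; rewrite subr_ge0 ?ler_nat // ler1n.
have k1 : k true + k false = 1 by rewrite /k; ring.
have eqs j : adjoint_equation U eps (fun x => 1 + g j x) (b j) (g (~~ j)) (k j) x0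
    (s j) (s (~~ j)).
  by case: j; [exact: asol_eq1 adj|exact: asol_eq2 adj].
have phiP j l x : U x -> is_derive x (delta_mx 0 l) (phi j) (phi1 j l x).
  move=> Ux; rewrite -[phi1 j l x]addr0.
  exact: (is_deriveD_fun (Ck_extends_is_derive oU (delta_mx 0 l) (Eu j 1) Ux)
    (is_derive_cst C0 x (delta_mx 0 l))).
have phi1P j l x : U x -> is_derive x (delta_mx 0 l) (phi1 j l) (phi2 j l x).
  by move=> Ux; exact: (Ck_extends_is_derive oU (delta_mx 0 l) (Eu1 j l 1) Ux).
have phi_ge0 j x : U x -> 0 <= phi j x <= 2 * C0.
  move=> Ux; have := u_le j x Ux; have := u_ge j x Ux; rewrite /phi => h1 h2.
  by apply/andP; split; lra.
have cphi j x : U x -> {for x, continuous (phi j)}.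
  move=> Ux; apply: (@continuousD _ _ _ (u j) (cst C0)); first exact: cu.
  exact: cst_continuous.
have cphi1 j l x : U x -> {for x, continuous (phi1 j l)}.
  by move=> Ux; exact: (Ck_extends_continuous oU (Eu1 j l 0) Ux).
have cphi2 j l x : U x -> {for x, continuous (phi2 j l)}.
  by move=> Ux; exact: (Ck_extends_continuous oU (Eu2 j l 0) Ux).
have adj_s j : adjoint_function U x0 (s j).
  by case: j; [exact: asol_fun1 adj|exact: asol_fun2 adj].
have cb j l x : U x -> {for x, continuous (fun y => b j y 0 l)}.
  by case: j => Ux; [exact: cb1|exact: cb2].
have cdb j l m x : U x -> {for x, continuous (db j l m)}.
  by case: j => Ux; [exact: cdb1|exact: cdb2].
have dbP j l m x : U x -> is_derive x (delta_mx 0 l) (fun y => b j y 0 m) (db j l m x).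
  by case: j => Ux; [exact: dbP1|exact: dbP2].
have div j x : U x -> `|\sum_l db j l l x| <= Num.max Mb1 Mb2.
  move=> Ux; rewrite le_max.
  by case: j; rewrite ?div1 ?div2 ?orbT.
(* The bounds [eps^-1] and [Num.max Mb1 Mb2], which depend on [eps], do not appear in the
   conclusion; only [Mphi = 2 * C0] and [alpha] do. *)
exact: (@adjoint_bound R n (ltnW n_ge2) gamma pen U rU x0 oU bU Ux0 s g eps^-1
  (Num.max Mb1 Mb2) (2 * C0) eps alpha adj_s cg gP b db cb cdb dbP div phi phi1 phi2
  phi_ge0 cphi cphi1 cphi2 phiP phi1P (ltW eps_gt0) alpha_gt0 phi_super k k0 k1 eqs).
Qed.
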